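(* Let $\beta>0$, let $b\geq 2$ be an integer, and fix $\theta\in[0,2\pi)$. For $N\in\mathbb{N}$ let $(\theta_1,\dots,\theta_N)$ be distributed according to the circular $\beta$-ensemble and let $D_{N,\beta}(\theta)=\prod_{j=1}^N(e^{i\theta}-e^{i\theta_j})$. Write the base-$b$ expansion of $|D_{N,\beta}(\theta)|$ as $$|D_{N,\beta}(\theta)|=\Big(\sum_{k=1}^\infty d_{k,N}(\theta)\,b^{1-k}\Big)b^{M},$$ where $M\in\mathbb{Z}$, $d_{k,N}(\theta)\in\{0,1,\dots,b-1\}$ and $d_{1,N}(\theta)\neq 0$. Then for every integer $\ell\geq 1$, every $k_1\in\{1,\dots,b-1\}$, every $k_2,\dots,k_\ell\in\{0,1,\dots,b-1\}$ and every $\varepsilon>0$, $$\left|\mathbb{P}\big(d_{1,N}(\theta)=k_1,\dots,d_{\ell,N}(\theta)=k_\ell\big)-\log_b\Big(1+\frac{1}{\sum_{j=1}^{\ell}k_j b^{\ell-j}}\Big)\right|=o\big((\log N)^{-3/2+\varepsilon}\big)\quad\text{as }N\to\infty.$$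
   Context: The circular $\beta$-ensemble (C$\beta$E) with $N$ points is the random vector $(\theta_1,\dots,\theta_N)\in[0,2\pi)^N$ whose law has density proportional to $\prod_{1\leq j<k\leq N}|e^{i\theta_j}-e^{i\theta_k}|^\beta$ with respect to Lebesgue measure $d\theta_1\cdots d\theta_N$. The law of $|D_{N,\beta}(\theta)|$ does not depend on $\theta$. *)

(* Defs.v *)
From HB Require Import structures.
From mathcomp Require Import all_boot all_order all_algebra.
From mathcomp Require Import all_classical all_reals all_analysis.
From mathcomp Require Import complex.
Set Implicit Arguments. Unset Strict Implicit. Unset Printing Implicit Defensive.
Import Order.TTheory GRing.Theory Num.Theory.
Local Open Scope classical_set_scope.
Local Open Scope ring_scope.

Section Defs.
Variable R : realType.

Definition expi (t : R) : R[i] := (cos t +i* sin t)%C.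

Definition cmod (z : R[i]) : R := Normc.normc z.

(* a configuration (theta_1,...,theta_N) is coded by th : nat -> R,
   theta_{j+1} = th j for j < N *)
Definition consR (x : R) (g : nat -> R) : nat -> R :=
  fun k => if k is k'.+1 then g k' else x.

(* iterated Lebesgue integral over [0,2pi)^n of a nonnegative integrand;
   by Tonelli this is the integral w.r.t. n-dimensional Lebesgue measure *)
Fixpoint iint (n : nat) (f : (nat -> R) -> \bar R) : \bar R :=
  match n with
  | 0 => f (fun _ => 0)
  | n'.+1 => (\int[lebesgue_measure]_(x in `[0%R, (2 * pi)%R[%classic)
                 iint n' (fun g => f (consR x g)))%E
  end.

Definition cbe_weight (N : nat) (beta : R) (th : nat -> R) : R :=
  \prod_(k < N) \prod_(j < k) (cmod (expi (th j) - expi (th k))) `^ beta.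

Definition cbe_prob (N : nat) (beta : R) (E : (nat -> R) -> Prop) : R :=
  fine (iint N (fun th => ((\1_E th) * cbe_weight N beta th)%:E)) /
  fine (iint N (fun th => (cbe_weight N beta th)%:E)).

Definition charpoly (N : nat) (th : nat -> R) (theta : R) : R[i] :=
  \prod_(j < N) (expi theta - expi (th j)).

Definition bexp (b : nat) (x : R) : int := Num.floor (ln x / ln b%:R).

(* k-th base-b significant digit (k >= 1) of x > 0, in the expansion
   x = (sum_{k>=1} d_k b^{1-k}) b^M, d_1 <> 0 (greedy / non-terminating-in-(b-1)
   convention); set to 0 when x <= 0 *)
Definition bdigit (b : nat) (k : nat) (x : R) : int :=
  if 0 < x then
    ((Num.floor (x * (b%:R `^ ((k%:R - 1) - (bexp b x)%:~R)))) %% b%:Z)%Z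
  else 0.

End Defs.

(* Main.v *)
Require Import Defs.
From HB Require Import structures.
From mathcomp Require Import all_boot all_order all_algebra.
From mathcomp Require Import all_classical all_reals all_analysis.
From mathcomp Require Import complex measurable_realfun.
From mathcomp Require Import ring lra zify.
Import Order.TTheory GRing.Theory Num.Theory.
Import numFieldNormedType.Exports.
Set Implicit Arguments. Unset Strict Implicit. Unset Printing Implicit Defensive.
Local Open Scope classical_set_scope.
Local Open Scope ring_scope.
Local Notation Re := complex.Re.
Local Notation Im := complex.Im.

(** Write [z_j = exp(i (theta_j - theta))], [y_j = 1 - z_j], so that
    [|D| = prod_j |y_j|], and put [lam = beta / 2].  Aomoto's method computes the
    ratio of consecutive moments: integrating by parts in [theta_p] the function
    [y_0 ... y_p conj(D)^e |D|^s w] (with [e = 0, 1] and [w] the weight of the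
    ensemble), and symmetrizing the singular terms in pairs of variables, gives
    [E |D|^(s+2) = r(s) E |D|^s] with
    [r(s) = prod_(j < N) (1 + s + lam j) (2 + s + lam j) / (1 + s/2 + lam j)^2].
    No analytic continuation in [s] is needed: iterating [n] times at
    [s = eta + i tau] and bounding the last moment by its modulus,
    [|E |D|^(eta + i tau)| <= (prod_(m < n) r(eta + 2m) / |r(eta + i tau + 2m)|) E |D|^eta],
    and for [n] of order [N] the product is at most a negative power of [N].
    Letting [eta] tend to [0] and majorizing the indicator of an arc by Fejer
    sums, [log_b |D|] is equidistributed modulo [1] up to a negative power of
    [ln N]; the digits of [|D|] depend only on [log_b |D|] modulo [1].

    Integrals are replaced by sums over a regular grid of mesh [2 pi / K], where
    integration by parts is invariance under a rotation of one coordinate by one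
    mesh, and where complex values and permutations of the variables cost nothing.
    The kernels [|z_j - z_k|^beta] and [|y_j|^s] are smoothed by adding [d > 0] to
    the squared distances. *)

(** * Complex moduli and uniform continuity *)

Section ComplexModulus.
Variable R : realType.
Implicit Types (z w : R[i]) (x a b : R).
Local Notation cmod := (@cmod R).
Local Notation expi := (@expi R).

(** The code works with squared distances: [wreg a t] carries [|D|^s] with [s = 2 (a + i t)], so
    raising [a] by 1 raises [s] by 2. A purely imaginary power has no limit at a zero of [D],
    whereas the passage [d -> 0] must be uniform over all grid points; hence a tilt [a > 0], removed
    only at the end, for fixed [N]. This works because the decay rate of the oscillating moments is
    uniform in [0 < a <= 1/2], while [|D|^2 <= 4^N] and the lower bound on the moment of order [a]
    make the tilt cost arbitrarily little. Off the real axis [|r|] exceeds its value at the real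
    part. For [|t|] bounded below, each pair [(m, j)] with [j > 0] and [2 m <= lam j] contributes a
    gain of order at least [1 / j^2]. There are at least [lam j / 2] such [m], so the double sum is
    bounded below by a harmonic sum, whence a power of [N]. That power beats every power of [ln N],
    so the Fejer order and the width of smoothing may be powers of [ln N]: [(ln N)^6] and
    [(ln N)^-2] give an error [O((ln N)^-2)], half a power better than the exponent [3/2]. *)

Lemma cmodE z : cmod z = Num.sqrt (Re z ^+ 2 + Im z ^+ 2).
Proof. by case: z. Qed.

Lemma cmod_ge0 z : 0 <= cmod z.
Proof. by rewrite cmodE sqrtr_ge0. Qed.

Lemma cmod_sq z : cmod z ^+ 2 = Re z ^+ 2 + Im z ^+ 2.
Proof. by rewrite cmodE sqr_sqrtr// addr_ge0// sqr_ge0. Qed.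

Lemma cmodM z w : cmod (z * w) = cmod z * cmod w.
Proof. exact: Normc.normcM. Qed.

Lemma cmodN z : cmod (- z) = cmod z.
Proof. exact: normcN. Qed.

Lemma cmodD_le z w : cmod (z + w) <= cmod z + cmod w.
Proof. exact: le_normcD. Qed.

Lemma cmodB_le z w : cmod (z - w) <= cmod z + cmod w.
Proof. by rewrite -[cmod w]cmodN cmodD_le. Qed.

Lemma cmod1 : cmod 1 = 1.
Proof. exact: Normc.normc1. Qed.

Lemma cmod0 : cmod 0 = 0.
Proof. exact: Normc.normc0. Qed.

Lemma cmodX z n : cmod (z ^+ n) = cmod z ^+ n.
Proof. by elim: n => [|n IH]; rewrite ?expr0 ?cmod1// !exprS cmodM IH. Qed.

Lemma cmod_prod (I : Type) (r : seq I) (P : pred I) (F : I -> R[i]) :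
  cmod (\prod_(i <- r | P i) F i) = \prod_(i <- r | P i) cmod (F i).
Proof. by apply: (big_morph _ cmodM cmod1). Qed.

Lemma cmod_sum (I : Type) (r : seq I) (P : pred I) (F : I -> R[i]) :
  cmod (\sum_(i <- r | P i) F i) <= \sum_(i <- r | P i) cmod (F i).
Proof.
elim/big_ind2 : _ => [|x1 x2 y1 y2 h1 h2|//]; first by rewrite cmod0.
by apply: le_trans (cmodD_le _ _) _; exact: lerD.
Qed.

Lemma cmod_real x : cmod x%:C%C = `|x|.
Proof. by rewrite cmodE /= expr0n addr0 sqrtr_sqr. Qed.

Lemma cmod_conj z : cmod (conjc z) = cmod z.
Proof. by case: z => a b; rewrite !cmodE /= sqrrN. Qed.

Lemma Re_le_cmod z : `|Re z| <= cmod z.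
Proof.
by rewrite -ler_sqr ?nnegrE ?cmod_ge0// cmod_sq real_normK ?num_real// lerDl sqr_ge0.
Qed.

Lemma Im_le_cmod z : `|Im z| <= cmod z.
Proof.
by rewrite -ler_sqr ?nnegrE ?cmod_ge0// cmod_sq real_normK ?num_real// lerDr sqr_ge0.
Qed.

Lemma cmod_le_ReIm z : cmod z <= `|Re z| + `|Im z|.
Proof.
rewrite -ler_sqr ?nnegrE ?cmod_ge0 ?addr_ge0// cmod_sq sqrrD.
rewrite !real_normK ?num_real//.
have : 0 <= `|Re z| * `|Im z| by rewrite mulr_ge0.
rewrite mulr2n; lra.
Qed.

Lemma mul_conj_cmod z : z * conjc z = (cmod z ^+ 2)%:C%C.
Proof.
by case: z => a b; rewrite cmod_sq; apply/eqP; rewrite eq_complex /=; apply/andP;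
   split; apply/eqP; ring.
Qed.

Lemma expiD a b : expi (a + b) = expi a * expi b.
Proof.
rewrite /expi cosD sinD; apply/eqP; rewrite eq_complex /=.
by rewrite !eqxx/= [sin a * cos b + _]addrC [_ * sin b + _]addrC addrC eqxx.
Qed.

Lemma expi0 : expi 0 = 1.
Proof. by rewrite /expi cos0 sin0. Qed.

Lemma conj_expi a : conjc (expi a) = expi (- a).
Proof. by rewrite /expi cosN sinN. Qed.

Lemma cmod_expi a : cmod (expi a) = 1.
Proof. by rewrite cmodE /= cos2Dsin2 sqrtr1. Qed.

Lemma expi_mul_conj a : expi a * conjc (expi a) = 1.
Proof. by rewrite mul_conj_cmod cmod_expi expr1n. Qed.

Lemma expi2pi a : expi (a + 2 * pi) = expi a.
Proof. by rewrite /expi mulr_natl cosD2pi sinD2pi. Qed.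

Lemma cmod_sub_expi a b : cmod (expi a - expi b) ^+ 2 = 2 - 2 * cos (a - b).
Proof.
rewrite cmod_sq /= cosB.
have := cos2Dsin2 a; have := cos2Dsin2 b; rewrite !expr2; nra.
Qed.

End ComplexModulus.

Section HeineCantor.
Variable R : realType.

(** Only the base point [x] is confined to a bounded set, while [y] is free, so later uses need a
    bound on one argument only. Compactness enters as near covering: what holds near each point for
    all small radii holds on the whole segment for all small radii at once. *)
Lemma heine_cantor (f : R -> R) (B : R) : continuous f ->
  forall e, 0 < e -> exists2 d, 0 < d & forall x y, `|x| <= B -> `|y - x| < d ->
    `|f y - f x| <= e.
Proof.
move=> cf e e0.
pose P (d x : R) := 0 < d -> forall y, `|y - x| < d -> `|f y - f x| <= e.
have := @compact_near_coveringP _ `[- B, B]%classic.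
move=> [+ _] => /(_ (@segment_compact _ _ _)) /(_ _ (0^'+)%classic P _) [].
  move=> x _; have e2 : 0 < e / 2 by rewrite divr_gt0.
  have /cvgrPdist_lt /(_ _ e2) := cf x.
  move=> /nbhs_ballP[d /= d0' hd]; have d0 : 0 < d by exact: d0'.
  have hd' z : `|x - z| < d -> `|f x - f z| < e / 2 by move=> h; apply: hd.
  exists (ball x (d / 2), [set u : R | u < d / 2]) => /=.
    split; first by apply: nbhsx_ballx; rewrite divr_gt0.
    by apply: nbhs_right_lt; rewrite divr_gt0.
  move=> [z u] [/= hz hu] u0 y hy.
  have h1 := hd' z; have h2 := hd' y.
  have hz' : `|x - z| < d / 2 by exact: hz.
  have h3 : `|x - z| < d by lra.
  have h4 : `|x - y| < d.
    have -> : x - y = (x - z) + (z - y) by ring.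
    apply: le_lt_trans (ler_normD _ _) _; rewrite [`|z - y|]distrC.
    lra.
  have -> : f y - f z = (f x - f z) - (f x - f y) by ring.
  apply: le_trans (ler_normB _ _) _; have := h1 h3; have := h2 h4; lra.
move=> d /= d0 hd.
exists (d / 2); first by rewrite divr_gt0.
move=> x y xB hy.
have d2 : 0 < d / 2 by rewrite divr_gt0.
apply: (hd (d / 2) _ d2 x _ d2 y hy) => /=.
  by rewrite sub0r normrN gtr0_norm// ltr_pdivrMr// ltr_pMr// ltr1n.
by rewrite in_itv/= -ler_norml.
Qed.

End HeineCantor.

(** * Grid sums *)

Section GridSums.
Variables (R : realType) (N : nat).
Local Notation conf := ('I_N -> R).
Local Notation cmod := (@cmod R).
Local Notation expi := (@expi R).

Definition grid_pt (K : nat) (g : {ffun 'I_N -> 'I_K}) : conf :=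
  fun j => 2 * pi * (g j)%:R / K%:R.

Definition gsum (V : nmodType) (K : nat) (f : conf -> V) : V :=
  \sum_(g : {ffun 'I_N -> 'I_K}) f (grid_pt g).

(** The grid has [K ^ N] points, so this says that the grid average tends to 0. It plays the role of
    a vanishing integral, for complex integrands whose averages need not be known to converge
    separately. *)
Definition negl (f : conf -> R[i]) : Prop :=
  forall e : R, 0 < e -> exists K0 : nat, forall K, (K0 <= K)%N ->
    cmod (gsum K f) <= e * K%:R ^+ N.

Definition shift (p : 'I_N) (h : R) (th : conf) : conf :=
  fun j => if j == p then th j + h else th j.

Definition circular (V : Type) (f : conf -> V) : Prop :=
  forall th th', (forall j, expi (th j) = expi (th' j)) -> f th = f th'.

Lemma eq_gsum (V : nmodType) K (f g : conf -> V) :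
  f =1 g -> gsum K f = gsum K g.
Proof. by move=> fg; apply: eq_bigr => i _. Qed.

Lemma gsumD (V : nmodType) K (f g : conf -> V) :
  gsum K (fun th => f th + g th) = gsum K f + gsum K g.
Proof. exact: big_split. Qed.

Lemma gsumZ (V : pzSemiRingType) K (c : V) (f : conf -> V) :
  gsum K (fun th => c * f th) = c * gsum K f.
Proof. by rewrite /gsum big_distrr. Qed.

Lemma gsum_sum (V : nmodType) K (I : Type) (r : seq I) (P : pred I)
    (F : I -> conf -> V) :
  gsum K (fun th => \sum_(i <- r | P i) F i th) = \sum_(i <- r | P i) gsum K (F i).
Proof. exact: exchange_big. Qed.

Lemma gsum_morph (V W : nmodType) K (u : V -> W) (f : conf -> V) :
  {morph u : x y / x + y} -> u 0 = 0 ->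
  gsum K (fun th => u (f th)) = u (gsum K f).
Proof. by move=> uD u0; rewrite /gsum (big_morph u uD u0). Qed.

Lemma gsum_cst (e : R) K : gsum K (fun=> e) = e * K%:R ^+ N.
Proof.
by rewrite /gsum sumr_const card_ffun !card_ord -[e *+ _]mulr_natr natrX.
Qed.

Lemma ler_gsum K (f g : conf -> R) : (forall th, f th <= g th) ->
  gsum K f <= gsum K g.
Proof. by move=> fg; apply: ler_sum => i _. Qed.

Lemma cmod_gsum K (f : conf -> R[i]) :
  cmod (gsum K f) <= gsum K (fun th => cmod (f th)).
Proof. exact: cmod_sum. Qed.

Lemma gsum_bound K (f : conf -> R[i]) (e : R) :
  (forall th, cmod (f th) <= e) -> cmod (gsum K f) <= e * K%:R ^+ N.
Proof.
move=> fe; rewrite -gsum_cst; apply: le_trans (cmod_gsum _ _) _.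
exact: ler_gsum.
Qed.

Lemma gsum_involutive (V : nmodType) K (f : conf -> V) (s : 'I_N -> 'I_N) :
  involutive s -> gsum K (fun th => f (fun j => th (s j))) = gsum K f.
Proof.
move=> sK.
rewrite /gsum [RHS](reindex_inj (h := fun g : {ffun 'I_N -> 'I_K} =>
  [ffun j => g (s j)])) /=.
  apply: eq_bigr => g _; congr f; apply/funext => j.
  by rewrite /grid_pt ffunE.
move=> g g' /ffunP gg'; apply/ffunP => j.
by have := gg' (s j); rewrite !ffunE sK.
Qed.

(** A rotation by one mesh permutes the grid: the index [g p] moves to its cyclic successor, and at
    the last index the extra turn of [2 pi] is absorbed by [circular]. *)
Lemma gsum_shift (V : nmodType) K (p : 'I_N) (f : conf -> V) : circular f ->
  gsum K.+1 (fun th => f (shift p (2 * pi / K.+1%:R) th)) = gsum K.+1 f.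
Proof.
move=> cf.
rewrite /gsum [RHS](reindex_inj (h := fun g : {ffun 'I_N -> 'I_K.+1} =>
  [ffun j => if j == p then ordS (g j) else g j])) /=.
  apply: eq_bigr => g _; apply: cf => j.
  rewrite /grid_pt /shift ffunE; case: eqP => // _.
  have K0 : K.+1%:R != 0 :> R by rewrite pnatr_eq0.
  have [gK|gK] := eqVneq (g j : nat) K.
    rewrite gK /= gK modnn mulr0 mul0r -mulrDl -{2}[2 * pi]mulr1 -mulrDr natr1.
    by rewrite mulfK// -[2 * pi]add0r expi2pi.
  rewrite /= modn_small; last by rewrite ltnS ltn_neqAle gK -ltnS ltn_ord.
  by rewrite -mulrDl -{2}[2 * pi]mulr1 -mulrDr natr1.
move=> g g' /ffunP gg'; apply/ffunP => j.
have := gg' j; rewrite !ffunE; case: eqP => // _.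
exact: ordS_inj.
Qed.

Lemma negl_ext (f g : conf -> R[i]) :
  (forall K, gsum K f = gsum K g) -> negl f -> negl g.
Proof. by move=> fg nf e /nf [K0 h]; exists K0 => K /h; rewrite fg. Qed.

Lemma neglD (f g : conf -> R[i]) :
  negl f -> negl g -> negl (fun th => f th + g th).
Proof.
move=> nf ng e e0; have e2 : 0 < e / 2 by rewrite divr_gt0.
have [K1 h1] := nf _ e2; have [K2 h2] := ng _ e2.
exists (maxn K1 K2) => K; rewrite geq_max => /andP[/h1 a1 /h2 a2].
rewrite gsumD; apply: le_trans (cmodD_le _ _) _.
apply: le_trans (lerD a1 a2) _; rewrite -mulrDl; have -> : e / 2 + e / 2 = e by lra.
by [].
Qed.

Lemma neglZ (c : R[i]) (f : conf -> R[i]) :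
  negl f -> negl (fun th => c * f th).
Proof.
move=> nf e e0.
have c1 : 0 < cmod c + 1 by rewrite ltr_wpDl ?cmod_ge0.
have [K0 h] := nf _ (divr_gt0 e0 c1); exists K0 => K /h {}h.
rewrite gsumZ cmodM.
apply: le_trans (_ : (cmod c + 1) * (e / (cmod c + 1) * K%:R ^+ N) <= _); last first.
  by rewrite mulrA mulrCA mulfV ?gt_eqF// mulr1.
apply: ler_pM => //; rewrite ?cmod_ge0//.
by rewrite lerDl.
Qed.

Lemma negl_approx (f : conf -> R[i]) :
  (forall e, 0 < e -> exists2 g, negl g & forall th, cmod (f th - g th) <= e) ->
  negl f.
Proof.
move=> H e e0; have e2 : 0 < e / 2 by rewrite divr_gt0.
have [g /(_ _ e2) [K0 ng] fg] := H _ e2; exists K0 => K /ng h.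
have -> : gsum K f = gsum K g + gsum K (fun th => f th - g th).
  by rewrite -gsumD; apply: eq_gsum => th; rewrite addrC subrK.
apply: le_trans (cmodD_le _ _) _.
apply: le_trans (lerD h (gsum_bound K fg)) _.
by rewrite -mulrDl; have -> : e / 2 + e / 2 = e by lra.
Qed.

Lemma negl_conj (f : conf -> R[i]) : negl f -> negl (fun th => conjc (f th)).
Proof.
move=> nf e /nf [K0 h]; exists K0 => K /h {}h.
rewrite (@gsum_morph _ _ K (@conjc R)) ?cmod_conj//.
  exact: rmorphD.
exact: rmorph0.
Qed.

End GridSums.

(** * Derivatives in one coordinate, uniform over all configurations *)

Section UniformDerivative.
Variables (R : realType) (N : nat) (p : 'I_N).
Local Notation conf := ('I_N -> R).
Local Notation cmod := (@cmod R).
Local Notation expi := (@expi R).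

Definition bounded_conf (f : conf -> R[i]) : Prop :=
  exists2 B, 0 <= B & forall th, cmod (f th) <= B.

(** The increment is positive because it will be the mesh of the grid, and [d] does not depend on
    the configuration because the error is summed over the whole grid. The two bounds are what the
    product rule consumes. *)
Definition uderiv (f f' : conf -> R[i]) : Prop :=
  [/\ bounded_conf f, bounded_conf f' & forall e : R, 0 < e ->
    exists2 d : R, 0 < d & forall h : R, 0 < h < d -> forall th,
      cmod (f (shift p h th) - f th - h%:C%C * f' th) <= e * h].

Lemma eq_uderiv (f g f' g' : conf -> R[i]) :
  f =1 g -> f' =1 g' -> uderiv f f' -> uderiv g g'.
Proof. by move=> /funext-> /funext->. Qed.

Lemma uderiv_cst (f : conf -> R[i]) : bounded_conf f ->
  (forall h th, f (shift p h th) = f th) -> uderiv f (fun=> 0).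
Proof.
move=> bf fs; split => //; first by exists 0 => // th; rewrite cmod0.
move=> e e0; exists 1 => // h /andP[h0 _] th.
by rewrite fs subrr sub0r mulr0 oppr0 cmod0 mulr_ge0// ltW.
Qed.

Lemma uderivM (f g f' g' : conf -> R[i]) : uderiv f f' -> uderiv g g' ->
  uderiv (fun th => f th * g th) (fun th => f' th * g th + f th * g' th).
Proof.
move=> [[Bf Bf0 hBf] [Cf Cf0 hCf] hf] [[Bg Bg0 hBg] [Cg Cg0 hCg] hg]; split.
- by exists (Bf * Bg); rewrite ?mulr_ge0// => th; rewrite cmodM ler_pM ?cmod_ge0.
- exists (Cf * Bg + Bf * Cg); rewrite ?addr_ge0 ?mulr_ge0// => th.
  by apply: le_trans (cmodD_le _ _) _; rewrite !cmodM lerD// ler_pM ?cmod_ge0.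
move=> e e0.
have e1 : 0 < e / (3 * (Bg + 1)) by rewrite divr_gt0// mulr_gt0// ltr_wpDl.
have e2 : 0 < e / (3 * (Bf + 1)) by rewrite divr_gt0// mulr_gt0// ltr_wpDl.
have [d1 d10 h1] := hf _ e1; have [d2 d20 h2] := hg _ e2.
have [d3 d30 h3] := hg _ ltr01.
have d40 : 0 < e / (3 * ((Cf + 1) * (Cg + 1))).
  by rewrite divr_gt0// mulr_gt0// mulr_gt0// ltr_wpDl.
exists (Num.min (Num.min d1 d2) (Num.min d3 (e / (3 * ((Cf + 1) * (Cg + 1)))))).
  by rewrite !lt_min d10 d20 d30.
move=> h /andP[h0]; rewrite !lt_min => /andP[/andP[hd1 hd2] /andP[hd3 hd4]] th.
have {}h1 := h1 h; rewrite h0 hd1 in h1; have {}h1 := h1 isT th.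
have {}h2 := h2 h; rewrite h0 hd2 in h2; have {}h2 := h2 isT th.
have {}h3 := h3 h; rewrite h0 hd3 in h3; have {}h3 := h3 isT th.
set fs := f (shift p h th); set gs := g (shift p h th) in h2 h3 *.
have -> : fs * gs - f th * g th - h%:C%C * (f' th * g th + f th * g' th) =
  (fs - f th - h%:C%C * f' th) * gs + h%:C%C * f' th * (gs - g th)
   + f th * (gs - g th - h%:C%C * g' th) by ring.
have hgs : cmod (gs - g th) <= (Cg + 1) * h.
  have -> : gs - g th = (gs - g th - h%:C%C * g' th) + h%:C%C * g' th by ring.
  apply: le_trans (cmodD_le _ _) _; rewrite addrC mulrDl lerD//.
  by rewrite cmodM cmod_real gtr0_norm// mulrC ler_pM2r.
apply: le_trans (cmodD_le _ _) _.
have -> : e * h = e * h / 3 + e * h / 3 + e * h / 3 by lra.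
apply: lerD; first (apply: le_trans (cmodD_le _ _) _; apply: lerD).
- rewrite cmodM.
  apply: le_trans (ler_pM _ _ h1 (hBg _)) _; rewrite ?cmod_ge0//.
  apply: le_trans (_ : e / (3 * (Bg + 1)) * h * (Bg + 1) <= _).
    by rewrite ler_wpM2l ?lerDl// mulr_ge0// ltW.
  rewrite le_eqVlt; apply/orP; left; apply/eqP; field.
  by rewrite gt_eqF// ltr_wpDl.
- rewrite !cmodM cmod_real gtr0_norm//.
  apply: le_trans (_ : h * (Cf + 1) * ((Cg + 1) * h) <= _).
    apply: ler_pM => //; rewrite ?cmod_ge0//.
      by rewrite mulr_ge0 ?cmod_ge0// ltW.
    by rewrite ler_pM2l//; apply: le_trans (hCf th) _; rewrite lerDl.
  have -> : e * h / 3 = h * (e / 3) by ring.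
  rewrite -!mulrA ler_pM2l//.
  move: hd4; rewrite ltr_pdivlMr; last by rewrite mulr_gt0// mulr_gt0// ltr_wpDl.
  nra.
- rewrite cmodM.
  apply: le_trans (ler_pM _ _ (hBf th) h2) _; rewrite ?cmod_ge0//.
  apply: le_trans (_ : (Bf + 1) * (e / (3 * (Bf + 1)) * h) <= _).
    by rewrite ler_wpM2r ?lerDl// mulr_ge0// ltW.
  rewrite le_eqVlt; apply/orP; left; apply/eqP; field.
  by rewrite gt_eqF// ltr_wpDl.
Qed.

(** Derivatives are carried as [L * F], so logarithmic derivatives add up without dividing by
    factors that may vanish. *)
Lemma logderiv_prod (I : Type) (r : seq I) (P : pred I) (F L : I -> conf -> R[i]) :
  (forall i, P i -> uderiv (F i) (fun th => L i th * F i th)) ->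
  uderiv (fun th => \prod_(i <- r | P i) F i th)
    (fun th => (\sum_(i <- r | P i) L i th) * \prod_(i <- r | P i) F i th).
Proof.
move=> H; elim: r => [|i r IH].
  apply: eq_uderiv (uderiv_cst (f := fun=> 1) _ _) => //.
  - by move=> th; rewrite big_nil.
  - by move=> th; rewrite !big_nil mul0r.
  - by exists 1 => // th; rewrite cmod1.
case: (boolP (P i)) => Pi; last first.
  apply: eq_uderiv IH => th; first by rewrite big_cons (negbTE Pi).
  by rewrite !big_cons (negbTE Pi).
apply: eq_uderiv (uderivM (H i Pi) IH) => th; rewrite !big_cons Pi//.
by ring.
Qed.

(** Integration by parts: by rotation invariance the increments of [f] over one mesh sum to 0, so
    the mesh times the sum of [f'] is a pure Taylor error. That error is [e] times the mesh per grid
    point, and the mesh cancels. *)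
Lemma negl_uderiv (f f' : conf -> R[i]) : circular f -> uderiv f f' -> negl f'.
Proof.
move=> cf [_ _ H] e e0; have [d d0 h] := H _ e0.
have pi0 := pi_gt0 R.
exists (Num.truncn (2 * pi / d)).+1 => -[//|K] Kd.
set k : R := 2 * pi / K.+1%:R.
have k0 : 0 < k by rewrite divr_gt0// mulr_gt0.
have kd : k < d.
  rewrite /k ltr_pdivrMr// [d * _]mulrC -ltr_pdivrMr//.
  by rewrite -truncn_lt_nat ?ltW// divr_gt0// mulr_gt0.
have {}h := h k; rewrite k0 kd in h; have {}h := h isT.
have E : - (k%:C%C * gsum K.+1 f') =
    gsum K.+1 (fun th => f (shift p k th) - f th - k%:C%C * f' th).
  transitivity (gsum K.+1 (fun th => f (shift p k th) + ((-1) * f th +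
     (- k%:C%C) * f' th))).
    by rewrite !gsumD gsum_shift// !gsumZ; ring.
  by apply: eq_gsum => th; ring.
have := gsum_bound K.+1 h; rewrite -E cmodN cmodM cmod_real gtr0_norm//.
by rewrite (mulrAC e) (mulrC k) ler_pM2r.
Qed.

End UniformDerivative.

(** * Uniform limits of integrands *)

Section UniformLimit.
Variables (R : realType) (N : nat).
Local Notation conf := ('I_N -> R).
Local Notation cmod := (@cmod R).

(** Convergence is uniform because a grid may contain the singular configurations at every [K]. The
    common bound is what makes products converge. *)
Definition ulim (f : R -> conf -> R[i]) (f0 : conf -> R[i]) : Prop :=
  (exists2 B : R, 0 <= B & (forall d : R, 0 < d <= 1 -> forall th, cmod (f d th) <= B) /\
    forall th, cmod (f0 th) <= B) /\
  forall e : R, 0 < e -> exists2 d0 : R, 0 < d0 & forall d : R, 0 < d < d0 ->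
    forall th, cmod (f d th - f0 th) <= e.

Lemma eq_ulim f g f0 g0 : (forall d : R, 0 < d -> f d =1 g d) -> f0 =1 g0 ->
  ulim f f0 -> ulim g g0.
Proof.
move=> fg fg0 [[B B0 [h1 h2]] H]; split.
  exists B => //; split => [d hd th|th]; last by rewrite -fg0.
  by rewrite -fg ?h1//; case/andP: hd.
move=> e /H[d0 d00 h]; exists d0 => // d hd th.
by rewrite -fg -?fg0 ?h//; case/andP: hd.
Qed.

Lemma ulim_cst f0 : bounded_conf f0 -> ulim (fun=> f0) f0.
Proof.
move=> [B B0 h]; split; first by exists B.
by move=> e e0; exists 1 => // d _ th; rewrite subrr cmod0 ltW.
Qed.

Lemma ulimD f g f0 g0 : ulim f f0 -> ulim g g0 ->
  ulim (fun d th => f d th + g d th) (fun th => f0 th + g0 th).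
Proof.
move=> [[B B0 [h1 h2]] H] [[C C0 [k1 k2]] K]; split.
  exists (B + C); first exact: addr_ge0.
  split=> [d dd th|th]; apply: le_trans (cmodD_le _ _) _; apply: lerD => //.
    exact: h1.
  exact: k1.
move=> e e0; have e2 : 0 < e / 2 by rewrite divr_gt0.
have [d1 d10 m1] := H _ e2; have [d2 d20 m2] := K _ e2.
exists (Num.min d1 d2); rewrite ?lt_min ?d10// => d /andP[d0].
rewrite lt_min => /andP[dd1 dd2] th.
have -> : f d th + g d th - (f0 th + g0 th) = (f d th - f0 th) + (g d th - g0 th).
  by ring.
apply: le_trans (cmodD_le _ _) _; rewrite [e]splitr; apply: lerD.
  by apply: m1; rewrite d0.
by apply: m2; rewrite d0.
Qed.

Lemma ulimM f g f0 g0 : ulim f f0 -> ulim g g0 ->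
  ulim (fun d th => f d th * g d th) (fun th => f0 th * g0 th).
Proof.
move=> [[B B0 [h1 h2]] H] [[C C0 [k1 k2]] K]; split.
  exists (B * C); first exact: mulr_ge0.
  split=> [d dd th|th]; rewrite cmodM; apply: ler_pM; rewrite ?cmod_ge0//.
    exact: h1.
  exact: k1.
move=> e e0.
have e1 : 0 < e / 2 / (C + 1) by rewrite !divr_gt0// ltr_wpDl.
have e2 : 0 < e / 2 / (B + 1) by rewrite !divr_gt0// ltr_wpDl.
have [d1 d10 m1] := H _ e1; have [d2 d20 m2] := K _ e2.
exists (Num.min 1 (Num.min d1 d2)); rewrite ?lt_min ?ltr01 ?d10// => d /andP[d0].
rewrite !lt_min => /and3P[dl1 dd1 dd2] th.
have -> : f d th * g d th - f0 th * g0 th =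
   (f d th - f0 th) * g d th + f0 th * (g d th - g0 th) by ring.
apply: le_trans (cmodD_le _ _) _; rewrite [e]splitr !cmodM; apply: lerD.
  apply: le_trans (_ : e / 2 / (C + 1) * (C + 1) <= _).
    apply: ler_pM; rewrite ?cmod_ge0//; first by apply: m1; rewrite d0.
    apply: le_trans (k1 _ _ _) _; first by rewrite d0 ltW.
    by rewrite lerDl.
  by rewrite divfK// gt_eqF// ltr_wpDl.
apply: le_trans (_ : (B + 1) * (e / 2 / (B + 1)) <= _).
  apply: ler_pM; rewrite ?cmod_ge0//; last by apply: m2; rewrite d0.
  by apply: le_trans (h2 _) _; rewrite lerDl.
by rewrite mulrC divfK// gt_eqF// ltr_wpDl.
Qed.

Lemma ulim_sum (I : Type) (r : seq I) (P : pred I) F F0 :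
  (forall i, P i -> ulim (F i) (F0 i)) ->
  ulim (fun d th => \sum_(i <- r | P i) F i d th)
       (fun th => \sum_(i <- r | P i) F0 i th).
Proof.
move=> H; elim: r => [|i r IH].
  apply: eq_ulim (ulim_cst (f0 := fun=> 0) _) => [d _ th|th|]; rewrite ?big_nil//.
  by exists 0 => // th; rewrite cmod0.
have [Pi|Pi] := boolP (P i); last first.
  by apply: eq_ulim IH => [d _ th|th]; rewrite big_cons (negbTE Pi).
by apply: eq_ulim (ulimD (H i Pi) IH) => [d _ th|th]; rewrite big_cons Pi.
Qed.

Lemma ulim_prod (I : Type) (r : seq I) (P : pred I) F F0 :
  (forall i, P i -> ulim (F i) (F0 i)) ->
  ulim (fun d th => \prod_(i <- r | P i) F i d th)
       (fun th => \prod_(i <- r | P i) F0 i th).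
Proof.
move=> H; elim: r => [|i r IH].
  apply: eq_ulim (ulim_cst (f0 := fun=> 1) _) => [d _ th|th|]; rewrite ?big_nil//.
  by exists 1 => // th; rewrite cmod1.
have [Pi|Pi] := boolP (P i); last first.
  by apply: eq_ulim IH => [d _ th|th]; rewrite big_cons (negbTE Pi).
by apply: eq_ulim (ulimM (H i Pi) IH) => [d _ th|th]; rewrite big_cons Pi.
Qed.

Lemma negl_ulim f f0 : (forall d : R, 0 < d -> negl (f d)) -> ulim f f0 -> negl f0.
Proof.
move=> nf [_ H]; apply: negl_approx => e e0; have [d0 d00 h] := H _ e0.
exists (f (d0 / 2)); first by apply: nf; rewrite divr_gt0.
move=> th; rewrite -cmodN opprB; apply: h.
by rewrite divr_gt0//= ltr_pdivrMr// ltr_pMr// ltr1n.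
Qed.

(* The weight [q / (q + d)] tends to [1], but only where [q] stays away from [0];
   the bound on [f] covers the remaining region. *)
Lemma ulim_ratio f f0 (q : conf -> R) (a B : R) : 0 < a -> 0 <= B ->
  (forall th, 0 <= q th) ->
  (forall d : R, 0 < d <= 1 -> forall th, cmod (f d th) <= B * (q th + d) `^ a) ->
  ulim f f0 ->
  ulim (fun d th => (q th / (q th + d))%:C%C * f d th) f0.
Proof.
move=> a0 B0 q0 fB uf.
have qd d th : 0 < d -> 0 < q th + d by move=> d0; rewrite ltr_wpDl.
have r01 d th : 0 < d -> 0 <= q th / (q th + d) <= 1.
  move=> d0; rewrite divr_ge0 ?(ltW (qd _ _ _))//= ler_pdivrMr ?qd// mul1r lerDl.
  exact: ltW.
have [[C C0 [c1 c2]] H] := uf.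
split.
  exists C => //; split=> // d dd th; rewrite cmodM cmod_real.
  have /andP[d0 _] := dd; have /andP[r0 r1] := r01 d th d0.
  rewrite ger0_norm//; apply: le_trans (c1 d dd th).
  by rewrite ler_piMl ?cmod_ge0.
move=> e e0; have e2 : 0 < e / 2 by rewrite divr_gt0.
have [d1 d10 m1] := H _ e2.
(* Threshold for [q + d]: below it the bound [B * (q + d) ^ a] is at most [e / 2]; above it the
   defect [d / (q + d)] is at most [d / k], made small by the choice of [d2]. *)
pose k := (e / 2 / (B + 1)) `^ a^-1.
have k0 : 0 < k by rewrite powR_gt0// !divr_gt0// ltr_wpDl.
have kB : B * k `^ a <= e / 2.
  have k1 : 0 <= e / 2 / (B + 1) by rewrite ltW// !divr_gt0// ltr_wpDl.
  rewrite /k -powRrM mulVf ?gt_eqF// powRr1//.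
  apply: le_trans (_ : (B + 1) * (e / 2 / (B + 1)) <= _).
    by apply: ler_pM => //; rewrite ?lerDl// !divr_ge0// ?ltW// ltr_wpDl.
  by rewrite mulrC divfK// gt_eqF// ltr_wpDl.
pose d2 := k * (e / 2) / (C + 1).
have d20 : 0 < d2 by rewrite divr_gt0 ?mulr_gt0// ltr_wpDl.
exists (Num.min 1 (Num.min d1 d2)); first by rewrite !lt_min ltr01 d10.
move=> d /andP[d0]; rewrite !lt_min => /and3P[dl1 dd1 dd2] th.
have dd : 0 < d <= 1 by rewrite d0 ltW.
have E : (q th / (q th + d))%:C%C * f d th - f0 th =
   (f d th - f0 th) - (d / (q th + d))%:C%C * f d th.
  have -> : q th / (q th + d) = 1 - d / (q th + d).
    by field; rewrite gt_eqF// qd.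
  by rewrite rmorphB rmorph1; ring.
rewrite E; apply: le_trans (cmodB_le _ _) _; rewrite [e]splitr; apply: lerD.
  by apply: m1; rewrite d0.
rewrite cmodM cmod_real ger0_norm; last by rewrite divr_ge0// ltW ?qd.
have [qk|qk] := lerP k (q th + d).
  apply: le_trans (_ : d / k * C <= _).
    apply: ler_pM; rewrite ?cmod_ge0//; last exact: c1.
      by rewrite divr_ge0// ltW ?qd.
    by rewrite ler_pM2l// lef_pV2 ?posrE ?qd.
  apply: le_trans (_ : d2 / k * (C + 1) <= _).
    apply: ler_pM => //; rewrite ?lerDl//; first by rewrite divr_ge0// ltW.
    by rewrite ler_pM2r ?invr_gt0// ltW.
  rewrite /d2 le_eqVlt; apply/orP; left; apply/eqP; field.
  by rewrite !gt_eqF// ltr_wpDl.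
apply: le_trans (_ : 1 * (B * k `^ a) <= _); last by rewrite mul1r.
apply: ler_pM; rewrite ?cmod_ge0//.
- by rewrite divr_ge0// ltW ?qd.
- by rewrite ler_pdivrMr ?qd// mul1r lerDr.
apply: le_trans (fB _ dd _) _; rewrite ler_wpM2l//.
apply: ge0_ler_powR; rewrite ?nnegrE ?ltW// ?qd//.
Qed.

End UniformLimit.

(** * Complex powers *)

Section UniformContinuity.
Variable R : realType.

Definition ucont (f : R -> R) : Prop := forall e : R, 0 < e ->
  exists2 d : R, 0 < d & forall x y, `|y - x| < d -> `|f y - f x| <= e.

Lemma ucontM (f g : R -> R) (B C : R) :
  (forall x, `|f x| <= B) -> (forall x, `|g x| <= C) ->
  ucont f -> ucont g -> ucont (fun x => f x * g x).
Proof.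
move=> fB gC uf ug e e0.
have B0 : 0 <= B by apply: le_trans (fB 0).
have C0 : 0 <= C by apply: le_trans (gC 0).
have e1 : 0 < e / 2 / (C + 1) by rewrite !divr_gt0// ltr_wpDl.
have e2 : 0 < e / 2 / (B + 1) by rewrite !divr_gt0// ltr_wpDl.
have [d1 d10 h1] := uf _ e1; have [d2 d20 h2] := ug _ e2.
exists (Num.min d1 d2); first by rewrite lt_min d10.
move=> x y; rewrite lt_min => /andP[/h1 {}h1 /h2 {}h2].
have -> : f y * g y - f x * g x = (f y - f x) * g y + f x * (g y - g x) by ring.
apply: le_trans (ler_normD _ _) _; rewrite [e]splitr !normrM; apply: lerD.
  apply: le_trans (_ : e / 2 / (C + 1) * (C + 1) <= _).
    by apply: ler_pM => //; apply: le_trans (gC _) _; rewrite lerDl.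
  by rewrite divfK// gt_eqF// ltr_wpDl.
apply: le_trans (_ : (B + 1) * (e / 2 / (B + 1)) <= _).
  by apply: ler_pM => //; apply: le_trans (fB _) _; rewrite lerDl.
by rewrite mulrC divfK// gt_eqF// ltr_wpDl.
Qed.

Lemma ucont_comp (phi f : R -> R) (B : R) : (forall x, `|f x| <= B) ->
  continuous phi -> ucont f -> ucont (fun x => phi (f x)).
Proof.
move=> fB cphi uf e e0; have [d d0 h] := heine_cantor B cphi e0.
have d2 : 0 < d / 2 by rewrite divr_gt0.
have [d' d'0 h'] := uf _ d2; exists d' => // x y /h' xy.
apply: h => //; apply: le_lt_trans xy _.
by rewrite ltr_pdivrMr// ltr_pMr// ltr1n.
Qed.

Lemma derive_lipschitz (f f' : R -> R) (L : R) :
  (forall x : R, is_derive x 1 f (f' x)) -> (forall x, `|f' x| <= L) ->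
  forall x y, `|f y - f x| <= L * `|y - x|.
Proof.
move=> df f'L.
have cf z : {for z, continuous f}.
  by apply/differentiable_continuous/derivable1_diffP; apply: ex_derive.
have H x y : x <= y -> `|f y - f x| <= L * `|y - x|.
  move=> xy; have [|c _ ->] := @MVT_segment R f f' x y xy (fun z _ => df z).
    exact: continuous_subspaceT.
  by rewrite normrM ler_wpM2r.
move=> x y; have /orP[xy|xy] := le_total x y; first exact: H.
by rewrite distrC [`|y - x|]distrC; exact: H.
Qed.

Lemma lipschitz_ucont (f : R -> R) (L : R) :
  (forall x y, `|f y - f x| <= L * `|y - x|) -> ucont f.
Proof.
move=> fL e e0.
have L1 : 0 < `|L| + 1 by rewrite ltr_wpDl.
exists (e / (`|L| + 1)); first by rewrite divr_gt0.
move=> x y; rewrite ltr_pdivlMr// => h.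
apply: le_trans (fL x y) _; apply: le_trans (_ : (`|L| + 1) * `|y - x| <= _).
  by rewrite ler_wpM2r// (le_trans (ler_norm _))// lerDl.
by rewrite mulrC ltW.
Qed.

Lemma cos_lipschitz (x y : R) : `|cos y - cos x| <= `|y - x|.
Proof.
rewrite -[leRHS]mul1r; apply: (@derive_lipschitz _ (fun z => - sin z)) => z.
by rewrite normrN ler_norml sin_geN1 sin_le1.
Qed.

Lemma sin_lipschitz (x y : R) : `|sin y - sin x| <= `|y - x|.
Proof.
rewrite -[leRHS]mul1r; apply: (@derive_lipschitz _ cos) => z.
by rewrite ler_norml cos_geN1 cos_le1.
Qed.

Lemma ucont_derive (f f' : R -> R) :
  (forall x : R, is_derive x 1 f (f' x)) -> ucont f' -> forall e, 0 < e ->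
  exists2 d : R, 0 < d & forall h, 0 < h < d ->
    forall x, `|f (x + h) - f x - h * f' x| <= e * h.
Proof.
move=> df uf' e e0; have [d d0 H] := uf' _ e0; exists d => // h /andP[h0 hd] x.
have cf z : {for z, continuous f}.
  by apply/differentiable_continuous/derivable1_diffP; apply: ex_derive.
have xh : x <= x + h by rewrite lerDl ltW.
have [|c cI] := @MVT_segment R f f' x (x + h) xh (fun z _ => df z).
  exact: continuous_subspaceT.
rewrite addrAC subrr add0r => ->.
have -> : f' c * h - h * f' x = (f' c - f' x) * h by ring.
rewrite normrM [`|h|]gtr0_norm// ler_pM2r//; apply: H.
move: cI; rewrite in_itv/= => /andP[c1 c2].
rewrite ger0_norm; lra.
Qed.

(* The absolute values extend functions on [0 <= x] to the whole line. *)
Lemma continuous_powR_mul (a : R) (psi : R -> R) (M : R) : 0 < a ->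
  (forall x, `|psi x| <= M) -> (forall x, 0 < x -> {for x, continuous psi}) ->
  continuous (fun x : R => `|x| `^ a * psi `|x|).
Proof.
move=> a0 psiM cpsi x.
have [->|x0] := eqVneq x 0.
  apply/cvgrPdist_le => e e0 /=.
  have M0 : 0 <= M by apply: le_trans (psiM 0).
  have k0 : 0 < e / (M + 1) by rewrite divr_gt0// ltr_wpDl.
  apply/nbhs_ballP; exists ((e / (M + 1)) `^ a^-1); first exact: powR_gt0.
  move=> y; rewrite /ball/= sub0r normrN => hy.
  rewrite normr0 powR0 ?gt_eqF// mul0r sub0r normrN normrM.
  rewrite (ger0_norm (powR_ge0 _ _)).
  apply: le_trans (_ : e / (M + 1) * (M + 1) <= _); last first.
    by rewrite divfK// gt_eqF// ltr_wpDl.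
  apply: ler_pM => //; rewrite ?powR_ge0//; last first.
    by apply: le_trans (psiM _) _; rewrite lerDl.
  have -> : e / (M + 1) = ((e / (M + 1)) `^ a^-1) `^ a.
    by rewrite -powRrM mulVf ?gt_eqF// powRr1// ltW.
  by apply: ge0_ler_powR; rewrite ?nnegrE ?powR_ge0// ltW.
have ax0 : 0 < `|x| by rewrite normr_gt0.
apply: (@continuousM _ _ (fun x : R => `|x| `^ a) (fun x : R => psi `|x|)).
  apply: (@continuous_comp _ _ _ (fun x : R => `|x|) (fun x => x `^ a)).
    exact: norm_continuous.
  apply/differentiable_continuous/derivable1_diffP.
  by apply: derivable_powR; rewrite in_itv/= andbT.
apply: (@continuous_comp _ _ _ (fun x : R => `|x|) psi).
  exact: norm_continuous.
exact: cpsi.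
Qed.

End UniformContinuity.

Section ComplexPower.
Variable R : realType.
Local Notation cmod := (@cmod R).
Local Notation expi := (@expi R).

(* [x ^ (a + i t)]; at [x = 0] the value is [0] unless [a = 0]. *)
Definition cpow (a t x : R) : R[i] := (x `^ a)%:C%C * expi (t * ln x).

(* The exponents [a + i t] for which [cpow a t] is continuous at [0]. *)
Definition adm (a t : R) : Prop := 0 < a \/ (a = 0 /\ t = 0).

Lemma cmod_cpow a t x : cmod (cpow a t x) = x `^ a.
Proof. by rewrite cmodM cmod_expi mulr1 cmod_real ger0_norm ?powR_ge0. Qed.

Lemma Re_cpow a t x : Re (cpow a t x) = x `^ a * cos (t * ln x).
Proof. by rewrite /= mul0r subr0. Qed.

Lemma Im_cpow a t x : Im (cpow a t x) = x `^ a * sin (t * ln x).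
Proof. by rewrite /= mul0r addr0. Qed.

Lemma cpow00 x : cpow 0 0 x = 1.
Proof. by rewrite /cpow powRr0 mul0r expi0 mulr1. Qed.

(** The range of [y] contains all values of [chord2], which are at most 4; [x] needs no upper bound
    since [heine_cantor] confines only the base point. *)
Lemma cpow_ucont a t : adm a t -> forall e, 0 < e ->
  exists2 d : R, 0 < d & forall x y, 0 <= x -> 0 <= y <= 5 -> `|x - y| < d ->
    cmod (cpow a t x - cpow a t y) <= e.
Proof.
move=> [a0|[-> ->]] e e0; last first.
  by exists 1 => // x y _ _ _; rewrite !cpow00 subrr cmod0 ltW.
have e2 : 0 < e / 2 by rewrite divr_gt0.
have ccl x : 0 < x -> {for x, continuous (fun x => t * ln x)}.
  move=> x0; apply: continuousM; first exact: cst_continuous.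
  exact: continuous_ln.
have c1 : continuous (fun x : R => `|x| `^ a * cos (t * ln `|x|)).
  apply: (@continuous_powR_mul R a (fun x => cos (t * ln x)) 1 a0) => x.
    by rewrite ler_norml cos_geN1 cos_le1.
  by move=> x0; apply: (continuous_comp (ccl x x0)); exact: continuous_cos.
have c2 : continuous (fun x : R => `|x| `^ a * sin (t * ln `|x|)).
  apply: (@continuous_powR_mul R a (fun x => sin (t * ln x)) 1 a0) => x.
    by rewrite ler_norml sin_geN1 sin_le1.
  by move=> x0; apply: (continuous_comp (ccl x x0)); exact: continuous_sin.
have [d1 d10 h1] := heine_cantor 5 c1 e2.
have [d2 d20 h2] := heine_cantor 5 c2 e2.
exists (Num.min d1 d2); first by rewrite lt_min d10.
move=> x y x0 /andP[y0 y5]; rewrite lt_min => /andP[xy1 xy2].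
apply: le_trans (cmod_le_ReIm _) _.
have y5' : `|y| <= 5 by rewrite ger0_norm.
have := h1 y x y5' xy1; have := h2 y x y5' xy2.
rewrite !(ger0_norm x0) !(ger0_norm y0).
have -> : Re (cpow a t x - cpow a t y) = Re (cpow a t x) - Re (cpow a t y) by [].
have -> : Im (cpow a t x - cpow a t y) = Im (cpow a t x) - Im (cpow a t y) by [].
rewrite !Re_cpow !Im_cpow => i1 i2; rewrite [e]splitr; exact: lerD.
Qed.

End ComplexPower.

Section Chord.
Variable R : realType.
Local Notation cmod := (@cmod R).
Local Notation expi := (@expi R).

(** Squared length of the chord between two points of the unit circle at angular distance [x], by
    [cmod_sub_expi]. Unlike the length itself it is smooth in [x]. *)
Definition chord2 (x : R) : R := 2 - 2 * cos x.

Lemma chord2_ge0 x : 0 <= chord2 x.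
Proof. rewrite /chord2; have := cos_le1 x; lra. Qed.

Lemma chord2_le4 x : chord2 x <= 4.
Proof. rewrite /chord2; have := cos_geN1 x; lra. Qed.

Lemma chord2N x : chord2 (- x) = chord2 x.
Proof. by rewrite /chord2 cosN. Qed.

Lemma chord2_lipschitz x y : `|chord2 y - chord2 x| <= 2 * `|y - x|.
Proof.
have -> : chord2 y - chord2 x = 2 * (cos x - cos y) by rewrite /chord2; ring.
by rewrite normrM ger0_norm// distrC ler_pM2l// cos_lipschitz.
Qed.

Lemma is_derive_chord2 (d x : R) : is_derive x 1 (fun x => chord2 x + d) (2 * sin x).
Proof.
rewrite /chord2; apply: is_derive_eq.
by rewrite /GRing.scale/=; ring.
Qed.

Lemma is_derive_powcos (a t y : R) : 0 < y ->
  is_derive y 1 (fun y => y `^ a * cos (t * ln y))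
    (y `^ a / y * (a * cos (t * ln y) - t * sin (t * ln y))).
Proof.
move=> y0.
have dl : is_derive y 1 (fun y => t * ln y) (t / y).
  have := is_derive1_ln y0 => dl; apply: is_derive_eq.
  by rewrite /GRing.scale/=; ring.
have dc : is_derive y 1 (fun y => cos (t * ln y)) (- sin (t * ln y) * (t / y)).
  exact: (@is_derive1_comp R cos (fun y => t * ln y)).
have dp := is_derive1_powR a y0.
apply: is_derive_eq.
rewrite powRB; last by rewrite (gt_eqF y0) implybT.
by rewrite powRr1 ?ltW// /GRing.scale/=; field; rewrite gt_eqF.
Qed.

Lemma is_derive_powsin (a t y : R) : 0 < y ->
  is_derive y 1 (fun y => y `^ a * sin (t * ln y))
    (y `^ a / y * (a * sin (t * ln y) + t * cos (t * ln y))).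
Proof.
move=> y0.
have dl : is_derive y 1 (fun y => t * ln y) (t / y).
  have := is_derive1_ln y0 => dl; apply: is_derive_eq.
  by rewrite /GRing.scale/=; ring.
have dc : is_derive y 1 (fun y => sin (t * ln y)) (cos (t * ln y) * (t / y)).
  exact: (@is_derive1_comp R sin (fun y => t * ln y)).
have dp := is_derive1_powR a y0.
apply: is_derive_eq.
rewrite powRB; last by rewrite (gt_eqF y0) implybT.
by rewrite powRr1 ?ltW// /GRing.scale/=; field; rewrite gt_eqF.
Qed.

(** The argument [chord2 x + d] never goes below [d], so [phi] may be replaced by
    [phi (Num.max d y)], which is continuous on the whole line. *)
Lemma ucont_chord_comp (d : R) (phi : R -> R) : 0 < d ->
  (forall y, 0 < y -> {for y, continuous phi}) ->
  ucont (fun x => phi (chord2 x + d) * (2 * sin x)).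
Proof.
move=> d0 cphi.
pose ph y := phi (Num.max d y).
have cph : continuous ph.
  move=> y; apply: (@continuous_comp _ _ _ (fun y => Num.max d y) phi).
    by apply: (@continuous_max _ _ (fun=> d) id); [exact: cst_continuous|].
  by apply: cphi; rewrite lt_max d0.
have E x : phi (chord2 x + d) = ph (chord2 x + d).
  rewrite /ph; congr phi; apply/esym/max_idPr; rewrite lerDr; exact: chord2_ge0.
have qB x : `|chord2 x + d| <= 4 + d.
  by rewrite ger0_norm ?lerD2r ?chord2_le4// addr_ge0 ?chord2_ge0// ltW.
have uq : ucont (fun x => chord2 x + d).
  apply: (@lipschitz_ucont _ _ 2) => x y.
  by rewrite addrAC opprD addrA subrK; exact: chord2_lipschitz.
have [B hB] : exists B, forall x, `|ph (chord2 x + d)| <= B.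
  have [M [_ hM]] := compact_bounded (continuous_compact
    (continuous_subspaceT cph) (@segment_compact R (- (4 + d)) (4 + d))).
  exists (M + 1) => x; apply: hM; first by rewrite ltrDl.
  by exists (chord2 x + d) => //=; rewrite in_itv/= -ler_norml.
under eq_fun do rewrite E.
apply: (@ucontM _ _ _ B 2) => //.
- move=> x; rewrite normrM ger0_norm// -[leRHS]mulr1 ler_pM2l//.
  by rewrite ler_norml sin_geN1 sin_le1.
- exact: (ucont_comp qB).
apply: (@lipschitz_ucont _ _ 2) => x y.
by rewrite -mulrBr normrM ger0_norm// ler_pM2l// sin_lipschitz.
Qed.

Lemma cpow_uderiv1 (a t d : R) : 0 < d -> forall e, 0 < e ->
  exists2 d' : R, 0 < d' & forall h, 0 < h < d' -> forall x,
    cmod (cpow a t (chord2 (x + h) + d) - cpow a t (chord2 x + d)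
       - h%:C%C * ((a +i* t)%C * (2 * sin x / (chord2 x + d))%:C%C
                    * cpow a t (chord2 x + d))) <= e * h.
Proof.
move=> d0 e e0.
pose u (x : R) := (chord2 x + d) `^ a * cos (t * ln (chord2 x + d)).
pose v (x : R) := (chord2 x + d) `^ a * sin (t * ln (chord2 x + d)).
pose f1 (y : R) := y `^ a / y * (a * cos (t * ln y) - t * sin (t * ln y)).
pose f2 (y : R) := y `^ a / y * (a * sin (t * ln y) + t * cos (t * ln y)).
have q0 x : 0 < chord2 x + d by rewrite ltr_wpDl ?chord2_ge0.
have du (x : R) : is_derive x 1 u (f1 (chord2 x + d) * (2 * sin x)).
  have i1 := is_derive_powcos a t (q0 x); have i2 := is_derive_chord2 d x.
  exact: (@is_derive1_comp R (fun y => y `^ a * cos (t * ln y))).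
have dv (x : R) : is_derive x 1 v (f2 (chord2 x + d) * (2 * sin x)).
  have i1 := is_derive_powsin a t (q0 x); have i2 := is_derive_chord2 d x.
  exact: (@is_derive1_comp R (fun y => y `^ a * sin (t * ln y))).
have cl (y : R) : 0 < y -> {for y, continuous (fun y => t * ln y)}.
  by move=> y0; apply: continuousM; [exact: cst_continuous|exact: continuous_ln].
have cc (y : R) : 0 < y -> {for y, continuous (fun y => cos (t * ln y))}.
  by move=> y0; apply: (continuous_comp (cl y y0)); exact: continuous_cos.
have cs (y : R) : 0 < y -> {for y, continuous (fun y => sin (t * ln y))}.
  by move=> y0; apply: (continuous_comp (cl y y0)); exact: continuous_sin.
have cp (y : R) : 0 < y -> {for y, continuous (fun y => y `^ a / y)}.
  move=> y0; apply: continuousM.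
    apply/differentiable_continuous/derivable1_diffP.
    by apply: derivable_powR; rewrite in_itv/= andbT.
  by apply: inv_continuous; rewrite gt_eqF.
have cf1 (y : R) : 0 < y -> {for y, continuous f1}.
  move=> y0; apply: continuousM; first exact: cp.
  apply: continuousB; (apply: continuousM; first exact: cst_continuous).
    exact: cc.
  exact: cs.
have cf2 (y : R) : 0 < y -> {for y, continuous f2}.
  move=> y0; apply: continuousM; first exact: cp.
  apply: continuousD; (apply: continuousM; first exact: cst_continuous).
    exact: cs.
  exact: cc.
have e2 : 0 < e / 2 by rewrite divr_gt0.
have [d1 d10 h1] := ucont_derive du (ucont_chord_comp d0 cf1) e2.
have [d2 d20 h2] := ucont_derive dv (ucont_chord_comp d0 cf2) e2.
exists (Num.min d1 d2); first by rewrite lt_min d10.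
move=> h /andP[h0]; rewrite lt_min => /andP[hd1 hd2] x.
have {}h1 := h1 h; rewrite h0 hd1 in h1; have {}h1 := h1 isT x.
have {}h2 := h2 h; rewrite h0 hd2 in h2; have {}h2 := h2 isT x.
apply: le_trans (cmod_le_ReIm _) _.
have -> : e * h = e / 2 * h + e / 2 * h by lra.
apply: lerD.
  apply: le_trans h1; rewrite le_eqVlt; apply/orP; left; apply/eqP; congr `|_|.
  rewrite /cpow /u /f1 /=; ring.
apply: le_trans h2; rewrite le_eqVlt; apply/orP; left; apply/eqP; congr `|_|.
rewrite /cpow /v /f2 /=; ring.
Qed.

End Chord.

(** * Integration by parts on the grid *)

Section UniformDerivativeMore.
Variables (R : realType) (N : nat) (p : 'I_N).
Local Notation conf := ('I_N -> R).
Local Notation cmod := (@cmod R).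
Local Notation expi := (@expi R).

Lemma uderiv_conj (f f' : conf -> R[i]) : uderiv p f f' ->
  uderiv p (fun th => conjc (f th)) (fun th => conjc (f' th)).
Proof.
move=> [[B B0 hB] [C C0 hC] H]; split.
- by exists B => // th; rewrite cmod_conj.
- by exists C => // th; rewrite cmod_conj.
move=> e /H[d d0 h]; exists d => // k kd th.
rewrite -[k%:C%C]conjc_real -rmorphM -!rmorphB cmod_conj; exact: h.
Qed.

Lemma uderiv_cstB (c : R[i]) (f f' : conf -> R[i]) : uderiv p f f' ->
  uderiv p (fun th => c - f th) (fun th => - f' th).
Proof.
move=> [[B B0 hB] [C C0 hC] H]; split.
- exists (cmod c + B); first by rewrite addr_ge0 ?cmod_ge0.
  by move=> th; apply: le_trans (cmodB_le _ _) _; rewrite lerD2l.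
- by exists C => // th; rewrite cmodN.
move=> e /H[d d0 h]; exists d => // k kd th.
rewrite -cmodN; have -> : - (c - f (shift p k th) - (c - f th) - k%:C%C * - f' th) =
  f (shift p k th) - f th - k%:C%C * f' th by ring.
exact: h.
Qed.

Lemma uderiv_expi (c : R) :
  uderiv p (fun th => expi (th p - c)) (fun th => 'i%C * expi (th p - c)).
Proof.
have i1 : cmod ('i%C : R[i]) = 1.
  by rewrite cmodE /= expr0n expr1n add0r sqrtr1.
split.
- by exists 1 => // th; rewrite cmod_expi.
- by exists 1 => // th; rewrite cmodM i1 cmod_expi mulr1.
move=> e e0; have e2 : 0 < e / 2 by rewrite divr_gt0.
have us : ucont (fun x : R => - sin x).
  apply: (@lipschitz_ucont _ _ 1) => x y.
  by rewrite -opprD normrN mul1r sin_lipschitz.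
have uc : ucont (@cos R).
  by apply: (@lipschitz_ucont _ _ 1) => x y; rewrite mul1r cos_lipschitz.
have [d1 d10 h1] := ucont_derive (@is_derive_cos R) us e2.
have [d2 d20 h2] := ucont_derive (@is_derive_sin R) uc e2.
exists (Num.min d1 d2); first by rewrite lt_min d10.
move=> h /andP[h0]; rewrite lt_min => /andP[hd1 hd2] th.
have {}h1 := h1 h; rewrite h0 hd1 in h1; have {}h1 := h1 isT (th p - c).
have {}h2 := h2 h; rewrite h0 hd2 in h2; have {}h2 := h2 isT (th p - c).
rewrite /shift eqxx [th p + h - c]addrAC.
apply: le_trans (cmod_le_ReIm _) _.
have -> : e * h = e / 2 * h + e / 2 * h by lra.
apply: lerD.
  apply: le_trans h1; rewrite le_eqVlt; apply/orP; left; apply/eqP; congr `|_|.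
  rewrite /= ; ring.
apply: le_trans h2; rewrite le_eqVlt; apply/orP; left; apply/eqP; congr `|_|.
rewrite /= ; ring.
Qed.

(** The smoothed cotangent of the half angle: at [d = 0] it is [cot (x / 2)], the logarithmic
    derivative of [chord2]. *)
Definition cotw (d x : R) : R := 2 * sin x / (chord2 x + d).

Lemma uderiv_cpow (a t d : R) (u : conf -> R) : 0 <= a -> 0 < d ->
  (forall h th, u (shift p h th) = u th + h) ->
  uderiv p (fun th => cpow a t (chord2 (u th) + d))
    (fun th => ((a +i* t)%C * (cotw d (u th))%:C%C) * cpow a t (chord2 (u th) + d)).
Proof.
move=> a0 d0 us.
have q0 x : 0 < chord2 x + d by rewrite ltr_wpDl ?chord2_ge0.
have B1 th : cmod (cpow a t (chord2 (u th) + d)) <= (4 + d) `^ a.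
  rewrite cmod_cpow; apply: ge0_ler_powR; rewrite ?nnegrE ?(ltW (q0 _))//.
    by rewrite addr_ge0// ltW.
  by rewrite lerD2r chord2_le4.
split; first by exists ((4 + d) `^ a) => //; exact: powR_ge0.
  exists (cmod (a +i* t)%C * (2 / d) * (4 + d) `^ a).
    by rewrite !mulr_ge0 ?cmod_ge0 ?powR_ge0// invr_ge0 ltW.
  move=> th; rewrite cmodM [cmod ((a +i* t)%C * _)]cmodM.
  apply: ler_pM => //; rewrite ?mulr_ge0 ?cmod_ge0//.
  rewrite ler_wpM2l ?cmod_ge0// cmod_real /cotw normrM normrM.
  apply: ler_pM; rewrite ?mulr_ge0//.
    by rewrite ger0_norm// -[leRHS]mulr1 ler_pM2l// ler_norml sin_geN1 sin_le1.
  rewrite normfV (gtr0_norm (q0 _)) lef_pV2 ?posrE ?q0//.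
  by rewrite lerDr chord2_ge0.
move=> e e0; have [d' d'0 H] := cpow_uderiv1 a t d0 e0.
by exists d' => // h hd th; rewrite us; exact: H.
Qed.

End UniformDerivativeMore.

(** * Ward identities obtained from integration by parts in one angle *)

Section Ward.
Variables (R : realType) (N : nat) (theta lam a t : R) (e : bool).
Hypotheses (lam0 : 0 < lam) (at_adm : adm a t).
Local Notation conf := ('I_N -> R).
Local Notation cmod := (@cmod R).
Local Notation expi := (@expi R).
Local Notation sg := ((a +i* t)%C : R[i]).

Definition zc (th : conf) (j : 'I_N) : R[i] := expi (th j - theta).
Definition yc (th : conf) (j : 'I_N) : R[i] := 1 - zc th j.
Definition pairf (d : R) (th : conf) (j k : 'I_N) : R[i] :=
  cpow (lam / 2) 0 (chord2 (th j - th k) + d).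
Definition onef (d : R) (th : conf) (j : 'I_N) : R[i] :=
  cpow a t (chord2 (th j - theta) + d).
(* Each unordered pair occurs twice, which makes the symmetry evident;
   hence the exponent [lam / 2] in [pairf]. *)
Definition wreg (d : R) (th : conf) : R[i] :=
  (\prod_j onef d th j) * \prod_j \prod_(k | k != j) pairf d th j k.
Definition yconj (th : conf) : R[i] := \prod_j conjc (yc th j) ^+ e.
Definition ypart (r : nat) (th : conf) : R[i] := \prod_(j < N | (j < r)%N) yc th j.

Definition swapo (p k j : 'I_N) : 'I_N :=
  if j == p then k else if j == k then p else j.

Lemma swapoK p k : involutive (swapo p k).
Proof.
move=> j; rewrite /swapo.
have [->|jp] := eqVneq j p; first by rewrite eqxx; case: eqVneq.
by have [->|jk] := eqVneq j k; rewrite ?eqxx// (negbTE jp) (negbTE jk).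
Qed.

Lemma swapoL p k : swapo p k p = k. Proof. by rewrite /swapo eqxx. Qed.
Lemma swapoR p k : swapo p k k = p.
Proof. by rewrite /swapo; case: eqVneq => [->|]; rewrite ?eqxx. Qed.

Lemma wreg_invol s d (th : conf) : involutive s -> wreg d (fun j => th (s j)) = wreg d th.
Proof.
move=> sK; have sI := inv_inj sK; rewrite /wreg; congr (_ * _).
  by rewrite [RHS](reindex_inj sI).
rewrite [RHS](reindex_inj sI) /=; apply: eq_bigr => j _.
rewrite [RHS](reindex_inj sI) /=; apply: eq_bigl => k.
by rewrite (inj_eq sI).
Qed.

Lemma yconj_invol s (th : conf) : involutive s -> yconj (fun j => th (s j)) = yconj th.
Proof. by move=> sK; rewrite /yconj [RHS](reindex_inj (inv_inj sK)). Qed.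

Lemma ypart_swap r (p k : 'I_N) (th : conf) : (p < r)%N = (k < r)%N ->
  ypart r (fun j => th (swapo p k j)) = ypart r th.
Proof.
move=> pk; rewrite /ypart [RHS](reindex_inj (inv_inj (swapoK p k))) /=.
apply: eq_bigl => j; rewrite /swapo.
by have [->|] := eqVneq j p => //; have [->|] := eqVneq j k.
Qed.

Lemma ypartS (p : 'I_N) th : ypart p.+1 th = ypart p th * yc th p.
Proof.
rewrite /ypart (bigD1 p)//= mulrC; congr (_ * _); apply: eq_bigl => j.
by rewrite ltnS [in RHS]ltn_neqAle andbC.
Qed.

Lemma zc_shift p h th j : j != p -> zc (shift p h th) j = zc th j.
Proof. by rewrite /zc /shift => /negbTE ->. Qed.

Lemma yc_shift p h th j : j != p -> yc (shift p h th) j = yc th j.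
Proof. by rewrite /yc => jp; rewrite zc_shift. Qed.

Lemma cmod_yc th j : cmod (yc th j) <= 2.
Proof. by apply: le_trans (cmodB_le _ _) _; rewrite cmod1 cmod_expi. Qed.

Lemma bounded_prod (P : pred 'I_N) (F : conf -> 'I_N -> R[i]) (B : R) :
  (forall th j, cmod (F th j) <= B) -> bounded_conf (fun th => \prod_(j | P j) F th j).
Proof.
move=> FB; exists (\prod_(j | P j) `|B|); first exact: prodr_ge0.
move=> th; rewrite cmod_prod; apply: ler_prod => j _.
by rewrite cmod_ge0/=; apply: le_trans (FB _ _) _; exact: ler_norm.
Qed.

Lemma bounded_mul (f g : conf -> R[i]) : bounded_conf f -> bounded_conf g ->
  bounded_conf (fun th => f th * g th).
Proof.
move=> [B B0 hB] [C C0 hC]; exists (B * C); first exact: mulr_ge0.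
by move=> th; rewrite cmodM ler_pM ?cmod_ge0.
Qed.

Lemma a_ge0 : 0 <= a.
Proof. by case: at_adm => [/ltW|[-> _]]. Qed.

Lemma uderiv_wreg p d : 0 < d -> uderiv p (wreg d) (fun th =>
  (sg * (cotw d (th p - theta))%:C%C +
   \sum_(k | k != p) (lam * cotw d (th p - th k))%:C%C) * wreg d th).
Proof.
move=> d0.
have q0 x : 0 < chord2 x + d by rewrite ltr_wpDl ?chord2_ge0.
have bcp a' t' (u : conf -> R) : 0 <= a' ->
    bounded_conf (fun th => cpow a' t' (chord2 (u th) + d)).
  move=> a'0; exists ((4 + d) `^ a'); first exact: powR_ge0.
  move=> th; rewrite cmod_cpow; apply: ge0_ler_powR; rewrite ?nnegrE ?(ltW (q0 _))//.
    by rewrite addr_ge0// ltW.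
  by rewrite lerD2r chord2_le4.
have L2 : 0 <= lam / 2 by rewrite divr_ge0// ltW.
have U1 : uderiv p (fun th => \prod_j onef d th j) (fun th =>
    (\sum_j (if j == p then sg * (cotw d (th p - theta))%:C%C else 0)) *
     \prod_j onef d th j).
  apply: (@logderiv_prod R N p _ _ _ (fun j th => onef d th j) (fun j th =>
    if j == p then sg * (cotw d (th p - theta))%:C%C else 0)) => j _.
  have [->|jp] := eqVneq j p.
    apply: (@uderiv_cpow R N p a t d (fun th => th p - theta)) => //.
      exact: a_ge0.
    by move=> h th; rewrite /shift eqxx addrAC.
  apply: eq_uderiv (uderiv_cst (f := fun th => onef d th j) _ _) => //.
  - by move=> th; rewrite mul0r.
  - exact: (bcp a t (fun th => th j - theta) a_ge0).
  - by move=> h th; rewrite /onef /shift (negbTE jp).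
(* Logarithmic derivative in the coordinate [p] of the factor of the ordered pair [(j, k)]. Each
   unordered pair containing [p] occurs in both orders, and the two halves [lam / 2] add up to
   [lam]. *)
pose Lp th j k := if j == p then (lam / 2 * cotw d (th p - th k))%:C%C
  else if k == p then (lam / 2 * cotw d (th p - th j))%:C%C else 0 : R[i].
have U2 : uderiv p (fun th => \prod_j \prod_(k | k != j) pairf d th j k) (fun th =>
   (\sum_j \sum_(k | k != j) Lp th j k) * \prod_j \prod_(k | k != j) pairf d th j k).
  apply: (@logderiv_prod R N p _ _ _ (fun j th => \prod_(k | k != j) pairf d th j k)
    (fun j th => \sum_(k | k != j) Lp th j k)) => j _.
  apply: (@logderiv_prod R N p _ _ _ (fun k th => pairf d th j k)
    (fun k th => Lp th j k)) => k kj; rewrite /Lp.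
  have [jp|jp] := eqVneq j p.
    subst j; apply: eq_uderiv (@uderiv_cpow R N p (lam / 2) 0 d
      (fun th => th p - th k) L2 d0 _) => // [th|h th].
      by congr (_ * _); apply/esym; exact: (rmorphM (real_complex R)).
    by rewrite /shift eqxx (negbTE kj) addrAC.
  have [kp|kp] := eqVneq k p.
    subst k; apply: eq_uderiv (@uderiv_cpow R N p (lam / 2) 0 d
      (fun th => th p - th j) L2 d0 _) => [th|th|h th].
    - by rewrite /pairf -chord2N opprB.
    - rewrite /pairf -[chord2 (th j - _)]chord2N opprB; congr (_ * _).
      by apply/esym; exact: (rmorphM (real_complex R)).
    by rewrite /shift eqxx (negbTE jp) addrAC.
  apply: eq_uderiv (uderiv_cst (f := fun th => pairf d th j k) _ _) => //.
  - by move=> th; rewrite mul0r.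
  - exact: (bcp (lam / 2) 0 (fun th => th j - th k) L2).
  - by move=> h th; rewrite /pairf /shift (negbTE jp) (negbTE kp).
apply: eq_uderiv (uderivM U1 U2) => // th; rewrite /wreg.
have -> : \sum_j (if j == p then sg * (cotw d (th p - theta))%:C%C else 0) =
    sg * (cotw d (th p - theta))%:C%C.
  by rewrite -big_mkcond big_pred1_eq.
have -> : \sum_j \sum_(k | k != j) Lp th j k =
    \sum_(k | k != p) (lam * cotw d (th p - th k))%:C%C.
  rewrite (bigD1 p)//= /Lp eqxx.
  have -> : \sum_(i < N | i != p) \sum_(k < N | k != i)
      (if i == p then (lam / 2 * cotw d (th p - th k))%:C%C
       else if k == p then (lam / 2 * cotw d (th p - th i))%:C%C else 0) =
      \sum_(i < N | i != p) (lam / 2 * cotw d (th p - th i))%:C%C :> R[i].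
    apply: eq_bigr => i ip; rewrite (negbTE ip) (bigD1 p) 1?eq_sym//= eqxx.
    by rewrite big1 ?addr0// => k /andP[_ /negbTE ->].
  rewrite -big_split /=; apply: eq_bigr => k _.
  by rewrite -rmorphD -mulrDl -splitr.
by ring.
Qed.

Lemma circular_zc th th' : (forall j, expi (th j) = expi (th' j)) ->
  forall j, zc th j = zc th' j.
Proof. by move=> h j; rewrite /zc !expiD h. Qed.

Lemma circular_wreg d : circular (wreg d).
Proof.
move=> th th' h.
have hc j : cos (th j) = cos (th' j) by have := h j => -[].
have hs j : sin (th j) = sin (th' j) by have := h j => -[].
rewrite /wreg; congr (_ * _).
  by apply: eq_bigr => j _; rewrite /onef /chord2 !cosB hc hs.
apply: eq_bigr => j _; apply: eq_bigr => k _.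
by rewrite /pairf /chord2 !cosB !hc !hs.
Qed.

(** The derivative of [ypart p.+1 * yconj * wreg]. The factor [yc th p] is kept apart from
    [ypart p]: it is the one that will cancel the singularities of the cotangents. *)
Lemma ward_derivative (p : 'I_N) d : 0 < d ->
  negl (fun th => ypart p th * yconj th * wreg d th *
    ('i%C * (- zc th p - (e : nat)%:R) + yc th p *
      (sg * (cotw d (th p - theta))%:C%C +
       \sum_(k | k != p) (lam * cotw d (th p - th k))%:C%C))).
Proof.
move=> d0.
pose C th := ypart p th * \prod_(j | j != p) conjc (yc th j) ^+ e.
have UC : uderiv p C (fun=> 0).
  apply: uderiv_cst.
    apply: bounded_mul; first by apply: bounded_prod => th j; exact: cmod_yc.
    apply: (@bounded_prod _ _ 2) => th j; rewrite cmodX cmod_conj.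
    by case: e; rewrite ?expr1 ?cmod_yc// expr0 ler1n.
  move=> h th; rewrite /C; congr (_ * _); apply: eq_bigr => j jp.
    by rewrite yc_shift//; apply: contraTneq jp => ->; rewrite ltnn.
  by rewrite yc_shift.
(* For [e = 1], [z * conj z = 1] gives [y * conj z = - conj y], so that differentiating [conj y]
   contributes just [-'i * conj y]. This is the origin of the term [e], and it allows [conj y] to be
   factored out. *)
have UB : uderiv p (fun th => yc th p * conjc (yc th p) ^+ e)
    (fun th => 'i%C * (- zc th p - (e : nat)%:R) * conjc (yc th p) ^+ e).
  have Uy : uderiv p (fun th => yc th p) (fun th => - ('i%C * zc th p)).
    exact: uderiv_cstB (uderiv_expi p theta).
  case: e.
    apply: eq_uderiv (uderivM Uy (uderiv_conj Uy)) => th; first by rewrite expr1.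
    have zz : zc th p * conjc (zc th p) = 1 by exact: expi_mul_conj.
    have c1 (z : R[i]) : conjc (1 - z) = 1 - conjc z.
      by case: z => x y; apply/eqP; rewrite eq_complex /=; apply/andP; split;
         apply/eqP; ring.
    have c2 (z : R[i]) : conjc (- ('i%C * z)) = 'i%C * conjc z.
      by case: z => x y; apply/eqP; rewrite eq_complex /=; apply/andP; split;
         apply/eqP; ring.
    rewrite expr1 /yc c1 c2.
    set z := zc th p in zz *; set w := conjc z in zz *.
    have -> : - ('i%C * z) * (1 - w) + (1 - z) * ('i%C * w) =
       'i%C * (- z + w + z * w - z * w) :> R[i] by ring.
    have -> : 'i%C * (- z - 1) * (1 - w) = 'i%C * (- z - 1 + w + z * w) :> R[i] by ring.
    by rewrite zz; congr (_ * _); ring.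
  apply: eq_uderiv Uy => th; first by rewrite expr0 mulr1.
  by rewrite expr0 mulr1 subr0 mulrN.
have UF := uderivM (uderivM UC UB) (uderiv_wreg p d0).
have Ep th : yconj th = conjc (yc th p) ^+ e * \prod_(j | j != p) conjc (yc th j) ^+ e.
  by rewrite /yconj (bigD1 p).
apply: negl_ext (negl_uderiv _ UF) => [K|].
  by apply: eq_gsum => th; rewrite Ep /C; ring.
move=> th th' h; rewrite (circular_wreg d h) /C /ypart.
have hy j : yc th j = yc th' j by rewrite /yc (circular_zc h).
rewrite hy; congr (_ * _ * _ * _).
  by apply: eq_bigr => j _.
by apply: eq_bigr => j _; rewrite hy.
Qed.

End Ward.

Section WardStep.
Variables (R : realType) (N : nat) (theta lam a t : R) (e : bool).
Hypotheses (lam0 : 0 < lam) (at_adm : adm a t).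
Local Notation conf := ('I_N -> R).
Local Notation cmod := (@cmod R).
Local Notation expi := (@expi R).
Local Notation sg := ((a +i* t)%C : R[i]).
Local Notation zc := (@zc R N theta).
Local Notation yc := (@yc R N theta).
Local Notation wreg := (@wreg R N theta lam a t).
Local Notation yconj := (@yconj R N theta e).
Local Notation ypart := (@ypart R N theta).

(** The identity [(exp(i B) - exp(i A)) cot((A - B) / 2) = - i (exp(i A) + exp(i B))], multiplied by
    [chord2 (A - B)] so that it also holds at coinciding points. It is how a difference of two
    variables removes the singularity of the cotangent. *)
Lemma expi_sub_mul_sin (A B : R) : (expi B - expi A) * (2 * sin (A - B))%:C%C =
  - 'i%C * (expi A + expi B) * (chord2 (A - B))%:C%C.
Proof.
rewrite /chord2 sinB cosB; have hA := cos2Dsin2 A; have hB := cos2Dsin2 B.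
apply/eqP; rewrite eq_complex /=; apply/andP; split; rewrite -subr_eq0.
  set E := (X in X == 0).
  have -> : E = 2 * (sin A * (cos B ^+ 2 + sin B ^+ 2 - 1) +
    sin B * (cos A ^+ 2 + sin A ^+ 2 - 1)) by rewrite /E; ring.
  by rewrite hA hB subrr !mulr0 addr0 mulr0.
set E := (X in X == 0).
have -> : E = - 2 * (cos A * (cos B ^+ 2 + sin B ^+ 2 - 1) +
    cos B * (cos A ^+ 2 + sin A ^+ 2 - 1)) by rewrite /E; ring.
by rewrite hA hB subrr !mulr0 addr0 mulr0.
Qed.

(** What smoothing leaves of the cancelled singularity: it is 0 where the chord vanishes and tends
    to 1 elsewhere, not uniformly. *)
Definition ratw (d x : R) : R := chord2 x / (chord2 x + d).

Lemma expi_sub_mul_cotw (d A B : R) : (expi B - expi A) * (cotw d (A - B))%:C%C =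
  - 'i%C * (expi A + expi B) * (ratw d (A - B))%:C%C.
Proof.
rewrite /cotw /ratw !rmorphM /=; rewrite mulrA.
have -> : (expi B - expi A) * (2%:C%C * (sin (A - B))%:C%C) =
   - 'i%C * (expi A + expi B) * (chord2 (A - B))%:C%C.
  by rewrite -expi_sub_mul_sin rmorphM.
by rewrite mulrA.
Qed.

Lemma cotwN d x : cotw d (- x) = - cotw d x :> R.
Proof. by rewrite /cotw sinN chord2N mulrN mulNr. Qed.

(** For [k < p] both [y_k] and [y_p] occur in [y_0 ... y_p], so exchanging the two variables changes
    only the sign of the odd factor [cotw]: the sum equals its own opposite. *)
Lemma gsum_ward_low K (p k : 'I_N) d : (k < p)%N ->
  gsum K (fun th => ypart p th * yconj th * wreg d th *
    (yc th p * (lam * cotw d (th p - th k))%:C%C)) = 0.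
Proof.
move=> kp; set f := fun th => _.
have : gsum K f = - gsum K f.
  rewrite -[in LHS](gsum_involutive K f (swapoK p k)) -mulN1r -gsumZ.
  apply: eq_gsum => th; rewrite /f swapoL swapoR.
  rewrite wreg_invol ?yconj_invol; try exact: swapoK.
  rewrite -[th k - th p]opprB cotwN mulrN rmorphN.
  pose th' := fun j => th (swapo p k j); rewrite -/th'.
  have uv : ypart p th' * yc th' p = ypart p th * yc th p.
    by rewrite -!ypartS ypart_swap// !ltnS leqnn ltnW.
  set x := (lam * _)%:C%C.
  transitivity (- (ypart p th' * yc th' p * wreg d th * yconj th * x)); first by ring.
  by rewrite uv; ring.
move=> /eqP; rewrite -addr_eq0 -mulr2n mulrn_eq0 /= => /eqP; exact.
Qed.

(** For [k > p] the product contains [y_p] but not [y_k]. Averaging with the exchanged sum replaces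
    [y_p] by half of [y_p - y_k = z_k - z_p], which cancels the singularity of the cotangent. *)
Lemma gsum_ward_high K (p k : 'I_N) d : (p < k)%N ->
  gsum K (fun th => ypart p th * yconj th * wreg d th *
    (yc th p * (lam * cotw d (th p - th k))%:C%C)) =
  gsum K (fun th => ypart p th * yconj th * wreg d th *
    (- 'i%C * (lam / 2)%:C%C * (zc th p + zc th k) * (ratw d (th p - th k))%:C%C)).
Proof.
move=> pk; set f := fun th => _; set g := fun th => _.
suff : gsum K f + gsum K f = gsum K g + gsum K g.
  rewrite -!mulr2n => /eqP; rewrite -subr_eq0 -mulrnBl mulrn_eq0 subr_eq0 /=.
  by move=> /eqP.
rewrite -[X in _ + X = _](gsum_involutive K f (swapoK p k)) -!gsumD.
apply: eq_gsum => th; rewrite /f /g swapoL swapoR.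
rewrite wreg_invol ?yconj_invol; try exact: swapoK.
rewrite ypart_swap; last by rewrite ltnn ltnNge ltnW.
have -> : yc (fun j => th (swapo p k j)) p = yc th k by rewrite /yc /zc swapoL.
rewrite -[th k - th p]opprB cotwN mulrN rmorphN.
rewrite -!mulrDr; congr (_ * _); rewrite mulrN -mulrBl.
have -> : yc th p - yc th k = zc th k - zc th p by rewrite /yc; ring.
have CM (x y : R) : (x * y)%:C%C = x%:C%C * y%:C%C by exact: (rmorphM (real_complex R)).
rewrite CM mulrCA.
have -> : th p - th k = (th p - theta) - (th k - theta) by ring.
rewrite /zc expi_sub_mul_cotw.
have -> : lam%:C%C = (lam / 2)%:C%C + (lam / 2)%:C%C :> R[i].
  by rewrite -rmorphD /= -splitr.
by ring.
Qed.

Lemma ward_symmetrized (p : 'I_N) d : 0 < d ->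
  negl (fun th => ypart p th * yconj th * wreg d th *
    (zc th p + (e : nat)%:R + sg * (1 + zc th p) * (ratw d (th p - theta))%:C%C +
     \sum_(k < N | (p < k)%N) (lam / 2)%:C%C * (zc th p + zc th k)
        * (ratw d (th p - th k))%:C%C)).
Proof.
move=> d0.
have ii : 'i%C * 'i%C = -1 :> R[i] by rewrite -expr2 sqr_i.
have H := neglZ 'i%C (ward_derivative theta e lam0 at_adm p d0).
apply: negl_ext H => K; rewrite gsumZ.
pose P th := ypart p th * yconj th * wreg d th.
pose A th := P th * ('i%C * (- zc th p - (e : nat)%:R)).
pose B th := P th * (- 'i%C * sg * (1 + zc th p) * (ratw d (th p - theta))%:C%C).
pose T k th := P th * (yc th p * (lam * cotw d (th p - th k))%:C%C).
pose S k th := P th * (- 'i%C * (lam / 2)%:C%C * (zc th p + zc th k)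
   * (ratw d (th p - th k))%:C%C).
transitivity ('i%C * (gsum K A + gsum K B + \sum_(k | k != p) gsum K (T k))).
  congr (_ * _); rewrite -gsum_sum -!gsumD; apply: eq_gsum => th.
  rewrite /A /B /T -!mulr_sumr -/(P th).
  have := expi_sub_mul_cotw d (th p - theta) 0; rewrite subr0 expi0 -/(zc th p).
  rewrite -/(yc th p); set c := (cotw _ _)%:C%C; set S1 := \sum_(_ | _) _ => h.
  transitivity (P th * ('i%C * (- zc th p - (e : nat)%:R)) + P th * sg * (yc th p * c)
    + P th * (yc th p * S1)); first by ring.
  by rewrite h; ring.
have -> : \sum_(k | k != p) gsum K (T k) = \sum_(k < N | (p < k)%N) gsum K (S k).
  rewrite (bigID (fun k : 'I_N => (p < k)%N)) /= [X in _ + X]big1 ?addr0.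
    apply: eq_big => [k|k /andP[_ pk]]; last exact: gsum_ward_high.
    by rewrite andb_idl// => pk; rewrite -val_eqE gtn_eqF.
  move=> k /andP[kp]; rewrite -leqNgt leq_eqVlt => /orP[|/gsum_ward_low]; last exact.
  by rewrite (negbTE (_ : (k : nat) != p)).
rewrite -gsum_sum -!gsumD -gsumZ; apply: eq_gsum => th.
rewrite /A /B /S -mulr_sumr -/(P th).
have -> : \sum_(k < N | (p < k)%N) - 'i%C * (lam / 2)%:C%C * (zc th p + zc th k) *
    (ratw d (th p - th k))%:C%C = - 'i%C * \sum_(k < N | (p < k)%N)
    (lam / 2)%:C%C * (zc th p + zc th k) * (ratw d (th p - th k))%:C%C.
  by rewrite mulr_sumr; apply: eq_bigr => k _; ring.
set S1 := \sum_(_ < _ | _) _; set c := (ratw _ _)%:C%C.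
transitivity (- ('i%C * 'i%C) * (P th * (zc th p + (e : nat)%:R
  + sg * (1 + zc th p) * c + S1))); first by ring.
by rewrite ii opprK mul1r.
Qed.

Lemma ulim_cpow (a' t' : R) (u : conf -> R) : adm a' t' ->
  ulim (fun d th => cpow a' t' (chord2 (u th) + d))
       (fun th => cpow a' t' (chord2 (u th) + 0)).
Proof.
move=> ad.
have a'0 : 0 <= a' by case: ad => [/ltW|[-> _]].
have q0 (x : R) : 0 <= chord2 x by exact: chord2_ge0.
have q4 (x : R) : chord2 x <= 4 by exact: chord2_le4.
split.
  exists (5 `^ a'); first exact: powR_ge0.
  have q5 d (x : R) : 0 <= d <= 1 -> cmod (cpow a' t' (chord2 x + d)) <= 5 `^ a'.
    move=> /andP[d0 d1]; rewrite cmod_cpow; apply: ge0_ler_powR => //.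
      by rewrite nnegrE addr_ge0.
      by rewrite nnegrE.
    have -> : 5 = 4 + 1 :> R by lra.
    by apply: lerD.
  split=> [d /andP[d0 d1] th|th]; apply: q5; rewrite ?lexx ?ler01//.
  by rewrite (ltW d0).
move=> eps eps0; have [d' d'0 H] := cpow_ucont ad eps0.
exists d' => // d /andP[d0 dd'] th; apply: H.
- by rewrite addr_ge0// ltW.
- by rewrite addr0 q0 /= (le_trans (q4 _))// ler_nat.
by rewrite addr0 addrAC subrr add0r gtr0_norm.
Qed.

Lemma adm_pair : adm (lam / 2) 0.
Proof. by left; rewrite divr_gt0. Qed.

Lemma ulim_ypart r : ulim (fun _ : R => ypart r) (ypart r).
Proof. by apply/ulim_cst/bounded_prod => th j; exact: cmod_yc. Qed.

Lemma ulim_yconj : ulim (fun _ : R => yconj) yconj.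
Proof.
apply: ulim_cst; apply: (@bounded_prod _ _ _ _ 2) => th j; rewrite cmodX cmod_conj.
by case: e; rewrite ?expr1 ?cmod_yc// expr0 ler1n.
Qed.

Lemma ulim_wreg : ulim wreg (wreg 0).
Proof.
apply: ulimM.
  apply: ulim_prod => j _; exact: (ulim_cpow (fun th => th j - theta)).
apply: ulim_prod => j _; apply: ulim_prod => k _.
exact: (ulim_cpow (fun th => th j - th k) adm_pair).
Qed.

Lemma ulim_ward r : ulim (fun d th => ypart r th * yconj th * wreg d th)
  (fun th => ypart r th * yconj th * wreg 0 th).
Proof. exact: (ulimM (ulimM (ulim_ypart r) ulim_yconj) ulim_wreg). Qed.

(** The factor [ratw] is far from 1 only where the chord is short, and there the isolated factor
    [cpow a' t'], with [a' > 0], makes the integrand small. *)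
Lemma ulim_ward_ratio (r : nat) (f : R -> conf -> R[i]) f0
    (a' t' : R) (u : conf -> R) : 0 < a' -> ulim f f0 ->
  (forall d th, ypart r th * yconj th * wreg d th =
     cpow a' t' (chord2 (u th) + d) * f d th) ->
  ulim (fun d th => (ratw d (u th))%:C%C * (ypart r th * yconj th * wreg d th))
       (fun th => ypart r th * yconj th * wreg 0 th).
Proof.
move=> a'0 [[B B0 [hB _]] _] E.
apply: (@ulim_ratio R N (fun d th => ypart r th * yconj th * wreg d th) _
  (fun th => chord2 (u th)) a' B a'0 B0) => //.
- by move=> th; exact: chord2_ge0.
- move=> d dd th; rewrite E cmodM cmod_cpow mulrC ler_wpM2r ?powR_ge0//; exact: hB.
exact: ulim_ward.
Qed.

(** For [a > 0] the factor [onef] at [p] provides the smallness. In the other admissible case,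
    [a = t = 0], there is no such factor, but the coefficient [sg] vanishes too. *)
Lemma ulim_ward_one r (p : 'I_N) :
  ulim (fun d th => sg * ((ratw d (th p - theta))%:C%C *
     (ypart r th * yconj th * wreg d th)))
   (fun th => sg * (ypart r th * yconj th * wreg 0 th)).
Proof.
case: (at_adm) => [a0|[-> ->]]; last first.
  have -> : (0 +i* 0)%C = 0 :> R[i] by [].
  apply: eq_ulim (ulim_cst (f0 := fun=> 0) _) => [d _ th|th|]; rewrite ?mul0r//.
  by exists 0 => // th; rewrite cmod0.
apply: ulimM; first by apply: ulim_cst; exists (cmod sg) => //; exact: cmod_ge0.
pose f d th := ypart r th * yconj th * ((\prod_(j | j != p) onef theta a t d th j) *
  \prod_j \prod_(k | k != j) pairf lam d th j k).
pose f0 th := ypart r th * yconj th * ((\prod_(j | j != p) onef theta a t 0 th j) *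
  \prod_j \prod_(k | k != j) pairf lam 0 th j k).
apply: (@ulim_ward_ratio r f f0 a t (fun th => th p - theta) a0).
  apply: ulimM; first exact: ulimM (ulim_ypart r) ulim_yconj.
  apply: ulimM.
    apply: ulim_prod => j _; exact: (ulim_cpow (fun th => th j - theta)).
  apply: ulim_prod => j _; apply: ulim_prod => k _.
  exact: (ulim_cpow (fun th => th j - th k) adm_pair).
move=> d th; rewrite /f /wreg (bigD1 p)//= -/(onef theta a t d th p).
by rewrite [RHS]mulrCA !mulrA.
Qed.

Lemma ulim_ward_pair r (p k : 'I_N) : k != p ->
  ulim (fun d th => (ratw d (th p - th k))%:C%C *
     (ypart r th * yconj th * wreg d th))
   (fun th => ypart r th * yconj th * wreg 0 th).
Proof.
move=> kp.
pose f d th := ypart r th * yconj th * ((\prod_j onef theta a t d th j) *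
  ((\prod_(j | (j != p) && (j != k)) pairf lam d th p j) *
  (\prod_(i | i != p) \prod_(j | j != i) pairf lam d th i j))).
have E d th : ypart r th * yconj th * wreg d th =
     cpow (lam / 2) 0 (chord2 (th p - th k) + d) * f d th.
  rewrite /f /wreg [\prod_j \prod_(_ | _) _](bigD1 p)//=.
  rewrite [\prod_(i | i != p) pairf _ _ _ _ _](bigD1 k)//=.
  by rewrite -/(pairf lam d th p k); ring.
apply: (@ulim_ward_ratio r f (f 0) (lam / 2) 0 (fun th => th p - th k)) => //.
  by rewrite divr_gt0.
apply: ulimM; first exact: ulimM (ulim_ypart r) ulim_yconj.
have up (i j : 'I_N) : ulim (fun d (th : conf) => pairf lam d th i j)
    (fun th => pairf lam 0 th i j).
  exact: (ulim_cpow (fun th => th i - th j) adm_pair).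
apply: ulimM.
  apply: ulim_prod => j _; exact: (ulim_cpow (fun th => th j - theta)).
by apply: ulimM; do ?[apply: ulim_prod => ? _].
Qed.

Lemma card_ord_gt (p : 'I_N) : #|[pred k : 'I_N | (p < k)%N]| = (N - p.+1)%N.
Proof.
rewrite -sum1_card -[RHS]muln1 -sum_nat_const_nat big_geq_mkord /=.
by apply: eq_bigl => k; rewrite !inE.
Qed.

(** Once [d] has gone to 0 and each [z_k] with [k > p] has been exchanged for [z_p], every term is
    affine in [z_p]. Substituting [z_p = 1 - y_p] leaves a linear relation between the sums with
    [ypart p] and with [ypart p.+1]. *)
Lemma ward_step (p : 'I_N) :
  negl (fun th => (1 + (e : nat)%:R + 2 * sg + (lam * (N - p.+1)%:R)%:C%C) *
      (ypart p th * yconj th * wreg 0 th) -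
     (1 + sg + (lam * (N - p.+1)%:R)%:C%C) *
      (ypart p.+1 th * yconj th * wreg 0 th)).
Proof.
pose P d th := ypart p th * yconj th * wreg d th.
pose g d th := P d th * (zc th p + (e : nat)%:R) +
  (1 + zc th p) * (sg * ((ratw d (th p - theta))%:C%C * P d th)) +
  \sum_(k < N | (p < k)%N) (lam / 2)%:C%C * (zc th p + zc th k) *
    ((ratw d (th p - th k))%:C%C * P d th).
pose g0 th := P 0 th * (zc th p + (e : nat)%:R) + (1 + zc th p) * (sg * P 0 th) +
  \sum_(k < N | (p < k)%N) (lam / 2)%:C%C * (zc th p + zc th k) * P 0 th.
have ng d : 0 < d -> negl (g d).
  move=> d0; apply: negl_ext (ward_symmetrized p d0) => K; apply: eq_gsum => th.
  rewrite /g -/(P d th).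
  have -> : \sum_(k < N | (p < k)%N) (lam / 2)%:C%C * (zc th p + zc th k) *
      ((ratw d (th p - th k))%:C%C * P d th) = P d th * \sum_(k < N | (p < k)%N)
      (lam / 2)%:C%C * (zc th p + zc th k) * (ratw d (th p - th k))%:C%C.
    by rewrite mulr_sumr; apply: eq_bigr => k _; ring.
  by ring.
have bz k : ulim (fun _ : R => zc ^~ k) (zc ^~ k).
  by apply: ulim_cst; exists 1 => // th; rewrite cmod_expi.
have bc (c : R[i]) : ulim (fun (_ : R) (_ : conf) => c) (fun=> c).
  by apply: ulim_cst; exists (cmod c) => //; exact: cmod_ge0.
have ug : ulim g g0.
  apply: ulimD; first apply: ulimD.
  - by apply: ulimM (ulim_ward p) _; exact: ulimD.
  - by apply: ulimM (ulim_ward_one p p); exact: ulimD.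
  apply: ulim_sum => k pk; apply: ulimM; last first.
    by apply: ulim_ward_pair; rewrite -val_eqE gtn_eqF.
  by apply: ulimM => //; exact: ulimD.
apply: negl_ext (negl_ulim ng ug) => K.
(* Neither [y_p] nor [y_k] occurs in [ypart p], so the weight is symmetric in the two variables. *)
have sw (k : 'I_N) : (p < k)%N -> gsum K (fun th => zc th k * P 0 th) =
    gsum K (fun th => zc th p * P 0 th).
  move=> pk; rewrite -[LHS](gsum_involutive K _ (swapoK p k)); apply: eq_gsum => th.
  rewrite /P wreg_invol ?yconj_invol; try exact: swapoK.
  rewrite ypart_swap; last by rewrite ltnn ltnNge ltnW.
  by rewrite /zc swapoR.
set m := (N - p.+1)%N.
have -> : gsum K g0 = gsum K (fun th => P 0 th * (zc th p + (e : nat)%:R)) +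
   gsum K (fun th => (1 + zc th p) * (sg * P 0 th)) +
   (lam * m%:R)%:C%C * gsum K (fun th => zc th p * P 0 th).
  rewrite /g0 !gsumD gsum_sum; congr (_ + _ + _).
  transitivity (\sum_(k < N | (p < k)%N) lam%:C%C * gsum K (fun th => zc th p * P 0 th)).
    apply: eq_bigr => k pk.
    rewrite [in RHS](splitr lam) rmorphD mulrDl -{2}(sw _ pk) -!gsumZ -gsumD.
    by apply: eq_gsum => th; ring.
  rewrite sumr_const card_ord_gt -/m rmorphM rmorph_nat /=.
  by rewrite -[RHS]mulrA [_ * gsum _ _]mulrC mulrA -[LHS]mulr_natr; ring.
rewrite -gsumZ -!gsumD; apply: eq_gsum => th; rewrite /P ypartS /yc.
by rewrite rmorphM rmorph_nat /=; ring.
Qed.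

End WardStep.

(** * Moment recursion *)

Section Recursion.
Variables (R : realType) (N : nat) (theta lam : R).
Hypotheses (lam0 : 0 < lam).
Local Notation conf := ('I_N -> R).
Local Notation cmod := (@cmod R).
Local Notation expi := (@expi R).
Local Notation yc := (@yc R N theta).
Local Notation yconj := (@yconj R N theta).
Local Notation ypart := (@ypart R N theta).
Local Notation wreg := (@wreg R N theta lam).

Definition fprod (c : R[i]) : R[i] := \prod_(j < N) (c + (lam * j%:R)%:C%C).

Lemma fprod_rev (c : R[i]) :
  \prod_(i < N) (c + (lam * (N - i.+1)%:R)%:C%C) = fprod c.
Proof. by rewrite /fprod [RHS](reindex_inj rev_ord_inj). Qed.

(** The [N] relations of [ward_step] chain from the empty product to the full product [D]. They stay
    multiplied out, since [negl] is stable under multiplication by constants. *)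
Lemma ward_chain (a t : R) (e : bool) : adm a t ->
  negl (fun th => fprod (1 + (a +i* t)%C) * (ypart N th * yconj e th * wreg a t 0 th) -
     fprod (1 + (e : nat)%:R + 2 * (a +i* t)%C) * (yconj e th * wreg a t 0 th)).
Proof.
move=> ad; set s := (a +i* t)%C : R[i].
pose Af (i : nat) := 1 + s + (lam * (N - i.+1)%:R)%:C%C.
pose Bf (i : nat) := 1 + (e : nat)%:R + 2 * s + (lam * (N - i.+1)%:R)%:C%C.
suff H r : (r <= N)%N -> negl (fun th =>
    (\prod_(i < r) Af i) * (ypart r th * yconj e th * wreg a t 0 th) -
    (\prod_(i < r) Bf i) * (yconj e th * wreg a t 0 th)).
  by apply: negl_ext (H N (leqnn N)) => K; rewrite !fprod_rev.
elim: r => [_|r IH rN].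
  move=> eps eps0; exists 0%N => K _.
  rewrite (_ : gsum K _ = 0) ?cmod0 ?mulr_ge0 ?(ltW eps0)//.
  rewrite /gsum big1// => g _; rewrite !big_ord0 /ypart big_pred0 ?mul1r ?subrr//.
have := ward_step theta e lam0 ad (Ordinal rN) => /= /(neglZ (- \prod_(i < r) Af i)) H1.
have H2 := neglZ (Bf r) (IH (ltnW rN)).
apply: negl_ext (neglD H1 H2) => K; apply: eq_gsum => th.
by rewrite !big_ord_recr /= /Af /Bf -/s; ring.
Qed.

Lemma conj_cpow (a t x : R) : conjc (cpow a t x) = cpow a (- t) x.
Proof.
rewrite /cpow mulNr -conj_expi.
case: (expi _) => u v; apply/eqP; rewrite eq_complex /=.
by apply/andP; split; apply/eqP; ring.
Qed.

Lemma conj_wreg (a t d : R) (th : conf) : conjc (wreg a t d th) = wreg a (- t) d th.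
Proof.
rewrite /wreg rmorphM !rmorph_prod; congr (_ * _).
  by apply: eq_bigr => j _; exact: conj_cpow.
apply: eq_bigr => j _; rewrite rmorph_prod; apply: eq_bigr => k _.
by rewrite [LHS]conj_cpow oppr0.
Qed.

Lemma cpowS (a t x : R) : 0 <= a -> 0 <= x -> x%:C%C * cpow a t x = cpow (a + 1) t x.
Proof.
move=> a0 x0; rewrite /cpow mulrA; congr (_ * _).
rewrite -(rmorphM (real_complex R)) /=; congr (_%:C%C).
have [->|xn0] := eqVneq x 0.
  by rewrite mul0r powR0// gt_eqF// ltr_wpDl.
by rewrite powRD ?xn0 ?implybT// powRr1// mulrC.
Qed.

Lemma yc_conj (th : conf) j : yc th j * conjc (yc th j) = (chord2 (th j - theta))%:C%C.
Proof.
rewrite mul_conj_cmod /yc /zc -expi0 cmod_sub_expi /chord2 sub0r cosN.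
by [].
Qed.

Lemma wregS (a t : R) (th : conf) : 0 <= a ->
  ypart N th * yconj true th * wreg a t 0 th = wreg (a + 1) t 0 th.
Proof.
move=> a0.
have -> : ypart N th = \prod_j yc th j.
  by rewrite /ypart; apply: eq_bigl => j; rewrite ltn_ord.
rewrite /yconj /wreg mulrA; congr (_ * _); rewrite -!big_split /=.
apply: eq_bigr => j _; rewrite expr1 yc_conj /onef !addr0 cpowS//.
exact: chord2_ge0.
Qed.

Lemma conj_fprod (c : R[i]) : conjc (fprod c) = fprod (conjc c).
Proof.
rewrite /fprod rmorph_prod; apply: eq_bigr => j _.
case: c => u v; apply/eqP; rewrite eq_complex /=.
by apply/andP; split; apply/eqP; ring.
Qed.

Lemma adm_ge0 (a t : R) : adm a t -> 0 <= a.
Proof. by case=> [/ltW|[-> _]]. Qed.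

(** Two chains are composed through the sum of [conj(D) w]: the case [e = 1] leads from it to
    [D conj(D) w], and the case [e = 0] at [- t], conjugated, leads from [w] to it. *)
Lemma moment_step (a t : R) : adm a t ->
  negl (fun th => fprod (1 + (a +i* t)%C) ^+ 2 * wreg (a + 1) t 0 th -
     fprod (1 + 2 * (a +i* t)%C) * fprod (2 + 2 * (a +i* t)%C) * wreg a t 0 th).
Proof.
move=> ad.
have adN : adm a (- t) by case: ad => [|[-> ->]]; [left|right; rewrite oppr0].
have a0 := adm_ge0 ad.
set s := (a +i* t)%C : R[i].
have H1 := negl_conj (ward_chain false adN).
have H2 := ward_chain true ad; rewrite -/s in H2.
apply: negl_ext (neglD (neglZ (fprod (1 + s)) H2) (neglZ (fprod (2 + 2 * s)) H1)) => K.
apply: eq_gsum => th; rewrite wregS//.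
have c1 (A B Y E W : R[i]) : conjc (A * (Y * E * W) - B * (E * W)) =
    conjc A * (conjc Y * conjc E * conjc W) - conjc B * (conjc E * conjc W).
  by rewrite rmorphB !rmorphM.
rewrite c1 !conj_fprod !conj_wreg !opprK.
have -> : conjc (1 + (a +i* - t)%C) = 1 + s.
  by apply/eqP; rewrite eq_complex /= !opprD !opprK oppr0 !eqxx.
have -> : conjc (1 + (false : nat)%:R + 2 * (a +i* - t)%C) = 1 + 2 * s.
  by apply/eqP; rewrite eq_complex /=; apply/andP; split; apply/eqP; ring.
have -> : conjc (yconj false th) = 1.
  rewrite /yconj big1 ?rmorph1// => j _; exact: expr0.
have -> : conjc (ypart N th) = yconj true th.
  rewrite /ypart /yconj rmorph_prod; apply: eq_big => [j|j _]; first by rewrite ltn_ord.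
  by rewrite expr1.
have -> : 1 + (true : nat)%:R = 2 :> R[i] by rewrite [RHS]mulr2n.
by ring.
Qed.

(** The quotient [momB / momA] is the product of the ratios [r(s)] at [s = 2 (a + m + i t)],
    [m < n]. *)
Definition momA (n : nat) (a t : R) : R[i] :=
  \prod_(m < n) fprod (1 + ((a + m%:R) +i* t)%C) ^+ 2.
Definition momB (n : nat) (a t : R) : R[i] :=
  \prod_(m < n) (fprod (1 + 2 * ((a + m%:R) +i* t)%C) *
                 fprod (2 + 2 * ((a + m%:R) +i* t)%C)).

Lemma moment_chain (n : nat) (a t : R) : adm a t ->
  negl (fun th => momA n a t * wreg (a + n%:R) t 0 th - momB n a t * wreg a t 0 th).
Proof.
move=> ad; elim: n => [|n IH].
  move=> eps eps0; exists 0%N => K _.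
  rewrite (_ : gsum K _ = 0) ?cmod0 ?mulr_ge0 ?(ltW eps0)//.
  by rewrite /gsum big1// => g _; rewrite /momA /momB !big_ord0 addr0 subrr.
have adn : adm (a + n%:R) t.
  case: ad => [a0|[-> ->]]; first by left; rewrite ltr_pwDl.
  case: n {IH} => [|n]; first by right; rewrite addr0.
  by left; rewrite add0r ltr0n.
have H1 := neglZ (momA n a t) (moment_step adn).
have H2 := neglZ (fprod (1 + 2 * ((a + n%:R) +i* t)%C) *
                 fprod (2 + 2 * ((a + n%:R) +i* t)%C)) IH.
apply: negl_ext (neglD H1 H2) => K; apply: eq_gsum => th.
rewrite /momA /momB !big_ord_recr /= -/(momA n a t) -/(momB n a t).
have -> : a + n.+1%:R = a + n%:R + 1 by rewrite -natr1 addrA.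
by ring.
Qed.

Definition wabs (a : R) (th : conf) : R := cmod (wreg a 0 0 th).

Lemma cmod_wreg (a t : R) th : cmod (wreg a t 0 th) = wabs a th.
Proof.
rewrite /wabs /wreg !cmodM !cmod_prod; congr (_ * _).
by apply: eq_bigr => j _; rewrite /onef !cmod_cpow.
Qed.

Lemma wreg_real (a : R) th : wreg a 0 0 th = (wabs a th)%:C%C.
Proof.
have E x b : cpow b 0 x = (cmod (cpow b 0 x))%:C%C :> R[i].
  by rewrite cmod_cpow /cpow mul0r expi0 mulr1.
rewrite /wabs /wreg cmodM !cmod_prod rmorphM !rmorph_prod /=; congr (_ * _).
  by apply: eq_bigr => j _; exact: E.
apply: eq_bigr => j _; rewrite cmod_prod rmorph_prod; apply: eq_bigr => k _.
exact: E.
Qed.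

Lemma fprod_gt0 (c : R) : 0 < c -> 0 < \prod_(j < N) (c + lam * j%:R).
Proof. by move=> c0; apply: prodr_gt0 => j _; rewrite ltr_pwDl// mulr_ge0// ltW. Qed.

Lemma fprod_real (c : R) : fprod c%:C%C = (\prod_(j < N) (c + lam * j%:R))%:C%C.
Proof.
by rewrite /fprod rmorph_prod; apply: eq_bigr => j _; rewrite rmorphD.
Qed.

Lemma cmod_fprod_gt0 (c : R[i]) : 0 < Re c -> 0 < cmod (fprod c).
Proof.
move=> c0; rewrite cmod_prod; apply: prodr_gt0 => j _.
apply: lt_le_trans (Re_le_cmod _) => /=; rewrite normr_gt0 gt_eqF//.
by case: c c0 => u v /= u0; rewrite ltr_pwDl// mulr_ge0// ltW.
Qed.

Lemma cmod_momA_gt0 n (a t : R) : 0 <= a -> 0 < cmod (momA n a t).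
Proof.
move=> a0; rewrite cmod_prod; apply: prodr_gt0 => m _; rewrite cmodX exprn_gt0//.
by apply: cmod_fprod_gt0 => /=; rewrite ltr_pwDl// addr_ge0.
Qed.

Lemma cmod_momB_gt0 n (a t : R) : 0 <= a -> 0 < cmod (momB n a t).
Proof.
move=> a0; rewrite cmod_prod; apply: prodr_gt0 => m _; rewrite cmodM.
have am : 0 <= a + m%:R by rewrite addr_ge0.
have E1 : Re (1 + 2 * ((a + m%:R) +i* t)%C) = 1 + 2 * (a + m%:R) by rewrite /=; ring.
have E2 : Re (2 + 2 * ((a + m%:R) +i* t)%C) = 2 + 2 * (a + m%:R) by rewrite /=; ring.
by rewrite mulr_gt0//; apply: cmod_fprod_gt0; rewrite ?E1 ?E2 ltr_pwDl// mulr_ge0.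
Qed.

(* The shifted moment is at most the shifted moment of the modulus, and the latter
   is computed by the same recursion at [t = 0]. *)
Lemma oscillating_moment_bound (n : nat) (a t : R) : adm a t ->
  forall eps, 0 < eps -> exists K0 : nat, forall K, (K0 <= K)%N ->
    cmod (gsum K (wreg a t 0)) <=
      cmod (momA n a t) / cmod (momB n a t) * (cmod (momB n a 0) / cmod (momA n a 0))
       * gsum K (wabs a) + eps * K%:R ^+ N.
Proof.
move=> ad eps eps0.
have a0 := adm_ge0 ad.
have ad0 : adm a 0 by case: ad => [|[-> _]]; [left|right].
have At := cmod_momA_gt0 n t a0; have Bt := cmod_momB_gt0 n t a0.
have A0 := cmod_momA_gt0 n 0 a0; have B0 := cmod_momB_gt0 n 0 a0.
set at_ := cmod (momA n a t) in At *; set bt := cmod (momB n a t) in Bt *.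
set a0_ := cmod (momA n a 0) in A0 *; set b0 := cmod (momB n a 0) in B0 *.
have e1 : 0 < eps / 2 * bt by rewrite mulr_gt0// divr_gt0.
have e2 : 0 < eps / 2 * bt * a0_ / at_ by rewrite divr_gt0// !mulr_gt0// divr_gt0.
have [K1 h1] := moment_chain n ad e1; have [K2 h2] := moment_chain n ad0 e2.
exists (maxn K1 K2) => K; rewrite geq_max => /andP[/h1 {}h1 /h2 {}h2].
have split_gsum u : gsum K (fun th => momA n a u * wreg (a + n%:R) u 0 th -
    momB n a u * wreg a u 0 th) =
   momA n a u * gsum K (wreg (a + n%:R) u 0) - momB n a u * gsum K (wreg a u 0).
  rewrite -!gsumZ -mulN1r -gsumZ -gsumD; apply: eq_gsum => th; ring.
rewrite !split_gsum in h1 h2.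
have real_gsum b : cmod (gsum K (wreg b 0 0)) = gsum K (wabs b).
  have -> : gsum K (wreg b 0 0) = (gsum K (wabs b))%:C%C.
    rewrite -(@gsum_morph _ _ _ _ K (real_complex R)).
      by apply: eq_gsum => th; rewrite wreg_real.
    - exact: rmorphD.
    - exact: rmorph0.
  by rewrite cmod_real ger0_norm// sumr_ge0// => g _; exact: cmod_ge0.
set KN := K%:R ^+ N in h1 h2 *.
have KN0 : 0 <= KN by rewrite exprn_ge0.
have i1 : bt * cmod (gsum K (wreg a t 0)) <=
    at_ * gsum K (wabs (a + n%:R)) + eps / 2 * bt * KN.
  rewrite -cmodM; set X := momB n a t * _ in h1 *; set Y := momA n a t * _ in h1.
  have -> : X = Y - (Y - X) by ring.
  apply: le_trans (cmodB_le _ _) _; apply: lerD => //.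
  rewrite cmodM ler_pM2l//; apply: le_trans (cmod_gsum _ _) _.
  by rewrite le_eqVlt; apply/orP; left; apply/eqP/eq_gsum => th; rewrite cmod_wreg.
have i2 : a0_ * gsum K (wabs (a + n%:R)) <=
    b0 * gsum K (wabs a) + eps / 2 * bt * a0_ / at_ * KN.
  rewrite -!real_gsum -!cmodM; set Y := momB n a 0 * _ in h2 *.
  set X := momA n a 0 * _ in h2 *.
  have -> : X = Y + (X - Y) by ring.
  by apply: le_trans (cmodD_le _ _) _; apply: lerD.
set G := gsum K (wabs a) in i2 *; set G' := gsum K (wabs (a + n%:R)) in i1 i2.
rewrite -(ler_pM2l Bt); apply: le_trans i1 _.
have {}i2 : G' <= (b0 * G + eps / 2 * bt * a0_ / at_ * KN) / a0_.
  by rewrite ler_pdivlMr// mulrC.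
apply: le_trans (_ : at_ * ((b0 * G + eps / 2 * bt * a0_ / at_ * KN) / a0_)
    + eps / 2 * bt * KN <= _); first by rewrite lerD2r ler_pM2l.
rewrite le_eqVlt; apply/orP; left; apply/eqP; field.
by rewrite !gt_eqF.
Qed.

End Recursion.

(** * Decay of the oscillating moments *)

Section MomentRatio.
Variables (R : realType) (lam : R).
Hypothesis (lam0 : 0 < lam).
Local Notation cmod := (@cmod R).

Lemma ratio_le1 (x A C : R) : 0 <= x -> 0 < A -> A <= C ->
  (1 + x / C ^+ 2) / (1 + x / A ^+ 2) <= 1.
Proof.
move=> x0 A0 hAC; have C0 : 0 < C by apply: lt_le_trans hAC.
have h : 0 <= x / A ^+ 2 by rewrite divr_ge0// sqr_ge0.
rewrite ler_pdivrMr ?mul1r; last by rewrite ltr_pwDl.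
rewrite lerD2l ler_wpM2l// lef_pV2 ?posrE ?exprn_gt0//.
by rewrite ler_sqr ?nnegrE ?(ltW A0) ?(ltW C0).
Qed.

(** The constant is [9 / 25 = 1 - (4 / 5) ^ 2]: enlarging [A] by [5 / 4] shrinks [x / A ^+ 2] by at
    least [16 / 25]. The loss relative to [1 + x / A ^+ 2] is then put into the exponential by
    [1 + u <= expR u]. *)
Lemma ratio_le_expR (x A C : R) : 0 <= x -> 0 < A -> 5 / 4 * A <= C ->
  (1 + x / C ^+ 2) / (1 + x / A ^+ 2) <= expR (- (9 / 25) * (x / (A ^+ 2 + x))).
Proof.
move=> x0 A0 hAC.
have C0 : 0 < C by apply: lt_le_trans hAC; rewrite mulr_gt0// divr_gt0.
have A2 : 0 < A ^+ 2 by rewrite exprn_gt0.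
have h : 0 <= x / A ^+ 2 by rewrite divr_ge0// ltW.
apply: le_trans (expR_ge1Dx _).
rewrite ler_pdivrMr; last by rewrite ltr_pwDl.
have -> : (1 + - (9 / 25) * (x / (A ^+ 2 + x))) * (1 + x / A ^+ 2) =
   1 + x * (16 / 25 / A ^+ 2).
  field; rewrite gt_eqF//= gt_eqF// ltr_pwDl//.
rewrite lerD2l ler_wpM2l//.
rewrite -[leLHS]mul1r ler_pdivrMr ?exprn_gt0// mulrAC ler_pdivlMr//.
have : (5 / 4 * A) ^+ 2 <= C ^+ 2.
  by rewrite ler_sqr ?nnegrE ?(ltW C0)// ltW// mulr_gt0// divr_gt0.
rewrite exprMn; lra.
Qed.

(** Contribution of one pair [(m, j)] to the square of the moment ratio; squaring removes the roots
    in the moduli. The [2] in [2 * B] brings the relative imaginary part [t / B] to the same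
    numerator [2 t] as in the other two factors. *)
Definition mfac (a t : R) (m j : nat) : R :=
  let B := 1 + (a + m%:R) + lam * j%:R in
  let A1 := 1 + 2 * (a + m%:R) + lam * j%:R in
  let A2 := 2 + 2 * (a + m%:R) + lam * j%:R in
  let x := 4 * t ^+ 2 in
  (1 + x / (2 * B) ^+ 2) / (1 + x / A1 ^+ 2) *
  ((1 + x / (2 * B) ^+ 2) / (1 + x / A2 ^+ 2)).

Lemma moment_ratio_sq (N n : nat) (a t : R) : 0 <= a ->
  (cmod (momA N lam n a t) / cmod (momB N lam n a t) *
    (cmod (momB N lam n a 0) / cmod (momA N lam n a 0))) ^+ 2 =
  \prod_(m < n) \prod_(j < N) mfac a t m j.
Proof.
move=> a0.
have E u : (cmod (momA N lam n a u)) ^+ 2 = \prod_(m < n) \prod_(j < N)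
    (cmod ((1 + (a + m%:R) + lam * j%:R) +i* u)%C ^+ 2) ^+ 2.
  rewrite cmod_prod -prodrXl; apply: eq_bigr => m _.
  rewrite cmodX /fprod cmod_prod -!prodrXl; apply: eq_bigr => j _.
  do 2 congr (_ ^+ _); congr cmod; apply/eqP; rewrite eq_complex /=.
  by apply/andP; split; apply/eqP; ring.
have F u : (cmod (momB N lam n a u)) ^+ 2 = \prod_(m < n) \prod_(j < N)
    (cmod ((1 + 2 * (a + m%:R) + lam * j%:R) +i* (2 * u))%C ^+ 2 *
     cmod ((2 + 2 * (a + m%:R) + lam * j%:R) +i* (2 * u))%C ^+ 2).
  rewrite cmod_prod -prodrXl; apply: eq_bigr => m _.
  rewrite cmodM /fprod !cmod_prod exprMn -!prodrXl -big_split.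
  have cE (z w : R[i]) : Re z = Re w -> Im z = Im w -> cmod z = cmod w.
    by move=> h1 h2; rewrite !cmodE h1 h2.
  by apply: eq_bigr => j _; congr (_ * _); congr (_ ^+ _); apply: cE => /=; ring.
rewrite !exprMn !exprVn !E !F.
rewrite -!prodfV -!big_split; apply: eq_bigr => m _.
rewrite -!prodfV -!big_split; apply: eq_bigr => j _.
have lj : 0 <= lam * j%:R by rewrite mulr_ge0// ltW.
have am : 0 <= a + m%:R by rewrite addr_ge0.
rewrite /mfac; set B := 1 + _ + _; set A1 := 1 + _ + _; set A2 := 2 + _ + _.
have B0 : 0 < B by rewrite /B; lra.
have A10 : 0 < A1 by rewrite /A1; lra.
have A20 : 0 < A2 by rewrite /A2; lra.
rewrite mulr0 !cmod_sq /= !expr0n !addr0 /=; field.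
have p1 : 0 < A1 ^+ 2 + (2 * t) ^+ 2 by rewrite ltr_pwDl ?exprn_gt0 ?sqr_ge0.
have p2 : 0 < A2 ^+ 2 + (2 * t) ^+ 2 by rewrite ltr_pwDl ?exprn_gt0 ?sqr_ge0.
have q : (2 * t) ^+ 2 = 4 * t ^+ 2 by ring.
by rewrite -q !gt_eqF.
Qed.

Lemma mfac_ge0 (a t : R) m j : 0 <= mfac a t m j.
Proof.
have x0 : 0 <= 4 * t ^+ 2 by rewrite mulr_ge0// sqr_ge0.
have h (u : R) : 0 <= 1 + 4 * t ^+ 2 / u ^+ 2.
  by rewrite addr_ge0// divr_ge0// sqr_ge0.
by rewrite /mfac mulr_ge0// divr_ge0.
Qed.

Lemma mfac_le1 (a t : R) m j : 0 <= a -> mfac a t m j <= 1.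
Proof.
move=> a0.
have x0 : 0 <= 4 * t ^+ 2 by rewrite mulr_ge0// sqr_ge0.
have h (u : R) : 0 <= 1 + 4 * t ^+ 2 / u ^+ 2.
  by rewrite addr_ge0// divr_ge0// sqr_ge0.
have lj : 0 <= lam * j%:R by rewrite mulr_ge0// ltW.
have am : 0 <= a + m%:R by rewrite addr_ge0.
rewrite /mfac -[leRHS]mulr1; apply: ler_pM; rewrite ?divr_ge0//;
  apply: ratio_le1 => //; lra.
Qed.

(** The hypotheses give [2 * B >= 5 / 4 * A1], so the quotient with [A1] decays; the quotient with
    [A2] is merely bounded by 1. *)
Lemma mfac_le_expR (a t : R) m j : 0 <= a -> 2 * a <= 1 -> 2 * m%:R <= lam * j%:R ->
  mfac a t m j <= expR (- (9 / 25) *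
    (4 * t ^+ 2 / ((1 + 2 * (a + m%:R) + lam * j%:R) ^+ 2 + 4 * t ^+ 2))).
Proof.
move=> a0 a1 mj.
have x0 : 0 <= 4 * t ^+ 2 by rewrite mulr_ge0// sqr_ge0.
have h (u : R) : 0 <= 1 + 4 * t ^+ 2 / u ^+ 2.
  by rewrite addr_ge0// divr_ge0// sqr_ge0.
have m0 : 0 <= m%:R :> R by [].
rewrite /mfac -[leRHS]mulr1; apply: ler_pM; rewrite ?divr_ge0//.
  apply: ratio_le_expR => //; lra.
by apply: ratio_le1 => //; lra.
Qed.

(** Here [1 + 2 (a + m) + lam j <= 2 (1 + lam) j], and the bound improves as [|t|] grows. Hence a
    rate depending on [t0] only, which serves all the frequencies of a Fejer sum at once. *)
Lemma mfac_decay (t0 a t : R) m j : 0 < t0 -> t0 <= `|t| -> 0 <= a -> 2 * a <= 1 ->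
  (0 < j)%N -> 2 * m%:R <= lam * j%:R ->
  mfac a t m j <= expR (- (9 / 25 * (t0 ^+ 2 / (1 + t0 ^+ 2) / (1 + lam) ^+ 2)
     / j%:R ^+ 2)).
Proof.
move=> t00 tt0 a0 a1 j0 mj.
apply: le_trans (mfac_le_expR t a0 a1 mj) _.
rewrite ler_expR mulNr lerN2 -[leLHS]mulrA ler_pM2l ?divr_gt0//.
have j1 : 1 <= j%:R :> R by rewrite ler1n.
have j0' : 0 < j%:R :> R by rewrite ltr0n.
have m0 : 0 <= m%:R :> R by [].
set A := 1 + _ + _.
have A0 : 0 < A by rewrite /A; lra.
have L0 : 0 < 1 + lam by rewrite addr_gt0.
have AL : A <= 2 * ((1 + lam) * j%:R) by rewrite /A; nra.
have AL2 : A ^+ 2 <= 4 * ((1 + lam) ^+ 2 * j%:R ^+ 2).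
  apply: le_trans (_ : (2 * ((1 + lam) * j%:R)) ^+ 2 <= _).
    by rewrite ler_sqr ?nnegrE ?(ltW A0) ?mulr_ge0 ?(ltW L0).
  by rewrite !exprMn; lra.
have tt2 : t0 ^+ 2 <= t ^+ 2.
  by rewrite -[leRHS]real_normK ?num_real// ler_sqr ?nnegrE// (ltW t00).
have t02 : 0 < t0 ^+ 2 by rewrite exprn_gt0.
have p1 : 0 < A ^+ 2 + 4 * t ^+ 2.
  by rewrite ltr_pwDl ?exprn_gt0// mulr_ge0// sqr_ge0.
set L := (1 + lam) ^+ 2 in AL2 *; set J := j%:R ^+ 2 in AL2 *.
have LJ : 1 <= L * J.
  by rewrite -[leLHS]mulr1 /L /J; apply: ler_pM => //; rewrite exprn_ege1// lerDl ltW.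
have -> : t0 ^+ 2 / (1 + t0 ^+ 2) / L / J = t0 ^+ 2 / ((1 + t0 ^+ 2) * (L * J)).
  have L1 : 0 < L by rewrite exprn_gt0.
  have J1 : 0 < J by rewrite exprn_gt0.
  have T1 : 0 < 1 + t0 ^+ 2 by rewrite addr_gt0.
  by field; rewrite !gt_eqF.
rewrite ler_pdivrMr; last by rewrite mulr_gt0 ?addr_gt0// (lt_le_trans ltr01 LJ).
rewrite mulrAC ler_pdivlMr//.
set u := t0 ^+ 2 in t02 tt2 *; set v := t ^+ 2 in tt2 p1 *; set Z := L * J in LJ AL2 *.
set W := A ^+ 2 in AL2 p1 *.
have : u * (W + 4 * v) <= u * (4 * Z + 4 * v) by rewrite ler_pM2l// lerD2r.
move=> i1; apply: le_trans i1 _.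
have i2 : u * Z <= v * Z by rewrite ler_pM2r// (lt_le_trans ltr01).
have i3 : u * v * 1 <= u * v * Z by rewrite ler_wpM2l// mulr_ge0 ?ltW// (lt_le_trans t02).
nra.
Qed.

Lemma harmonic_ge_ln (N : nat) : (0 < N)%N ->
  ln N%:R <= \sum_(j < N) (if (0 < j)%N then (j%:R)^-1 else 0) :> R.
Proof.
elim: N => // -[_ _|N IH _]; first by rewrite big_ord1 /= ln1.
rewrite big_ord_recr /=.
have N0 : 0 < N.+1%:R :> R by rewrite ltr0n.
have -> : N.+2%:R = N.+1%:R * (1 + N.+1%:R^-1) :> R.
  by rewrite mulrDr mulr1 mulfV ?gt_eqF// -natr1.
have V0 : 0 < N.+1%:R^-1 :> R by rewrite invr_gt0.
rewrite lnM ?posrE ?addr_gt0//.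
by apply: lerD; [exact: IH|rewrite le_ln1Dx// (lt_trans _ V0)].
Qed.

(** The indices from 0 to the integer part of [y / 2] all qualify: one more than that integer part,
    hence more than [y / 2]. The hypothesis on [n] makes them available. *)
Lemma count_small_indices (n : nat) (y : R) : 0 <= y -> y / 2 + 1 <= n%:R ->
  y / 2 <= \sum_(m < n) (if 2 * m%:R <= y then 1 else 0).
Proof.
move=> y0 yn.
have y20 : 0 <= y / 2 by rewrite divr_ge0.
set M := (Num.truncn (y / 2)).+1.
have Mn : (M <= n)%N.
  rewrite /M -(ler_nat R) -natr1; apply: le_trans yn; rewrite lerD2r.
  by rewrite truncn_le.
rewrite -(big_mkord xpredT (fun m => if 2 * m%:R <= y then 1 else 0)).
rewrite (@big_cat_nat _ _ _ M) //=.
apply: le_trans (_ : \sum_(0 <= m < M) (1 : R) + 0 <= _).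
  rewrite addr0 sumr_const_nat subn0; apply/ltW.
  by have := truncnS_gt (y / 2).
apply: lerD; last by apply: sumr_ge0 => m _; case: ifP.
apply: ler_sum_nat => m /= mM.
suff -> : 2 * m%:R <= y by [].
rewrite mulrC -ler_pdivlMr//.
by apply: le_trans (_ : (Num.truncn (y / 2))%:R <= _); rewrite ?truncn_le// ler_nat.
Qed.

(** For each [j > 0] at least [lam j / 2] indices [m] contribute the exponent of [mfac_decay],
    whence [decay_rate t0 / j]. Summed over [j], this makes the squared ratio at most [N] to the
    power [- decay_rate t0]. *)
Definition decay_rate (t0 : R) : R :=
  9 / 25 * (t0 ^+ 2 / (1 + t0 ^+ 2) / (1 + lam) ^+ 2) * (lam / 2).

Lemma decay_rate_gt0 t0 : 0 < t0 -> 0 < decay_rate t0.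
Proof.
move=> t00; rewrite /decay_rate; have t2 : 0 < t0 ^+ 2 by rewrite exprn_gt0.
have T1 : 0 < 1 + t0 ^+ 2 by rewrite addr_gt0.
have L1 : 0 < (1 + lam) ^+ 2 by rewrite exprn_gt0// addr_gt0.
apply: mulr_gt0; last by rewrite divr_gt0.
by rewrite mulr_gt0 ?divr_gt0.
Qed.

Lemma moment_ratio_decay (t0 a t : R) (N n : nat) : 0 < t0 -> t0 <= `|t| ->
  0 <= a -> 2 * a <= 1 -> (0 < N)%N -> lam * N%:R / 2 + 1 <= n%:R ->
  cmod (momA N lam n a t) / cmod (momB N lam n a t) *
    (cmod (momB N lam n a 0) / cmod (momA N lam n a 0)) <=
  expR (- (decay_rate t0 / 2 * ln N%:R)).
Proof.
move=> t00 tt0 a0 a1 N0 nN.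
rewrite -ler_sqr ?nnegrE ?expR_ge0//; last first.
  by rewrite !mulr_ge0 ?cmod_ge0// invr_ge0 cmod_ge0.
rewrite moment_ratio_sq// -expRM_natl.
set c := 9 / 25 * (t0 ^+ 2 / (1 + t0 ^+ 2) / (1 + lam) ^+ 2).
have c0 : 0 <= c.
  have := decay_rate_gt0 t00; rewrite /decay_rate -/c pmulr_lgt0 ?divr_gt0//.
  exact: ltW.
pose w (m j : nat) : R := if (0 < j)%N && (2 * m%:R <= lam * j%:R) then c / j%:R ^+ 2 else 0.
have F m j : mfac a t m j <= expR (- w m j).
  rewrite /w; case: ifP => [/andP[j0 mj]|_]; first exact: mfac_decay.
  by rewrite oppr0 expR0; exact: mfac_le1.
apply: le_trans (_ : \prod_(m < n) \prod_(j < N) expR (- w m j) <= _).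
  apply: ler_prod => m _; apply/andP; split.
    by apply: prodr_ge0 => j _; exact: mfac_ge0.
  by apply: ler_prod => j _; rewrite mfac_ge0 F.
have -> : \prod_(m < n) \prod_(j < N) expR (- w m j) =
    expR (- \sum_(j < N) \sum_(m < n) w m j).
  rewrite exchange_big /= -sumrN expR_sum; apply: eq_bigr => m _.
  by rewrite -sumrN expR_sum.
rewrite ler_expR mulrN lerN2.
have -> : 2 * (decay_rate t0 / 2 * ln N%:R) = c * (lam / 2) * ln N%:R.
  by rewrite /decay_rate -/c; field.
apply: le_trans (_ : c * (lam / 2) *
    \sum_(j < N) (if (0 < j)%N then (j%:R)^-1 else 0) <= _).
  rewrite ler_wpM2l ?harmonic_ge_ln// mulr_ge0// divr_ge0// ltW//.
rewrite mulr_sumr; apply: ler_sum => j _.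
case: (posnP j) => j0.
  by rewrite j0 /= mulr0; apply: sumr_ge0 => m _; rewrite /w.
rewrite /w j0 /=.
have jr : 0 < (j : nat)%:R :> R by rewrite ltr0n.
apply: le_trans (_ : c / j%:R ^+ 2 *
   \sum_(m < n) (if 2 * m%:R <= lam * j%:R then 1 else 0) <= _); last first.
  rewrite mulr_sumr; apply: ler_sum => m _.
  by case: ifP => _; rewrite ?mulr1 ?mulr0.
apply: le_trans (_ : c / j%:R ^+ 2 * (lam * j%:R / 2) <= _).
  by rewrite le_eqVlt; apply/orP; left; apply/eqP; field; rewrite gt_eqF.
rewrite ler_wpM2l ?divr_ge0 ?sqr_ge0//.
apply: count_small_indices; first by rewrite mulr_ge0// ltW.
apply: le_trans nN; rewrite lerD2r ler_pM2r ?invr_gt0// ler_pM2l// ler_nat.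
exact: ltnW.
Qed.

End MomentRatio.

(** * The Fejer kernel *)

Section Fejer.
Variables (R : realType) (n : nat).

Definition fejer_coef (m : nat) : R := (1 - m.+1%:R / n.+1%:R) / (pi * m.+1%:R).

(* The sums have [n] terms: the kernel has order [n.+1], and period [1]. *)
Definition fejer_prim (x : R) : R :=
  x + \sum_(m < n) fejer_coef m * sin (2 * pi * m.+1%:R * x).

Definition fejer (x : R) : R :=
  1 + \sum_(m < n) 2 * (1 - m.+1%:R / n.+1%:R) * cos (2 * pi * m.+1%:R * x).

Let pi0 : 0 < (pi : R) := pi_gt0 R.
Let n0 : 0 < n.+1%:R :> R := ltr0Sn R n.

Lemma is_derive_fejer_prim (x : R) : is_derive x 1 fejer_prim (fejer x).
Proof.
have ds (m : nat) : is_derive x 1 (fun x => fejer_coef m * sin (2 * pi * m.+1%:R * x))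
    (2 * (1 - m.+1%:R / n.+1%:R) * cos (2 * pi * m.+1%:R * x)).
  have dl : is_derive x 1 (fun x => 2 * pi * m.+1%:R * x) (2 * pi * m.+1%:R).
    by apply: is_derive_eq; rewrite /GRing.scale/=; ring.
  have dc : is_derive x 1 (fun x => sin (2 * pi * m.+1%:R * x))
      (cos (2 * pi * m.+1%:R * x) * (2 * pi * m.+1%:R)).
    exact: (@is_derive1_comp R sin (fun x => 2 * pi * m.+1%:R * x)).
  apply: is_derive_eq; rewrite /GRing.scale/= /fejer_coef.
  move: (cos _) => c; have := pi0; have := n0; have := ltr0Sn R m.
  move: m.+1%:R n.+1%:R (pi : R) => a b p a0 b0 p0.
  by field; rewrite !gt_eqF.
have E : fejer_prim = (fun x => x) + \sum_(m < n) (fun x => fejer_coef m * sin (2 * pi * m.+1%:R * x)).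
  by apply/funext => y; rewrite /fejer_prim fctE fct_sumE.
rewrite E /fejer; apply: is_deriveD; apply: is_derive_sum => m; exact: ds.
Qed.

End Fejer.

Section FejerKernel.
Variable R : realType.
Let pi0 : 0 < (pi : R) := pi_gt0 R.

Lemma dirichlet_sum (n : nat) (s : R) :
  sin s * (1 + 2 * \sum_(m < n) cos (2 * m.+1%:R * s)) = sin ((2 * n%:R + 1) * s).
Proof.
elim: n => [|n IH]; first by rewrite big_ord0 !mulr0 addr0 add0r mul1r mulr1.
rewrite big_ord_recr /=; move: IH; set S := \sum_(_ < _) _ => IH.
have E c : sin s * (1 + 2 * (S + c)) = sin s * (1 + 2 * S) + 2 * sin s * c by ring.
rewrite E IH; have -> : (2 * n%:R + 1) * s = 2 * n.+1%:R * s - s by rewrite -natr1; ring.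
have -> : (2 * n.+1%:R + 1) * s = 2 * n.+1%:R * s + s by ring.
by rewrite sinB sinD; ring.
Qed.

(** From [n] to [n.+1] the left side grows by [sin s] times the product computed in [dirichlet_sum],
    and the right side by [sin(v)^2 - sin(u)^2 = sin(v - u) sin(v + u)] with [v - u = s]. *)
Lemma fejer_sum (n : nat) (s : R) :
  sin s ^+ 2 * (n.+1%:R + 2 * \sum_(m < n) (n - m)%:R * cos (2 * m.+1%:R * s)) =
  sin (n.+1%:R * s) ^+ 2.
Proof.
elim: n => [|n IH]; first by rewrite big_ord0 mulr0 addr0 mulr1 mul1r.
have -> : \sum_(m < n.+1) (n.+1 - m)%:R * cos (2 * m.+1%:R * s) =
    \sum_(m < n) (n - m)%:R * cos (2 * m.+1%:R * s) +
    \sum_(m < n.+1) cos (2 * m.+1%:R * s).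
  rewrite !big_ord_recr /= subSnn mul1r addrA; congr (_ + _).
  rewrite -big_split /=; apply: eq_bigr => m _.
  by rewrite subSn 1?ltnW// -natr1 mulrDl mul1r.
have -> : sin s ^+ 2 * (n.+2%:R + 2 * (\sum_(m < n) (n - m)%:R * cos (2 * m.+1%:R * s) +
    \sum_(m < n.+1) cos (2 * m.+1%:R * s))) =
  sin s ^+ 2 * (n.+1%:R + 2 * \sum_(m < n) (n - m)%:R * cos (2 * m.+1%:R * s)) +
  sin s * (sin s * (1 + 2 * \sum_(m < n.+1) cos (2 * m.+1%:R * s))).
  by rewrite -[n.+2%:R]natr1; ring.
rewrite IH dirichlet_sum.
have -> : (2 * n.+1%:R + 1) * s = n.+1%:R * s + n.+2%:R * s.
  by rewrite -[n.+2%:R]natr1; ring.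
have -> : sin s = sin (n.+2%:R * s - n.+1%:R * s).
  by congr sin; rewrite -[n.+2%:R]natr1; ring.
set u := n.+1%:R * s; set v := n.+2%:R * s.
rewrite sinB sinD; have := cos2Dsin2 u; have := cos2Dsin2 v => hv hu.
have -> : (sin v * cos u - cos v * sin u) * (sin u * cos v + cos u * sin v) =
  sin v ^+ 2 * cos u ^+ 2 - cos v ^+ 2 * sin u ^+ 2 by ring.
have -> : cos u ^+ 2 = 1 - sin u ^+ 2 by rewrite -hu; ring.
have -> : cos v ^+ 2 = 1 - sin v ^+ 2 by rewrite -hv; ring.
ring.
Qed.

Lemma fejerE (n : nat) (x : R) :
  n.+1%:R * fejer n x = n.+1%:R + 2 * \sum_(m < n) (n - m)%:R * cos (2 * m.+1%:R * (pi * x)).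
Proof.
rewrite /fejer mulrDr mulr1; congr (_ + _); rewrite !mulr_sumr; apply: eq_bigr => m _.
have -> : 2 * pi * m.+1%:R * x = 2 * m.+1%:R * (pi * x) by ring.
have -> : (n - m)%:R = n.+1%:R - m.+1%:R :> R.
  by rewrite -natrB ?subSS// ltnS ltnW.
by have := ltr0Sn R n; move: n.+1%:R => b b0; field; rewrite gt_eqF.
Qed.

Lemma fejer_sin (n : nat) (x : R) :
  n.+1%:R * fejer n x * sin (pi * x) ^+ 2 = sin (n.+1%:R * (pi * x)) ^+ 2.
Proof. by rewrite fejerE mulrC fejer_sum. Qed.

Lemma sin_mul_nat_eq0 (k : nat) (s : R) : sin s = 0 -> sin (k%:R * s) = 0.
Proof.
move=> s0; elim: k => [|k IH]; first by rewrite mul0r sin0.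
by rewrite -natr1 mulrDl mul1r sinD IH s0 mul0r mulr0 addr0.
Qed.

(** Off the zeros of [sin (pi * x)] the kernel is a quotient of squares. At a zero the quotient says
    nothing, but every cosine in the sum equals 1. *)
Lemma fejer_ge0 (n : nat) (x : R) : 0 <= fejer n x.
Proof.
have n0 : 0 < n.+1%:R :> R := ltr0Sn R n.
have [s0|s0] := eqVneq (sin (pi * x)) 0; last first.
  have s2 : 0 < sin (pi * x) ^+ 2 by rewrite exprn_even_gt0.
  by rewrite -(pmulr_rge0 _ n0) -(pmulr_lge0 _ s2) fejer_sin sqr_ge0.
rewrite -(pmulr_rge0 _ n0) fejerE addr_ge0// mulr_ge0// sumr_ge0// => m _.
rewrite mulr_ge0//.
have -> : 2 * m.+1%:R * (pi * x) = (m.+1%:R * (pi * x)) *+ 2 by ring.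
rewrite cos_mulr2n.
have := cos2Dsin2 (m.+1%:R * (pi * x)); rewrite (sin_mul_nat_eq0 _ s0) => h.
by rewrite -mulr_natr; nra.
Qed.

End FejerKernel.

Section Sandwich.
Variables (R : realType) (n : nat).
Local Notation G := (@fejer_prim R n).
Let pi0 : 0 < (pi : R) := pi_gt0 R.
Let n0 : 0 < n.+1%:R :> R := ltr0Sn R n.

Lemma fejer_prim_mvt (x y : R) : x <= y ->
  exists2 c, x <= c <= y & G y - G x = fejer n c * (y - x).
Proof.
move=> xy.
have cf z : {for z, continuous G}.
  by apply/differentiable_continuous/derivable1_diffP; apply: ex_derive;
     exact: is_derive_fejer_prim.
have [|c cI E] := @MVT_segment R G (fejer n) x y xy
    (fun z _ => is_derive_fejer_prim n z).
  exact: continuous_subspaceT.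
by exists c => //; move: cI; rewrite in_itv.
Qed.

Lemma fejer_prim_nondecreasing (x y : R) : x <= y -> G x <= G y.
Proof.
move=> xy; have [c _ E] := fejer_prim_mvt xy.
by rewrite -subr_ge0 E mulr_ge0 ?fejer_ge0// subr_ge0.
Qed.

Lemma fejer_primDn (x : R) (k : nat) : G (x + k%:R) = G x + k%:R.
Proof.
rewrite /fejer_prim addrAC; congr (_ + _ + _); apply: eq_bigr => m _.
congr (_ * _).
have -> : 2 * pi * m.+1%:R * (x + k%:R) = 2 * pi * m.+1%:R * x + (pi *+ 2) *+ (m.+1 * k).
  by rewrite -[_ *+ (_ * _)]mulr_natr natrM -[pi *+ 2]mulr_natr; ring.
exact: (periodicn (@sinD2pi R)).
Qed.

Lemma fejer_primDz (x : R) (k : int) : G (x + k%:~R) = G x + k%:~R.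
Proof.
case: k => k; first by rewrite -pmulrn fejer_primDn.
rewrite NegzE mulrNz -pmulrn.
by apply/eqP; rewrite -subr_eq0 opprB addrA subr_eq0 -fejer_primDn subrK.
Qed.

Lemma fejer_primN (x : R) : G (- x) = - G x.
Proof.
rewrite /fejer_prim opprD -sumrN; congr (_ + _); apply: eq_bigr => m _.
by rewrite mulrN sinN mulrN.
Qed.

Lemma fejer_prim_half : G (1 / 2) = 1 / 2.
Proof.
rewrite /fejer_prim big1 ?addr0// => m _.
have -> : 2 * pi * m.+1%:R * (1 / 2) = m.+1%:R * pi :> R by field.
by rewrite (sin_mul_nat_eq0 _ (@sinpi R)) mulr0.
Qed.

Lemma sin_ge_half (x : R) : 0 <= x -> x <= 1 / 2 -> x / 2 <= sin x.
Proof.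
move=> x0 x1.
have [|c] := @MVT_segment R sin cos 0 x x0 (fun z _ => is_derive_sin z).
  by apply: continuous_subspaceT => z; exact: continuous_sin.
rewrite in_itv /= sin0 !subr0 => /andP[c0 cx] ->.
rewrite mulrC ler_wpM2r//.
have := cos_lipschitz 0 c; rewrite cos0 subr0 (ger0_norm c0) ler_distl.
by move=> /andP[h _]; lra.
Qed.

(** The left side is the mass of the kernel over one period outside [[-h, h]]. Beyond [h] the kernel
    is at most [1 / ((n + 1) sin(pi h)^2)], and [sin(pi h) >= pi h / 2 >= h]; as [pi < 4], the bound
    [1 / 8] keeps [pi h] within the range of [sin_ge_half]. *)
Lemma fejer_prim_tail (h : R) : 0 < h -> h <= 1 / 8 ->
  1 - 2 * G h <= 1 / (n.+1%:R * h ^+ 2).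
Proof.
move=> h0 h8.
have pi4 : (pi : R) < 4 by have := pihalf_lt2 R; lra.
have pi2 := pi_ge2 R.
have [|c /andP[hc c2]] := @fejer_prim_mvt h (1 / 2); first by lra.
rewrite fejer_prim_half => E.
have ph : pi * h <= 1 / 2 by nra.
have s1 : h <= sin (pi * h).
  apply: le_trans (sin_ge_half _ ph); first by nra.
  by rewrite mulr_ge0 ?ltW.
have s2 : sin (pi * h) <= sin (pi * c).
  have [->|hc'] := eqVneq h c; first by [].
  apply/ltW; rewrite ltr_sin.
  - by rewrite ltr_pM2l// lt_neqAle hc' hc.
  - by rewrite in_itv /=; apply/andP; split; nra.
  - by rewrite in_itv /=; apply/andP; split; nra.
have s0 : 0 < sin (pi * c) by apply: lt_le_trans s2; apply: lt_le_trans s1.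
have h2 : 0 < n.+1%:R * h ^+ 2 by rewrite mulr_gt0// exprn_gt0.
have K1 : fejer n c <= 1 / (n.+1%:R * h ^+ 2).
  rewrite ler_pdivlMr// mulrA [fejer n c * _]mulrC.
  apply: le_trans (_ : n.+1%:R * fejer n c * sin (pi * c) ^+ 2 <= _).
    rewrite ler_wpM2l ?mulr_ge0 ?fejer_ge0//.
    by rewrite ler_sqr ?nnegrE ?(ltW h0) ?(ltW s0)// (le_trans s1).
  rewrite fejer_sin; have := sin_le1 (n.+1%:R * (pi * c)).
  have := sin_geN1 (n.+1%:R * (pi * c)); nra.
have -> : 1 - 2 * G h = 2 * (fejer n c * (1 / 2 - h)) by rewrite -E; field.
by apply: le_trans K1; have := mulr_ge0 (fejer_ge0 n c) (ltW h0); lra.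
Qed.

Variables (al al' h : R).
Hypotheses (al1 : al <= al') (al2 : al' <= al + 1) (h0 : 0 < h) (h8 : h <= 1 / 8).
Local Notation tau := (1 / (n.+1%:R * h ^+ 2)).

(** A difference of two values of the primitive is the convolution of the kernel with the indicator
    of an arc modulo 1. Widening (here) or narrowing (below) the arc by [h] on each side and
    shifting by the tail mass [tau] makes it a majorant or a minorant of the indicator. *)
Definition upper_fejer (x : R) : R := G (x - al + h) - G (x - al' - h) + tau.
Definition lower_fejer (x : R) : R := G (x - al - h) - G (x - al' + h) - tau.

Let tau0 : 0 <= tau.
Proof. by rewrite divr_ge0// mulr_ge0// sqr_ge0. Qed.

Lemma fejer_diffDz (x p q : R) (k : int) :
  G (x - p) - G (x - q) = G (x - k%:~R - p) - G (x - k%:~R - q).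
Proof.
have -> : x - k%:~R - p = x - p + (- k)%:~R by rewrite mulrNz; ring.
have -> : x - k%:~R - q = x - q + (- k)%:~R by rewrite mulrNz; ring.
by rewrite !fejer_primDz; ring.
Qed.

Lemma upper_fejer_ge0 x : 0 <= upper_fejer x.
Proof.
rewrite /upper_fejer addr_ge0// subr_ge0; apply: fejer_prim_nondecreasing.
move: al1 h0; lra.
Qed.

(** Inside the arc both ends of the widened arc are at distance at least [h], so the convolution is
    at least [G h - G (- h) = 2 G h]. *)
Lemma upper_fejer_ge1 x (k : int) : al <= x - k%:~R < al' -> 1 <= upper_fejer x.
Proof.
move=> /andP[x1 x2]; rewrite /upper_fejer.
have := fejer_diffDz x (al - h) (al' + h) k.
have -> : x - (al - h) = x - al + h by ring.
have -> : x - (al' + h) = x - al' - h by ring.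
move=> ->; set y := x - k%:~R in x1 x2 *.
have i1 : G h <= G (y - (al - h)) by apply: fejer_prim_nondecreasing; lra.
have i2 : G (y - (al' + h)) <= G (- h) by apply: fejer_prim_nondecreasing; lra.
rewrite fejer_primN in i2.
have := fejer_prim_tail h0 h8; move: (1 / (_ * _)) => T; lra.
Qed.

Lemma lower_fejer_le1 x : lower_fejer x <= 1.
Proof.
rewrite /lower_fejer.
have : G (x - al - h) <= G (x - al' + h + 1%:R).
  by apply: fejer_prim_nondecreasing; move: al2 h0; lra.
rewrite fejer_primDn; move: tau0; move: (1 / (_ * _)) => T; lra.
Qed.

(** After reduction by [k], the point lies in the gap [[al', al + 1)], at distance at least [h] from
    the narrowed arc and from its translate by 1. The convolution is then at most
    [G (1 - h) - G h = 1 - 2 G h]. *)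
Lemma lower_fejer_le0 x : (forall k : int, ~ (al <= x - k%:~R < al')) ->
  lower_fejer x <= 0.
Proof.
move=> H; pose k := Num.floor (x - al).
have k1 : k%:~R <= x - al by exact: floor_le.
have k2 : x - al < k%:~R + 1.
  by have := floorD1_gt (x - al); rewrite intrD.
have {}H := H k; rewrite /lower_fejer.
have := fejer_diffDz x (al + h) (al' - h) k.
have -> : x - (al + h) = x - al - h by ring.
have -> : x - (al' - h) = x - al' + h by ring.
move=> ->.
have x2 : al' <= x - k%:~R.
  by rewrite leNgt; apply/negP => x2; apply: H; rewrite x2 andbT; lra.
set y := x - k%:~R in x2 *.
have y1 : y < al + 1 by rewrite /y; lra.
have i1 : G (y - (al + h)) <= G (- h + 1%:R) by apply: fejer_prim_nondecreasing; lra.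
have i2 : G h <= G (y - (al' - h)) by apply: fejer_prim_nondecreasing; lra.
rewrite fejer_primDn fejer_primN in i1.
have := fejer_prim_tail h0 h8; move: (1 / (_ * _)) => T; lra.
Qed.

Lemma fejer_diff_expand (x p q : R) : G (x - p) - G (x - q) = q - p +
  \sum_(m < n) fejer_coef R n m * (sin (2 * pi * m.+1%:R * (x - p))
     - sin (2 * pi * m.+1%:R * (x - q))).
Proof.
rewrite /fejer_prim.
under [in RHS]eq_bigr do rewrite mulrBr.
by rewrite sumrB; ring.
Qed.

Lemma fejer_coef_norm (m : nat) : (m < n)%N -> `|fejer_coef R n m| <= 1.
Proof.
move=> mn; rewrite /fejer_coef.
have pi2 := pi_ge2 R.
have m1 : 1 <= m.+1%:R :> R by rewrite ler1n.
have r1 : m.+1%:R / n.+1%:R <= 1 :> R by rewrite ler_pdivrMr// mul1r ler_nat ltnW.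
have r0 : 0 <= m.+1%:R / n.+1%:R :> R by rewrite divr_ge0.
have p1 : 1 <= pi * m.+1%:R :> R by nra.
rewrite ger0_norm; last by rewrite divr_ge0 ?subr_ge0// mulr_ge0// ltW.
by move: (_ / _) (pi * _) r0 r1 p1 => r w r0 r1 p1; rewrite ler_pdivrMr; lra.
Qed.

End Sandwich.

(** * Digits *)

Section Digits.
Variables (R : realType) (b : nat) (k : nat -> nat).
Hypothesis hb : (2 <= b)%N.
Hypothesis hk1 : (1 <= k 1%N <= b - 1)%N.

Let b0 : 0 < b%:R :> R. Proof. by rewrite ltr0n; lia. Qed.
Let lnb : 0 < ln b%:R :> R. Proof. by rewrite ln_gt0// ltr1n. Qed.

Definition dsum (l : nat) : nat := \sum_(1 <= j < l.+1) k j * b ^ (l - j).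

Lemma dsumS l : dsum l.+1 = (b * dsum l + k l.+1)%N.
Proof.
rewrite /dsum big_nat_recr//= subnn expn0 muln1; congr (_ + _)%N.
rewrite big_distrr /= big_nat_cond [RHS]big_nat_cond; apply: eq_bigr => j.
by move=> /andP[/andP[_ jl] _]; rewrite subSn// expnS mulnCA.
Qed.

Lemma dsum1 : dsum 1 = k 1%N.
Proof. by rewrite /dsum big_nat1 subnn expn0 muln1. Qed.

Lemma dsum_bounds l : (1 <= l)%N ->
  (forall j : nat, (2 <= j <= l)%N -> (k j <= b - 1)%N) ->
  (b ^ l.-1 <= dsum l)%N /\ (dsum l < b ^ l)%N.
Proof.
elim: l => // -[_ _ _|l IH _ hk].
  by rewrite dsum1 expn0 expn1; lia.
have [|h1 h2] := IH isT; first by move=> j /andP[j1 j2]; apply: hk; lia.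
have hl : (k l.+2 <= b - 1)%N by apply: hk; lia.
rewrite dsumS [l.+2.-1]/= expnS [(b ^ l.+2)%N]expnS; split; last by nia.
by rewrite /= in h1; nia.
Qed.

Lemma floor_mul_divz (z : R) : (Num.floor (b%:R * z) %/ b%:Z)%Z = Num.floor z.
Proof.
set f := Num.floor (b%:R * z).
have /andP[f1 f2] := floor_itv (b%:R * z); rewrite -/f in f1 f2.
have bz : (0 < b%:Z) by lia.
have e1 := divz_eq f b%:Z.
have e2 : (f %% b%:Z)%Z >= 0 by apply: modz_ge0; lia.
have e3 : (f %% b%:Z)%Z < b%:Z by apply: ltz_pmod.
set q := (f %/ b%:Z)%Z in e1 *; set r := (f %% b%:Z)%Z in e1 e2 e3.
apply/esym/floor_def; apply/andP; split.
  rewrite -(ler_pM2l b0); apply: le_trans f1.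
  by rewrite pmulrn -intrM ler_int e1; lia.
rewrite -(ltr_pM2l b0); apply: lt_le_trans f2 _.
by rewrite [b%:R]pmulrn -intrM ler_int e1; lia.
Qed.

Definition dexp (x : R) : R := ln x / ln b%:R - (bexp b x)%:~R.

Lemma dexp_itv x : 0 <= dexp x < 1.
Proof.
rewrite /dexp /bexp; have /andP[h1 h2] := floor_itv (ln x / ln b%:R).
rewrite intrD in h2; rewrite subr_ge0 h1 ltrBlDl//.
Qed.

(** For [x > 0], the integer written with the first [j + 1] significant digits of [x]; [dexp x] is
    the fractional part of [log_b x]. *)
Definition dfloor (x : R) (j : nat) : int := Num.floor (b%:R `^ (dexp x + j%:R)).

Lemma dfloorS x j : (dfloor x j.+1 %/ b%:Z)%Z = dfloor x j.
Proof.
rewrite /dfloor -[RHS]floor_mul_divz.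
have -> // : b%:R `^ (dexp x + j.+1%:R) = b%:R * b%:R `^ (dexp x + j%:R).
have -> : dexp x + j.+1%:R = 1 + (dexp x + j%:R) by rewrite -natr1; ring.
rewrite [LHS]powRD; last by rewrite (gt_eqF b0) implybT.
by rewrite powRr1// ltW.
Qed.

Lemma bdigitE x j : 0 < x -> bdigit b j.+1 x = (dfloor x j %% b%:Z)%Z.
Proof.
move=> x0; rewrite /bdigit x0 /dfloor; congr ((Num.floor _ %% _)%Z).
rewrite -natr1 addrK.
have {1}-> : x = b%:R `^ (ln x / ln b%:R).
  by rewrite /powR (gt_eqF b0) divfK ?gt_eqF// lnK.
rewrite -powRD ?(gt_eqF b0) ?implybT//; congr (_ `^ _).
by rewrite /dexp; ring.
Qed.

Lemma dfloor0 x : (dfloor x 0 %% b%:Z)%Z = dfloor x 0.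
Proof.
have /andP[y0 y1] := dexp_itv x.
rewrite /dfloor addr0; set f := Num.floor _.
have /andP[f1 f2] := floor_itv (b%:R `^ dexp x); rewrite -/f in f1 f2.
have B1 : 1 <= b%:R :> R by rewrite ler1n; lia.
have p1 : 0 <= b%:R `^ dexp x by exact: powR_ge0.
have p2 : b%:R `^ dexp x < b%:R :> R.
  rewrite -[ltRHS]powRr1 ?ltW// /powR (gt_eqF b0) ltr_expR ltr_pM2r//.
have g1 : -1 < f by have := le_lt_trans p1 f2; rewrite ltr0z; lia.
have g2 : f < b%:Z.
  by have := le_lt_trans f1 p2; rewrite pmulrn ltr_int.
by rewrite modz_small//; lia.
Qed.

Lemma digits_dfloor x l : 0 < x -> (1 <= l)%N ->
  (forall j : nat, (2 <= j <= l)%N -> (k j <= b - 1)%N) ->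
  (forall j : nat, (1 <= j <= l)%N -> bdigit b j x = (k j)%:Z) <->
  dfloor x l.-1 = (dsum l)%:Z.
Proof.
move=> x0; elim: l => // -[_ _ _|l IH _ hk].
  rewrite /= dsum1 -dfloor0 -bdigitE//; split => [|H [//|[|//]] _]; last by [].
  by apply.
have {}IH := IH isT; rewrite /= in IH.
have [|H1 H2] := IH; first by move=> j /andP[j1 j2]; apply: hk; lia.
have hl : (k l.+2 <= b - 1)%N by apply: hk; lia.
have e1 := divz_eq (dfloor x l.+1) b%:Z; rewrite dfloorS -bdigitE// in e1.
have e2 : bdigit b l.+2 x >= 0 by rewrite bdigitE//; apply: modz_ge0; lia.
have e3 : bdigit b l.+2 x < b%:Z by rewrite bdigitE//; apply: ltz_pmod; lia.
rewrite /= dsumS; split => [H|H].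
  rewrite e1 H1 => [|j jl]; last by apply: H; lia.
  by rewrite H; lia.
(* Uniqueness of Euclidean division by [b]: both remainders lie between 0 and [b - 1]. *)
have [h1 h2] : dfloor x l = (dsum l.+1)%:Z /\ bdigit b l.+2 x = (k l.+2)%:Z.
  rewrite H PoszD PoszM in e1.
  set u := dfloor x l in e1 *; set v := bdigit b l.+2 x in e1 e2 e3 *.
  have : u = (dsum l.+1)%:Z.
    have [c|[c|c]] : u < (dsum l.+1)%:Z \/ u = (dsum l.+1)%:Z \/ (dsum l.+1)%:Z < u by lia.
    - by exfalso; nia.
    - by [].
    - by exfalso; nia.
  by move=> E; split => //; rewrite E in e1; lia.
move=> j jl; have [->//|jl2] := eqVneq j l.+2.
by apply: H2 => //; lia.
Qed.

Section Interval.
Variable l : nat.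
Hypotheses (hl : (1 <= l)%N)
  (hk : forall j : nat, (2 <= j <= l)%N -> (k j <= b - 1)%N).

(** With [S = dsum l] and [y] the fractional part of [log_b x], the digit block says
    [S <= b^(y + l - 1) < S + 1]; taking logarithms turns this into an interval for [y]. *)
Definition dlow : R := ln (dsum l)%:R / ln b%:R - l.-1%:R.
Definition dhigh : R := ln (dsum l).+1%:R / ln b%:R - l.-1%:R.

Let S0 : 0 < (dsum l)%:R :> R.
Proof.
have [h1 _] := dsum_bounds hl hk; rewrite ltr0n; apply: leq_trans h1.
by rewrite expn_gt0; lia.
Qed.

Lemma dlow_ge0 : 0 <= dlow.
Proof.
have [h1 _] := dsum_bounds hl hk.
rewrite /dlow subr_ge0 ler_pdivlMr// mulrC mulr_natr -lnXn// -natrX.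
by rewrite ler_ln ?posrE ?ler_nat ?ltr0n ?expn_gt0//; lia.
Qed.

Lemma dhigh_le1 : dhigh <= 1.
Proof.
have [_ h1] := dsum_bounds hl hk.
rewrite /dhigh lerBlDr -[1]/(1%:R) -natrD add1n prednK//.
rewrite ler_pdivrMr// mulrC mulr_natr -lnXn// -natrX.
by rewrite ler_ln ?posrE ?ler_nat ?ltr0n ?expn_gt0//; lia.
Qed.

Lemma dlow_le_dhigh : dlow <= dhigh.
Proof.
by rewrite /dlow /dhigh lerD2r ler_pM2r ?invr_gt0// ler_ln ?posrE ?S0 ?ltr0Sn ?ler_nat.
Qed.

Lemma dhighB : dhigh - dlow = ln (1 + (dsum l)%:R^-1) / ln b%:R.
Proof.
have -> : 1 + (dsum l)%:R^-1 = (dsum l).+1%:R / (dsum l)%:R :> R.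
  by rewrite -natr1 mulrDl mulfV ?gt_eqF// mul1r.
by rewrite ln_div ?posrE ?S0 ?ltr0Sn// /dhigh /dlow; ring.
Qed.

(** Since [0 <= dlow] and [dhigh <= 1], the integer [m] is forced to be the floor of [log_b x]. The
    existential form is the membership in an arc modulo 1 that the Fejer bounds use. *)
Lemma digitsP x :
  (forall j : nat, (1 <= j <= l)%N -> bdigit b j x = (k j)%:Z) <->
  0 < x /\ exists m : int, dlow <= ln x / ln b%:R - m%:~R < dhigh.
Proof.
have [x0|x0] := ltP 0 x; last first.
  split=> [H|[]//].
  (* For [x <= 0] all digits default to 0, which contradicts a first digit at least 1. *)
  have := H 1%N; rewrite leqnn hl => /(_ isT).
  by rewrite /bdigit ltNge x0 /=; case/andP: hk1 => + _ [E]; rewrite -E.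
have key : dfloor x l.-1 = (dsum l)%:Z <-> dlow <= dexp x < dhigh.
  rewrite /dlow /dhigh lerBlDr ltrBrDr ler_pdivrMr// ltr_pdivlMr//.
  rewrite -ler_expR -ltr_expR !lnK ?posrE ?S0 ?ltr0Sn//.
  have -> : expR ((dexp x + l.-1%:R) * ln b%:R) = b%:R `^ (dexp x + l.-1%:R).
    by rewrite /powR (gt_eqF b0).
  rewrite /dfloor; split => [H|].
    have := floor_itv (b%:R `^ (dexp x + l.-1%:R)); rewrite H.
    by rewrite intrD -!pmulrn natr1.
  move=> H; apply: floor_def; rewrite intrD -!pmulrn natr1; exact: H.
rewrite (digits_dfloor x0 hl hk) key; split => [H|[_ [m /andP[m1 m2]]]].
  by split=> //; exists (bexp b x).
suff -> : dexp x = ln x / ln b%:R - m%:~R by rewrite m1 m2.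
rewrite /dexp /bexp; congr (_ - _%:~R); apply: floor_def.
have := dlow_ge0; have := dhigh_le1 => d1 d0; rewrite intrD.
apply/andP; split; first by have := le_trans d0 m1; rewrite subr_ge0.
by have := lt_le_trans m2 d1; rewrite ltrBlDl.
Qed.

End Interval.

End Digits.

(** * Riemann sums for iterated integrals *)

Section LowerIntegral.
Local Open Scope ereal_scope.

(* [integral] is a supremum over simple functions, so monotonicity needs no
   measurability. *)
Lemma ge0_le_integral_nonmeasurable (d : measure_display) (T : measurableType d)
    (R : realType) (mu : {measure set T -> \bar R}) (D : set T) (f g : T -> \bar R) :
  (forall x, D x -> 0 <= f x) -> (forall x, D x -> f x <= g x) ->
  \int[mu]_(x in D) f x <= \int[mu]_(x in D) g x.
Proof.
move=> f0 fg.
have g0 x : D x -> 0 <= g x by move=> Dx; apply: le_trans (f0 x Dx) (fg x Dx).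
rewrite !ge0_integralE//; apply: ereal_sup_le => _ [h /= hf <-]; exists h => //= x.
apply: le_trans (hf x) _; rewrite /patch; case: ifPn => // xD.
by apply: fg; rewrite -in_setE.
Qed.

End LowerIntegral.

Section Cells.
Variables (R : realType) (K : nat).
Local Notation mu := (@lebesgue_measure R).
Local Notation h := (2 * pi / K.+1%:R : R).
Local Notation node i := (2 * pi * i%:R / K.+1%:R : R).

Let pi0 : 0 < (pi : R) := pi_gt0 R.

Lemma mesh_gt0 : 0 < h.
Proof. by rewrite divr_gt0// mulr_gt0. Qed.

Lemma nodeE (i : nat) : node i = h * i%:R.
Proof. by rewrite mulrAC. Qed.

Definition cell (i : nat) : set R := `[node i, node i.+1[%classic.

Lemma cell_mem (x : R) : 0 <= x < 2 * pi -> exists2 i : 'I_K.+1, cell i x &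
  forall j : 'I_K.+1, cell j x -> j = i.
Proof.
move=> /andP[x0 x2].
have m0 := mesh_gt0.
have xh0 : 0 <= x / h by rewrite divr_ge0// ltW.
have /andP[t1 t2] := truncn_itv xh0.
have iK : (Num.truncn (x / h) < K.+1)%N.
  rewrite -(ltr_nat R); apply: le_lt_trans t1 _.
  by rewrite ltr_pdivrMr// mulrC divfK ?pnatr_eq0.
exists (Ordinal iK) => [|j].
  rewrite /cell /= in_itv /= !nodeE; apply/andP; split.
    by rewrite mulrC -ler_pdivlMr.
  by rewrite mulrC -ltr_pdivrMr.
rewrite /cell /= in_itv /= !nodeE => /andP[j1 j2]; apply/val_inj => /=.
apply/esym/truncn_def; rewrite ler_pdivlMr// ltr_pdivrMr// ![_ * h]mulrC.
by rewrite j1 j2.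
Qed.

Lemma integral_step (c : 'I_K.+1 -> R) : (forall i, 0 <= c i) ->
  (\int[mu]_(x in `[0%R, (2 * pi)%R[%classic) (\sum_(i < K.+1) c i * \1_(cell i) x)%:E
    = (h * \sum_(i < K.+1) c i)%:E)%E.
Proof.
move=> c0.
have mc (i : 'I_K.+1) : measurable (cell i) by exact: measurable_itv.
under eq_integral do rewrite -sumEFin.
rewrite ge0_integral_sum//; last 2 first.
- by move=> i; apply/measurable_EFinP; apply: measurable_funM => //;
     apply: measurable_indic; exact: mc.
- by move=> i x _; rewrite lee_fin mulr_ge0// indicE.
rewrite mulr_sumr -sumEFin; apply: eq_bigr => i _.
under eq_integral do rewrite EFinM.
rewrite ge0_integralZl_EFin//; last first.
  by apply/measurable_EFinP; apply: measurable_indic; exact: mc.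
rewrite integral_indic//; last exact: mc.
rewrite setIidl; last first.
  move=> x; rewrite /cell /= !in_itv /= !nodeE => /andP[x1 x2].
  have m0 := mesh_gt0; apply/andP; split.
    by apply: le_trans x1; rewrite mulr_ge0// ltW.
  apply: lt_le_trans x2 _; apply: le_trans (_ : h * K.+1%:R <= _).
    by rewrite ler_pM2l// ler_nat.
  by rewrite divfK ?pnatr_eq0.
have E : lebesgue_measure (cell i) = h%:E.
  rewrite /cell lebesgue_measure_itv /= lte_fin !nodeE.
  rewrite ltr_pM2l ?mesh_gt0// ltr_nat leqnn -EFinD; congr (_%:E).
  by rewrite -natr1; ring.
transitivity ((c i)%:E * lebesgue_measure (cell i))%E => //.
by rewrite E -EFinM mulrC.
Qed.

Lemma integral_cells_le (F : R -> \bar R) (c : 'I_K.+1 -> R) :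
  (forall x, 0 <= x < 2 * pi -> (0 <= F x)%E) ->
  (forall (i : 'I_K.+1) x, cell i x -> (F x <= (c i)%:E)%E) ->
  (forall i, 0 <= c i) ->
  (\int[mu]_(x in `[0%R, (2 * pi)%R[%classic) F x
     <= (h * \sum_(i < K.+1) c i)%:E)%E.
Proof.
move=> F0 Fc c0; rewrite -integral_step//.
apply: ge0_le_integral_nonmeasurable => x /=; rewrite in_itv /=; first exact: F0.
move=> x2; have [i xi ui] := cell_mem x2.
rewrite (bigD1 i)//= big1 ?addr0 => [|j ji].
  by rewrite indicE mem_set// mulr1; exact: Fc.
rewrite indicE memNset ?mulr0// => /ui ij; by rewrite ij eqxx in ji.
Qed.

Lemma integral_cells_ge (F : R -> \bar R) (c : 'I_K.+1 -> R) :
  (forall (i : 'I_K.+1) x, cell i x -> ((c i)%:E <= F x)%E) ->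
  (forall i, 0 <= c i) ->
  ((h * \sum_(i < K.+1) c i)%:E <=
    \int[mu]_(x in `[0%R, (2 * pi)%R[%classic) F x)%E.
Proof.
move=> Fc c0; rewrite -integral_step//.
apply: ge0_le_integral_nonmeasurable => x /=; rewrite in_itv /=.
  by move=> _; rewrite lee_fin sumr_ge0// => i _; rewrite mulr_ge0// indicE.
move=> x2; have [i xi ui] := cell_mem x2.
rewrite (bigD1 i)//= big1 ?addr0 => [|j ji].
  by rewrite indicE mem_set// mulr1; exact: Fc.
rewrite indicE memNset ?mulr0// => /ui ij; by rewrite ij eqxx in ji.
Qed.

Fixpoint rsum (n : nat) (f : (nat -> R) -> R) : R :=
  match n with
  | 0 => f (fun _ => 0)
  | n'.+1 => \sum_(i < K.+1) rsum n' (fun g => f (consR (node i) g))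
  end.

Lemma rsum_ge0 n f : (forall th, 0 <= f th) -> 0 <= rsum n f.
Proof.
elim: n f => [|n IH] f f0 //=; apply: sumr_ge0 => i _; exact: IH.
Qed.

Lemma iint_ge0 n (f : (nat -> R) -> \bar R) : (forall th, (0 <= f th)%E) ->
  (0 <= iint n f)%E.
Proof.
elim: n f => [|n IH] f f0 //=; apply: integral_ge0 => x _; exact: IH.
Qed.

Lemma consR_close x x' (th th' : nat -> R) : cell x' x ->
  (forall j, 0 <= th j - th' j <= h) ->
  forall j, 0 <= consR x th j - consR (node x') th' j <= h.
Proof.
rewrite /cell /= in_itv /= => /andP[x1 x2] H [|j] //=.
rewrite subr_ge0 x1 /= lerBlDl; apply: le_trans (ltW x2) _.
by rewrite !nodeE -[x'.+1%:R]natr1 mulrDr mulr1.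
Qed.

(** Here [g] is evaluated at the lower corner of the cell containing the point. Closeness is asked
    of every coordinate; those of index [n] and beyond are 0 on both sides. *)
Lemma iint_le_rsum n (f : (nat -> R) -> \bar R) (g : (nat -> R) -> R) :
  (forall th, (0 <= f th)%E) -> (forall th, 0 <= g th) ->
  (forall th th', (forall j, 0 <= th j - th' j <= h) -> (f th <= (g th')%:E)%E) ->
  (iint n f <= (h ^+ n * rsum n g)%:E)%E.
Proof.
have m0 := mesh_gt0.
elim: n f g => [|n IH] f g f0 g0 fg /=.
  by rewrite expr0 mul1r; apply: fg => j; rewrite subrr lexx ltW.
rewrite exprS -mulrA mulr_sumr.
apply: integral_cells_le => [x _|i x xi|i].
- exact: iint_ge0.
- by apply: IH => // th th' H; apply: fg; exact: consR_close.
- by rewrite mulr_ge0 ?rsum_ge0// exprn_ge0// ltW.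
Qed.

Lemma iint_ge_rsum n (f : (nat -> R) -> \bar R) (g : (nat -> R) -> R) :
  (forall th, 0 <= g th) ->
  (forall th th', (forall j, 0 <= th j - th' j <= h) -> ((g th')%:E <= f th)%E) ->
  ((h ^+ n * rsum n g)%:E <= iint n f)%E.
Proof.
have m0 := mesh_gt0.
elim: n f g => [|n IH] f g g0 fg /=.
  by rewrite expr0 mul1r; apply: fg => j; rewrite subrr lexx ltW.
rewrite exprS -mulrA mulr_sumr.
apply: integral_cells_ge => [i x xi|i].
- by apply: IH => // th th' H; apply: fg; exact: consR_close.
- by rewrite mulr_ge0 ?rsum_ge0// exprn_ge0// ltW.
Qed.

End Cells.

Section RiemannSums.
Variable R : realType.

Definition fcons (n K : nat) (i : 'I_K) (g : {ffun 'I_n -> 'I_K}) :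
    {ffun 'I_n.+1 -> 'I_K} :=
  [ffun j => if unlift ord0 j is Some j' then g j' else i].

Lemma rsum_gsum (n K : nat) (f : ('I_n -> R) -> R) :
  rsum K n (fun th => f (fun j => th j)) = gsum K.+1 f.
Proof.
elim: n f => [|n IH] f.
  rewrite /rsum /gsum (big_pred1 [ffun=> ord0])/=.
    by congr f; apply/funext => -[].
  by move=> g; apply/esym/eqP/ffunP => -[].
rewrite /gsum (reindex (fun u : 'I_K.+1 * {ffun 'I_n -> 'I_K.+1} => fcons u.1 u.2)) /=;
  last first.
  exists (fun g => (g ord0, [ffun j => g (lift ord0 j)])) => /=.
    move=> [i g] _ /=; congr (_, _); first by rewrite ffunE unlift_none.
    by apply/ffunP => j; rewrite !ffunE liftK.
  move=> g _; apply/ffunP => j; rewrite !ffunE /=.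
  by case: unliftP => [j' ->|->]; rewrite ?ffunE.
rewrite -(pair_bigA _ (fun i g => f (grid_pt R (fcons i g)))) /=.
apply: eq_bigr => i _.
pose f' (th : 'I_n -> R) := f (fun j => if unlift ord0 j is Some j' then th j'
  else 2 * pi * i%:R / K.+1%:R).
transitivity (rsum K n (fun th => f' (fun j => th j))).
  congr (rsum K n _); apply/funext => th; rewrite /f'; congr f; apply/funext => j.
  by case: unliftP => [j' ->|->].
rewrite IH; apply: eq_bigr => g _; rewrite /f'; congr f; apply/funext => j.
by rewrite /grid_pt ffunE; case: unliftP.
Qed.

Definition ucont_conf (N : nat) (f : ('I_N -> R) -> R) : Prop :=
  forall e : R, 0 < e -> exists2 d : R, 0 < d & forall th th',
    (forall j, `|th j - th' j| <= d) -> `|f th - f th'| <= e.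

Definition iintR (N : nat) (f : ('I_N -> R) -> R) : R :=
  fine (iint N (fun th => (f (fun j => th j))%:E)).

Lemma iint_gsum (N : nat) (f : ('I_N -> R) -> R) :
  (forall th, 0 <= f th) -> ucont_conf f ->
  iint N (fun th => (f (fun j => th j))%:E) = (iintR f)%:E /\
  forall e : R, 0 < e -> exists K0 : nat, forall K, (K0 <= K)%N -> (0 < K)%N ->
    `|iintR f - (2 * pi / K%:R) ^+ N * gsum K f| <= e.
Proof.
move=> f0 uf.
have pi0 : 0 < (pi : R) := pi_gt0 R.
have H e : 0 < e -> exists K0 : nat, forall K, (K0 <= K)%N ->
    (((2 * pi / K.+1%:R) ^+ N * gsum K.+1 f - e)%:E <=
       iint N (fun th => (f (fun j => th j))%:E) /\
     iint N (fun th => (f (fun j => th j))%:E) <=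
      ((2 * pi / K.+1%:R) ^+ N * gsum K.+1 f + e)%:E)%E.
  move=> e0.
  have P0 : 0 < (2 * pi) ^+ N :> R by rewrite exprn_gt0// mulr_gt0.
  (* The torus has volume [(2 * pi) ^ N], by which a pointwise error is multiplied. *)
  pose e' := e / (2 * pi) ^+ N.
  have e'0 : 0 < e' by rewrite divr_gt0.
  have [d d0 hd] := uf _ e'0.
  exists (Num.truncn (2 * pi / d)) => K Kd.
  have hd' : 2 * pi / K.+1%:R <= d.
    rewrite ler_pdivrMr// [d * _]mulrC -ler_pdivrMr//; apply/ltW.
    rewrite -truncn_lt_nat; first by rewrite ltnS.
    by rewrite divr_ge0// ltW// mulr_gt0.
  have close th th' : (forall j : nat, 0 <= th j - th' j <= 2 * pi / K.+1%:R) ->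
      `|f (fun j => th j) - f (fun j => th' j)| <= e'.
    move=> H; apply: hd => j; have /andP[h1 h2] := H j.
    by rewrite ger0_norm//; apply: le_trans hd'.
  have m0 := mesh_gt0 R K.
  have KN : (2 * pi / K.+1%:R) ^+ N * (e' * K.+1%:R ^+ N) = e.
    rewrite mulrCA -exprMn divfK ?pnatr_eq0// /e' divfK// gt_eqF//.
  split.
    (* Comparison functions have to be nonnegative, hence the truncation at 0. *)
    pose g (th : 'I_N -> R) := Num.max 0 (f th - e').
    apply: (@le_trans _ _ ((2 * pi / K.+1%:R) ^+ N * gsum K.+1 g)%:E); last first.
      rewrite -rsum_gsum; apply: iint_ge_rsum => [th|th th' /close].
        by rewrite le_max lexx.
      by rewrite ler_distl => /andP[h1 h2]; rewrite lee_fin ge_max f0.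
    rewrite lee_fin -KN -mulrBr ler_pM2l ?exprn_gt0//.
    rewrite lerBlDr -(gsum_cst N) -gsumD; apply: ler_gsum => th.
    by rewrite -lerBlDr le_max lexx orbT.
  pose g (th : 'I_N -> R) := f th + e'.
  apply: (@le_trans _ _ ((2 * pi / K.+1%:R) ^+ N * gsum K.+1 g)%:E).
    rewrite -rsum_gsum; apply: iint_le_rsum => [th|th|th th' /close].
    - by rewrite lee_fin.
    - by rewrite addr_ge0// ltW.
    by rewrite ler_distl => /andP[h1 h2]; rewrite lee_fin.
  by rewrite lee_fin -KN -mulrDr ler_pM2l ?exprn_gt0// gsumD gsum_cst.
have fin : iint N (fun th => (f (fun j => th j))%:E) = (iintR f)%:E.
  rewrite /iintR fineK//; have [K0 /(_ K0 (leqnn _)) [h1 h2]] := H 1 ltr01.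
  rewrite fin_numE; apply/andP; split.
    by rewrite gt_eqF//; apply: lt_le_trans h1; exact: ltNyr.
  by rewrite lt_eqF//; apply: le_lt_trans h2 _; exact: ltry.
split=> // e /H[K0 HK]; exists K0.+1 => -[//|K] KK _.
have [h1 h2] := HK K KK; rewrite fin !lee_fin in h1 h2.
by rewrite ler_distl h1 h2.
Qed.

Lemma iintR_ge0 (N : nat) (f : ('I_N -> R) -> R) : (forall th, 0 <= f th) ->
  0 <= iintR f.
Proof. by move=> f0; rewrite fine_ge0// iint_ge0// => th; rewrite lee_fin. Qed.

End RiemannSums.

(** * The weight of the circular ensemble *)

Section PowerProducts.
Variable R : realType.

Lemma cpowM (a t x y : R) : adm a t -> 0 <= x -> 0 <= y ->
  cpow a t (x * y) = cpow a t x * cpow a t y.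
Proof.
move=> [a0|[-> ->]] x0 y0; last by rewrite !cpow00 mulr1.
have c0 : cpow a t 0 = 0 by rewrite /cpow powR0 ?gt_eqF// mul0r.
have [->|xn0] := eqVneq x 0; first by rewrite mul0r c0 mul0r.
have [->|yn0] := eqVneq y 0; first by rewrite mulr0 c0 mulr0.
have x1 : 0 < x by rewrite lt_neqAle eq_sym xn0.
have y1 : 0 < y by rewrite lt_neqAle eq_sym yn0.
rewrite /cpow powRM// lnM ?posrE// mulrDr expiD (rmorphM (real_complex R)) /=.
by ring.
Qed.

Lemma cpow_1 (a t : R) : cpow a t 1 = 1.
Proof. by rewrite /cpow powR1 ln1 mulr0 expi0 mulr1. Qed.

Lemma cpow_prod (a t : R) (I : Type) (r : seq I) (F : I -> R) : adm a t ->
  (forall i, 0 <= F i) ->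
  \prod_(i <- r) cpow a t (F i) = cpow a t (\prod_(i <- r) F i).
Proof.
move=> ad F0; elim: r => [|i r IH]; first by rewrite !big_nil cpow_1.
by rewrite !big_cons IH cpowM// prodr_ge0.
Qed.

End PowerProducts.

Section BoundedUcont.
Variables (R : realType) (N : nat).
Local Notation conf := ('I_N -> R).

Definition bucont (f : conf -> R) : Prop :=
  (exists B, forall th, `|f th| <= B) /\ ucont_conf f.

Lemma eq_bucont (f g : conf -> R) : f =1 g -> bucont f -> bucont g.
Proof. by move=> /funext->. Qed.

Lemma bucont_cst (c : R) : bucont (fun=> c).
Proof.
split; first by exists `|c|.
by move=> e e0; exists 1 => // th th' _; rewrite subrr normr0 ltW.
Qed.

Lemma bucontM (f g : conf -> R) : bucont f -> bucont g ->
  bucont (fun th => f th * g th).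
Proof.
move=> [[B fB] uf] [[C gC] ug].
have B0 : 0 <= B by apply: le_trans (fB (fun=> 0)).
have C0 : 0 <= C by apply: le_trans (gC (fun=> 0)).
split; first by exists (B * C) => th; rewrite normrM ler_pM.
move=> e e0.
have e1 : 0 < e / 2 / (C + 1) by rewrite !divr_gt0// ltr_wpDl.
have e2 : 0 < e / 2 / (B + 1) by rewrite !divr_gt0// ltr_wpDl.
have [d1 d10 h1] := uf _ e1; have [d2 d20 h2] := ug _ e2.
exists (Num.min d1 d2); first by rewrite lt_min d10.
move=> x y xy.
have {}h1 : `|f x - f y| <= e / 2 / (C + 1).
  by apply: h1 => j; apply: le_trans (xy j) _; rewrite ge_min lexx.
have {}h2 : `|g x - g y| <= e / 2 / (B + 1).
  by apply: h2 => j; apply: le_trans (xy j) _; rewrite ge_min lexx orbT.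
have -> : f x * g x - f y * g y = (f x - f y) * g x + f y * (g x - g y) by ring.
apply: le_trans (ler_normD _ _) _; rewrite [e]splitr !normrM; apply: lerD.
  apply: le_trans (_ : e / 2 / (C + 1) * (C + 1) <= _).
    by apply: ler_pM => //; apply: le_trans (gC _) _; rewrite lerDl.
  by rewrite divfK// gt_eqF// ltr_wpDl.
apply: le_trans (_ : (B + 1) * (e / 2 / (B + 1)) <= _).
  by apply: ler_pM => //; apply: le_trans (fB _) _; rewrite lerDl.
by rewrite mulrC divfK// gt_eqF// ltr_wpDl.
Qed.

Lemma bucont_prod (I : Type) (r : seq I) (P : pred I) (F : I -> conf -> R) :
  (forall i, P i -> bucont (F i)) -> bucont (fun th => \prod_(i <- r | P i) F i th).
Proof.
move=> H; elim: r => [|i r IH].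
  by apply: eq_bucont (bucont_cst 1) => th; rewrite big_nil.
have [Pi|Pi] := boolP (P i); last first.
  by apply: eq_bucont IH => th; rewrite big_cons (negbTE Pi).
by apply: eq_bucont (bucontM (H i Pi) IH) => th; rewrite big_cons Pi.
Qed.

Lemma bucont_comp (phi : R -> R) (f : conf -> R) : continuous phi -> bucont f ->
  bucont (fun th => phi (f th)).
Proof.
move=> cphi [[B fB] uf]; split.
  have [M [_ hM]] := compact_bounded (continuous_compact
    (continuous_subspaceT cphi) (@segment_compact R (- B) B)).
  exists (M + 1) => x; apply: hM; first by rewrite ltrDl.
  by exists (f x) => //=; rewrite in_itv/= -ler_norml.
move=> e e0; have [d d0 h] := heine_cantor B cphi e0.
have d2 : 0 < d / 2 by rewrite divr_gt0.
have [d' d'0 h'] := uf _ d2; exists d' => // x y /h' xy.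
apply: h => //; apply: le_lt_trans xy _.
by rewrite ltr_pdivrMr// ltr_pMr// ltr1n.
Qed.

Lemma bucont_chord2 (u : conf -> R) :
  (forall d th th', (forall j, `|th j - th' j| <= d) -> `|u th - u th'| <= 2 * d) ->
  bucont (fun th => chord2 (u th)).
Proof.
move=> hu; split.
  by exists 4 => th; rewrite ger0_norm ?chord2_ge0 ?chord2_le4.
move=> e e0; exists (e / 4); first by rewrite divr_gt0.
move=> th th' /hu h; apply: le_trans (chord2_lipschitz _ _) _; lra.
Qed.

End BoundedUcont.

Section Weights.
Variables (R : realType) (N : nat) (theta lam : R).
Hypothesis lam0 : 0 < lam.
Local Notation conf := ('I_N -> R).
Local Notation wabs := (@wabs R N theta lam).
Local Notation wreg := (@wreg R N theta lam).

(* The square of [|D|]. *)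
Definition dabs2 (th : conf) : R := \prod_j chord2 (th j - theta).

Lemma dabs2_ge0 th : 0 <= dabs2 th.
Proof. by apply: prodr_ge0 => j _; exact: chord2_ge0. Qed.

Lemma dabs2_le th : dabs2 th <= 4 ^+ N.
Proof.
rewrite /dabs2 -[in leRHS](card_ord N) -prodr_const; apply: ler_prod => j _.
by rewrite chord2_ge0 chord2_le4.
Qed.

Lemma wabs_ge0 a th : 0 <= wabs a th.
Proof. exact: cmod_ge0. Qed.

Lemma wabs0E th : wabs 0 th =
  \prod_j \prod_(k | k != j) (chord2 (th j - th k)) `^ (lam / 2).
Proof.
rewrite /wabs /wreg cmodM !cmod_prod big1 ?mul1r.
  apply: eq_bigr => j _; rewrite cmod_prod; apply: eq_bigr => k _.
  by rewrite /pairf cmod_cpow addr0.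
by move=> j _; rewrite /onef cmod_cpow powRr0.
Qed.

(** Separates the function of [|D|^2] from the weight of the ensemble. Admissibility makes complex
    powers multiplicative even when some factor of [dabs2] vanishes. *)
Lemma wregE a t th : adm a t -> wreg a t 0 th = cpow a t (dabs2 th) * (wabs 0 th)%:C%C.
Proof.
move=> ad; rewrite -wreg_real /wreg [in RHS]big1 ?mul1r; last first.
  by move=> j _; rewrite /onef cpow00.
congr (_ * _); rewrite /dabs2 -cpow_prod//.
  by apply: eq_bigr => j _; rewrite /onef addr0.
by move=> j; exact: chord2_ge0.
Qed.

Lemma wabsE a th : 0 <= a -> wabs a th = dabs2 th `^ a * wabs 0 th.
Proof.
rewrite le_eqVlt => /orP[/eqP <-|a0]; first by rewrite powRr0 mul1r.
rewrite {1}/wabs wregE; last by left.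
by rewrite cmodM cmod_cpow cmod_real ger0_norm// wabs_ge0.
Qed.

Lemma bucont_dabs2 : bucont dabs2.
Proof.
apply: bucont_prod => j _; apply: bucont_chord2 => d th th' h.
have -> : th j - theta - (th' j - theta) = th j - th' j by ring.
apply: le_trans (h j) _; have := le_trans (normr_ge0 _) (h j); lra.
Qed.

Lemma continuous_abs_powR (a : R) : 0 < a -> continuous (fun x : R => `|x| `^ a).
Proof.
move=> a0.
have := @continuous_powR_mul R a (fun=> 1) 1 a0 _ _.
have -> : (fun x : R => `|x| `^ a * 1) = (fun x : R => `|x| `^ a).
  by apply/funext => x; rewrite mulr1.
apply; first by move=> x; rewrite normr1.
by move=> x _; exact: cst_continuous.
Qed.

Lemma bucont_wabs0 : bucont (wabs 0).
Proof.
have H j k : bucont (fun th : conf => (chord2 (th j - th k)) `^ (lam / 2)).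
  have l2 : 0 < lam / 2 by rewrite divr_gt0.
  have B : bucont (fun th : conf => chord2 (th j - th k)).
    apply: bucont_chord2 => d th th' h.
    have -> : th j - th k - (th' j - th' k) = (th j - th' j) - (th k - th' k) by ring.
    by apply: le_trans (ler_normB _ _) _; have := h j; have := h k; lra.
  apply: eq_bucont (bucont_comp (continuous_abs_powR l2) B) => th.
  by rewrite ger0_norm ?chord2_ge0.
apply: eq_bucont (bucont_prod _ (fun j _ => bucont_prod _ (fun k _ => H j k))).
by move=> th; rewrite wabs0E.
Qed.

Lemma bucont_weighted (phi : R -> R) : continuous phi ->
  bucont (fun th => phi (dabs2 th) * wabs 0 th).
Proof.
by move=> cphi; apply: bucontM bucont_wabs0; exact: bucont_comp bucont_dabs2.
Qed.

Lemma bucont_wabs a : 0 <= a -> bucont (wabs a).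
Proof.
rewrite le_eqVlt => /orP[/eqP <-|a0]; first exact: bucont_wabs0.
apply: eq_bucont (bucont_weighted (continuous_abs_powR a0)) => th.
by rewrite [RHS]wabsE ?ltW// ger0_norm ?dabs2_ge0.
Qed.

Lemma pair_prod_half (F : 'I_N -> 'I_N -> R) : (forall j k, F j k = F k j) ->
  \prod_(j < N) \prod_(k | k != j) F j k = \prod_(j < N) \prod_(k < N | (k < j)%N) F k j ^+ 2.
Proof.
move=> Fs.
have -> : \prod_(j < N) \prod_(k | k != j) F j k =
  (\prod_(j < N) \prod_(k < N | (k < j)%N) F j k) * \prod_(j < N) \prod_(k < N | (j < k)%N) F j k.
  rewrite -big_split; apply: eq_bigr => j _ /=.
  rewrite (bigID (fun k : 'I_N => (k < j)%N)) /=; congr (_ * _); apply: eq_bigl => k.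
    by rewrite andb_idl// => kj; rewrite -val_eqE ltn_eqF.
  by rewrite -leqNgt -val_eqE /= eq_sym -ltn_neqAle.
have -> : \prod_(j < N) \prod_(k < N | (j < k)%N) F j k =
    \prod_(j < N) \prod_(k < N | (k < j)%N) F k j.
  rewrite (exchange_big_dep xpredT)//=.
rewrite -big_split; apply: eq_bigr => j _; rewrite -big_split; apply: eq_bigr => k _ /=.
by rewrite Fs expr2.
Qed.

(** Each unordered pair appears twice with exponent [lam / 2] on the squared distance, hence with
    total exponent [2 * lam] on the distance. *)
Lemma cbe_weightE (th : nat -> R) :
  cbe_weight N (2 * lam) th = wabs 0 (fun j => th j).
Proof.
rewrite wabs0E (pair_prod_half (F := fun j k => chord2 (th j - th k) `^ (lam / 2))); last first.
  by move=> j k; rewrite -chord2N opprB.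
rewrite /cbe_weight; apply: eq_bigr => j _.
rewrite (big_ord_widen N (fun k => cmod (expi (th k) - expi (th j)) `^ (2 * lam)) (ltnW (ltn_ord j))).
apply: eq_bigr => k _.
rewrite -powR_mulrn ?powR_ge0// -powRrM /chord2 -cmod_sub_expi.
rewrite -powR_mulrn ?cmod_ge0// -powRrM; congr (_ `^ _); by field.
Qed.

Lemma cmod_charpoly (th : nat -> R) :
  cmod (charpoly N th theta) = Num.sqrt (dabs2 (fun j => th j)).
Proof.
have -> : dabs2 (fun j => th j) = cmod (charpoly N th theta) ^+ 2.
  rewrite /charpoly cmod_prod -prodrXl; apply: eq_bigr => j _.
  by rewrite cmod_sub_expi -chord2N opprB.
by rewrite sqrtr_sqr ger0_norm// cmod_ge0.
Qed.

End Weights.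

Section Limits.
Variables (R : realType) (N : nat).
Local Notation conf := ('I_N -> R).
Let pi0 : 0 < (pi : R) := pi_gt0 R.

Definition lsum (K : nat) (f : conf -> R) : R := (2 * pi / K%:R) ^+ N * gsum K f.

Lemma cvg_lsum (f : conf -> R) : (forall th, 0 <= f th) -> bucont f ->
  lsum K f @[K --> \oo] --> iintR f.
Proof.
move=> f0 [_ uf]; have [_ H] := iint_gsum f0 uf.
apply/cvgrPdist_le => e e0; have [K0 h] := H _ e0.
exists (maxn K0 1) => // K /=; rewrite geq_max => /andP[K1 K2]; exact: h.
Qed.

Lemma lsumD K (f g : conf -> R) :
  lsum K (fun th => f th + g th) = lsum K f + lsum K g.
Proof. by rewrite /lsum gsumD mulrDr. Qed.

Lemma lsumZ K (c : R) (f : conf -> R) : lsum K (fun th => c * f th) = c * lsum K f.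
Proof. by rewrite /lsum gsumZ mulrCA. Qed.

Lemma ler_lsum K (f g : conf -> R) : (forall th, f th <= g th) ->
  lsum K f <= lsum K g.
Proof.
move=> fg; rewrite /lsum ler_wpM2l ?ler_gsum// exprn_ge0// divr_ge0//.
by rewrite mulr_ge0// ltW.
Qed.

Lemma lsum_gsum_le K (x y e : R) : (0 < K)%N -> x <= y + e * K%:R ^+ N ->
  (2 * pi / K%:R) ^+ N * x <= (2 * pi / K%:R) ^+ N * y + e * (2 * pi) ^+ N.
Proof.
move=> K0 xy.
have Kr : K%:R != 0 :> R by rewrite pnatr_eq0 -lt0n.
have P0 : 0 <= (2 * pi / K%:R) ^+ N :> R.
  by rewrite exprn_ge0// divr_ge0// mulr_ge0// ltW.
apply: le_trans (ler_wpM2l P0 xy) _.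
by rewrite mulrDr mulrCA -exprMn divfK.
Qed.

End Limits.

(** * Moments as integrals, and the cost of the tilt *)

Section Moments.
Variables (R : realType) (N : nat) (theta lam : R).
Hypothesis lam0 : 0 < lam.
Local Notation conf := ('I_N -> R).
Local Notation wabs := (@wabs R N theta lam).
Local Notation wreg := (@wreg R N theta lam).
Local Notation dabs2 := (@dabs2 R N theta).
Let pi0 : 0 < (pi : R) := pi_gt0 R.

Definition mom (a : R) : R := iintR (wabs a).

Definition rfprod (c : R) : R := \prod_(j < N) (c + lam * j%:R).

Lemma cvg_mom a : 0 <= a -> lsum K (wabs a) @[K --> \oo] --> mom a.
Proof.
by move=> a0; apply: cvg_lsum; [exact: wabs_ge0|exact: bucont_wabs].
Qed.

(** At [t = 0] the normalized grid sums converge to the moments and the negligible term tends to 0,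
    so the recursion becomes an exact identity. *)
Lemma mom_recursion a : 0 <= a ->
  rfprod (1 + a) ^+ 2 * mom (a + 1) = rfprod (1 + 2 * a) * rfprod (2 + 2 * a) * mom a.
Proof.
move=> a0.
have ad : adm a 0.
  by move: a0; rewrite le_eqVlt => /orP[/eqP <-|]; [right|left].
set A := rfprod (1 + a) ^+ 2; set B := rfprod _ * rfprod _.
have cA : A * lsum K (wabs (a + 1)) @[K --> \oo] --> A * mom (a + 1).
  by apply: cvgM; [exact: cvg_cst|apply: cvg_mom; rewrite addr_ge0].
have cB : B * lsum K (wabs a) @[K --> \oo] --> B * mom a.
  by apply: cvgM; [exact: cvg_cst|exact: cvg_mom].
apply/eqP; rewrite -subr_eq0; apply/eqP.
apply: (cvg_unique _ (cvgB cA cB)) => //.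
apply/cvgrPdist_le => e e0.
have e' : 0 < e / (2 * pi) ^+ N by rewrite divr_gt0// exprn_gt0// mulr_gt0.
have [K0 h] := moment_step N theta lam0 ad e'.
exists (maxn K0 1) => // K /=; rewrite geq_max => /andP[/h {}h K1].
rewrite sub0r normrN /=.
have E : gsum K (fun th => fprod N lam (1 + (a +i* 0)%C) ^+ 2 * wreg (a + 1) 0 0 th -
   fprod N lam (1 + 2 * (a +i* 0)%C) * fprod N lam (2 + 2 * (a +i* 0)%C) * wreg a 0 0 th)
  = (A * gsum K (wabs (a + 1)) - B * gsum K (wabs a))%:C%C.
  rewrite -!gsumZ -mulN1r -gsumZ -gsumD -(@gsum_morph _ _ _ _ K (real_complex R)).
  - apply: eq_gsum => th; rewrite !wreg_real.
    have -> : 1 + (a +i* 0)%C = (1 + a)%:C%C :> R[i].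
      by apply/eqP; rewrite eq_complex /=; apply/andP; split; apply/eqP; ring.
    have -> : 1 + 2 * (a +i* 0)%C = (1 + 2 * a)%:C%C :> R[i].
      by apply/eqP; rewrite eq_complex /=; apply/andP; split; apply/eqP; ring.
    have -> : 2 + 2 * (a +i* 0)%C = (2 + 2 * a)%:C%C :> R[i].
      by apply/eqP; rewrite eq_complex /=; apply/andP; split; apply/eqP; ring.
    rewrite !fprod_real -!(rmorphXn, rmorphM, rmorphB) /=.
    congr (_%:C%C); rewrite /A /B /rfprod; ring.
  - exact: rmorphD.
  - exact: rmorph0.
rewrite E cmod_real in h; rewrite fctE.
have Kr : K%:R != 0 :> R by rewrite pnatr_eq0 -lt0n.
have P0 : 0 <= (2 * pi / K%:R) ^+ N :> R.
  by rewrite exprn_ge0// divr_ge0// mulr_ge0// ltW.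
have -> : A * lsum K (wabs (a + 1)) - B * lsum K (wabs a) =
   (2 * pi / K%:R) ^+ N * (A * gsum K (wabs (a + 1)) - B * gsum K (wabs a)).
  by rewrite /lsum; ring.
rewrite normrM (ger0_norm P0); apply: le_trans (ler_wpM2l P0 h) _.
by rewrite mulrCA -exprMn !divfK// gt_eqF// exprn_gt0// mulr_gt0.
Qed.

Lemma rfprod_gt0 c : 0 < c -> 0 < rfprod c.
Proof. by move=> c0; exact: fprod_gt0. Qed.

Lemma rfprod_le c c' : 0 <= c -> c <= c' -> rfprod c <= rfprod c'.
Proof.
move=> c0 cc; apply: ler_prod => j _.
by rewrite lerD2r cc andbT addr_ge0// mulr_ge0// ltW.
Qed.

Lemma rfprod_scale c e : 1 <= c -> 0 <= e ->
  rfprod (c + e) <= (1 + e) ^+ N * rfprod c.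
Proof.
move=> c1 e0.
rewrite /rfprod -[X in _ ^+ X](card_ord N) -prodr_const -big_split /=.
apply: ler_prod => j _.
have lj : 0 <= lam * j%:R by rewrite mulr_ge0// ltW.
by apply/andP; split; nra.
Qed.

(* Since [x^(1+a) >= x - a], the moment of order [1 + a] is nearly that of order [1];
   the recursion transfers this to the orders [a] and [0]. *)
Lemma mom_lower a : 0 <= a -> a <= 1 ->
  (1 - a) * mom 0 <= (1 + 2 * a) ^+ N * (1 + 2 * a) ^+ N * mom a.
Proof.
move=> a0 a1.
have m0 : 0 <= mom 0 by apply: iintR_ge0 => th; exact: wabs_ge0.
have ma : 0 <= mom a by apply: iintR_ge0 => th; exact: wabs_ge0.
have i1 : mom 1 <= mom (a + 1) + a * mom 0.
  have c1 := cvg_mom ler01.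
  have c2 : lsum K (wabs (a + 1)) + a * lsum K (wabs 0) @[K --> \oo] -->
      mom (a + 1) + a * mom 0.
    apply: cvgD; first by apply: cvg_mom; rewrite addr_ge0.
    by apply: cvgM; [exact: cvg_cst|exact: cvg_mom].
  apply: (ler_cvg_to c1 c2); apply: nearW => K; rewrite -lsumZ -lsumD.
  apply: ler_lsum => th.
  rewrite [wabs 1 _]wabsE// [wabs (a + 1) _]wabsE ?addr_ge0// -mulrDl.
  rewrite ler_wpM2r ?wabs_ge0//; set x := dabs2 th.
  have x0 : 0 <= x by exact: dabs2_ge0.
  rewrite powRr1//.
  have [->|xn0] := eqVneq x 0; first by rewrite addr_ge0// powR_ge0.
  have x1 : 0 < x by rewrite lt_neqAle eq_sym xn0.
  rewrite powRD ?xn0 ?implybT// powRr1//.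
  have h1 : 1 + a * ln x <= x `^ a.
    by rewrite /powR (negbTE xn0); exact: expR_ge1Dx.
  (* Apply [ln u <= u - 1] at [u = 1 / x]. Together with [h1] this gives [x^(1 + a) >= x (1 + a ln
     x) >= x + a (x - 1) >= x - a]. *)
  have h2 : x - 1 <= x * ln x.
    have : ln x^-1 <= x^-1 - 1.
      have := @le_ln1Dx R (x^-1 - 1).
      have -> : 1 + (x^-1 - 1) = x^-1 by ring.
      apply.
      by rewrite ltrBrDr addNr invr_gt0.
    rewrite lnV ?posrE// => h3.
    have : x * - ln x <= x * (x^-1 - 1) by rewrite ler_pM2l.
    rewrite mulrBr mulfV//; lra.
  have h3 : x * (1 + a * ln x) <= x * x `^ a by rewrite ler_pM2l.
  have h4 : a * (x - 1) <= a * (x * ln x) by rewrite ler_wpM2l.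
  nra.
have e0 := mom_recursion (lexx 0); have ea := mom_recursion a0.
rewrite !mulr0 !addr0 add0r in e0.
have A0 : 0 < rfprod 1 by exact: rfprod_gt0.
have A2 : 0 < rfprod 2 by exact: rfprod_gt0.
have Aa : rfprod 1 <= rfprod (1 + a) by apply: rfprod_le; lra.
have A12 : rfprod 1 <= rfprod 2 by apply: rfprod_le; lra.
have Ba1 : rfprod (1 + 2 * a) <= (1 + 2 * a) ^+ N * rfprod 1.
  by apply: rfprod_scale; lra.
have Ba2 : rfprod (2 + 2 * a) <= (1 + 2 * a) ^+ N * rfprod 2.
  by apply: rfprod_scale; lra.
have Ap : 0 < rfprod (1 + a) by apply: rfprod_gt0; lra.
set c := (1 + 2 * a) ^+ N in Ba1 Ba2 *.
have c0 : 0 <= c by rewrite exprn_ge0//; lra.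
have j1 : rfprod 1 ^+ 2 * mom (a + 1) <= c * c * (rfprod 1 * rfprod 2) * mom a.
  apply: le_trans (_ : rfprod (1 + a) ^+ 2 * mom (a + 1) <= _).
    rewrite ler_wpM2r//; first by apply: iintR_ge0 => th; exact: wabs_ge0.
    by rewrite ler_sqr ?nnegrE ?(ltW A0) ?(ltW Ap).
  rewrite ea ler_wpM2r//.
  have -> : c * c * (rfprod 1 * rfprod 2) = (c * rfprod 1) * (c * rfprod 2) by ring.
  by apply: ler_pM => //; apply/ltW/rfprod_gt0; lra.
have j2 : rfprod 1 * rfprod 2 * mom 0 <=
    c * c * (rfprod 1 * rfprod 2) * mom a + rfprod 1 * rfprod 2 * (a * mom 0).
  rewrite -e0; apply: le_trans (_ : rfprod 1 ^+ 2 * (mom (a + 1) + a * mom 0) <= _).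
    by rewrite ler_wpM2l// sqr_ge0.
  rewrite mulrDr; apply: lerD => //; rewrite ler_wpM2r ?mulr_ge0//.
  by rewrite expr2 ler_wpM2l// ltW.
have q0 : 0 < rfprod 1 * rfprod 2 by rewrite mulr_gt0.
rewrite -(ler_pM2l q0); move: j2; move: (rfprod 1 * rfprod 2) => q j2.
lra.
Qed.

End Moments.

(** * Decay of the Fourier modes of the logarithm of [|D|] under the tilted weight *)

Section Oscillation.
Variables (R : realType) (N : nat) (theta lam a : R).
Hypotheses (lam0 : 0 < lam) (N0 : (0 < N)%N) (a0 : 0 < a) (a1 : 2 * a <= 1).
Local Notation conf := ('I_N -> R).
Local Notation wabs := (@wabs R N theta lam).
Local Notation wreg := (@wreg R N theta lam).
Local Notation dabs2 := (@dabs2 R N theta).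
Let pi0 : 0 < (pi : R) := pi_gt0 R.

(** Grid form of a bound of the integral of [f] by [c] times the moment of order [a]. *)
Definition osc (f : conf -> R) (c : R) : Prop := forall e : R, 0 < e ->
  exists K0 : nat, forall K, (K0 <= K)%N ->
    `|gsum K f| <= c * gsum K (wabs a) + e * K%:R ^+ N.

Lemma oscD f g c c' : osc f c -> osc g c' -> osc (fun th => f th + g th) (c + c').
Proof.
move=> hf hg e e0; have e2 : 0 < e / 2 by rewrite divr_gt0.
have [K1 h1] := hf _ e2; have [K2 h2] := hg _ e2.
exists (maxn K1 K2) => K; rewrite geq_max => /andP[/h1 {}h1 /h2 {}h2].
rewrite gsumD; apply: le_trans (ler_normD _ _) _.
apply: le_trans (lerD h1 h2) _; rewrite [in leRHS](splitr e) !mulrDl.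
by rewrite le_eqVlt; apply/orP; left; apply/eqP; ring.
Qed.

Lemma oscZ k f c : `|k| <= 1 -> osc f c -> osc (fun th => k * f th) c.
Proof.
move=> k1 hf e /hf[K0 h]; exists K0 => K /h; apply: le_trans.
by rewrite gsumZ normrM ler_piMl.
Qed.

Lemma osc_sum n (F : 'I_n -> conf -> R) c : (forall i, osc (F i) c) ->
  osc (fun th => \sum_(i < n) F i th) (n%:R * c).
Proof.
elim: n F => [|n IH] F hF.
  move=> e e0; exists 0%N => K _; rewrite !mul0r add0r (_ : gsum K _ = 0).
    by rewrite normr0 mulr_ge0// ltW.
  by rewrite /gsum big1// => g _; rewrite big_ord0.
have := oscD (IH _ (fun i => hF (widen_ord (leqnSn n) i))) (hF ord_max).
have -> : n%:R * c + c = n.+1%:R * c by rewrite -natr1 mulrDl mul1r.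
move=> H e /H[K0 h]; exists K0 => K /h; apply: le_trans.
by rewrite le_eqVlt; apply/orP; left; apply/eqP; congr `|_|; apply: eq_gsum => th;
   rewrite big_ord_recr.
Qed.

(** The sum is the imaginary part of the complex moment at [a + i t], rotated by [- ph]. The number
    [n] of recursion steps is taken just large enough for [moment_ratio_decay]. *)
Lemma osc_sin (t0 t ph : R) : 0 < t0 -> t0 <= `|t| ->
  osc (fun th => wabs a th * sin (t * ln (dabs2 th) - ph))
      (expR (- (decay_rate lam t0 / 2 * ln N%:R))).
Proof.
move=> t00 tt0 e e0.
have ad : adm a t by left.
pose n := (Num.truncn (lam * N%:R / 2 + 1)).+1.
have nN : lam * N%:R / 2 + 1 <= n%:R by apply/ltW; exact: truncnS_gt.
have [K0 h] := oscillating_moment_bound N theta lam0 n ad e0.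
exists K0 => K /h {}h.
have E : gsum K (fun th => wabs a th * sin (t * ln (dabs2 th) - ph)) =
    Im (expi (- ph) * gsum K (wreg a t 0)).
  rewrite -gsumZ -(@gsum_morph _ _ _ _ K (@complex.Im R))//.
    apply: eq_gsum => th; rewrite wregE// wabsE ?(ltW a0)// sinB /= sinN cosN.
    by ring.
  by move=> [? ?] [? ?].
rewrite E; apply: le_trans (Im_le_cmod _) _; rewrite cmodM cmod_expi mul1r.
apply: le_trans h _; rewrite lerD2r ler_wpM2r//.
  by apply: sumr_ge0 => g _; exact: wabs_ge0.
exact: moment_ratio_decay (ltW a0) a1 N0 nN.
Qed.

Variable b : nat.
Hypothesis hb : (2 <= b)%N.
Let lnb : 0 < ln b%:R :> R. Proof. by rewrite ln_gt0// ltr1n. Qed.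

(** Base-[b] logarithm of the square root of [x], because [x] will be [|D|^2]. *)
Definition phase (x : R) : R := ln x / 2 / ln b%:R.

(** Once the mean [q - p] is removed, [n] modes remain, each a difference of two sines with
    coefficient at most 1. Mode [m] has frequency [pi (m + 1) / ln b], so all share the lower bound
    [pi / ln b] and therefore one rate, free of [a]. *)
Lemma osc_fejer (n : nat) (p q : R) :
  osc (fun th => wabs a th * (fejer_prim n (phase (dabs2 th) - p)
      - fejer_prim n (phase (dabs2 th) - q) - (q - p)))
    (n%:R * (2 * expR (- (decay_rate lam (pi / ln b%:R) / 2 * ln N%:R)))).
Proof.
pose t (m : nat) := pi * m.+1%:R / ln b%:R : R.
pose F (m : 'I_n) th := fejer_coef R n m *
  (wabs a th * sin (t m * ln (dabs2 th) - 2 * pi * m.+1%:R * p) +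
   (-1) * (wabs a th * sin (t m * ln (dabs2 th) - 2 * pi * m.+1%:R * q))).
have HF m : osc (F m) (2 * expR (- (decay_rate lam (pi / ln b%:R) / 2 * ln N%:R))).
  have t0 : 0 < pi / ln b%:R :> R by rewrite divr_gt0.
  have tt : pi / ln b%:R <= `|t m|.
    rewrite ger0_norm; last by rewrite !mulr_ge0// ?invr_ge0 ltW.
    by rewrite /t ler_pM2r ?invr_gt0// -[leLHS]mulr1 ler_pM2l// ler1n.
  have -> : 2 * expR (- (decay_rate lam (pi / ln b%:R) / 2 * ln N%:R)) =
    expR (- (decay_rate lam (pi / ln b%:R) / 2 * ln N%:R)) +
    expR (- (decay_rate lam (pi / ln b%:R) / 2 * ln N%:R)) by rewrite mulr_natl mulr2n.
  apply: oscZ; first exact: fejer_coef_norm.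
  apply: oscD; first exact: osc_sin.
  by apply: oscZ; [rewrite normrN1|exact: osc_sin].
move=> e /(osc_sum HF)[K0 h]; exists K0 => K /h; apply: le_trans.
rewrite le_eqVlt; apply/orP; left; apply/eqP; congr `|_|; apply: eq_gsum => th.
rewrite fejer_diff_expand addrAC subrr add0r mulr_sumr; apply: eq_bigr => m _.
have E (r : R) : 2 * pi * m.+1%:R * (phase (dabs2 th) - r) =
    t m * ln (dabs2 th) - 2 * pi * m.+1%:R * r.
  rewrite /phase /t; move: lnb; move: (ln b%:R) (ln (dabs2 th)) m.+1%:R => u v w u0.
  by rewrite mulrBr; congr (_ - _); field; rewrite gt_eqF.
by rewrite /F !E; ring.
Qed.

End Oscillation.

Section Positivity.
Variable R : realType.
Let pi0 : 0 < (pi : R) := pi_gt0 R.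

Lemma iint_box (n : nat) (f : (nat -> R) -> \bar R) (c : nat -> R) (d k : R) :
  0 <= d -> 0 <= k ->
  (forall th, (0 <= f th)%E) -> (forall j, (j < n)%N -> 0 <= c j /\ c j + d <= 2 * pi) ->
  (forall th, (forall j, (j < n)%N -> c j <= th j < c j + d) -> (k%:E <= f th)%E) ->
  ((k * d ^+ n)%:E <= iint n f)%E.
Proof.
move=> d0 k0; elim: n f c => [|n IH] f c f0 hc hf /=.
  by rewrite expr0 mulr1; apply: hf.
have [c0 c2] := hc 0%N isT.
set I := `[c 0%N, c 0%N + d[%classic : set R.
have mI : measurable I by exact: measurable_itv.
have E : lebesgue_measure I = d%:E.
  rewrite /I lebesgue_measure_itv /= lte_fin ltrDl.
  case: ltP => [_|d1]; first by rewrite -EFinD addrAC subrr add0r.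
  by congr (_%:E); apply/eqP; rewrite eq_le d0 d1.
apply: (@le_trans _ _ (\int[lebesgue_measure]_(x in `[0%R, (2 * pi)%R[%classic)
   ((k * d ^+ n) * \1_I x)%:E)%E).
  under eq_integral do rewrite EFinM.
  rewrite ge0_integralZl_EFin//; last 2 first.
  - by apply/measurable_EFinP; apply: measurable_indic.
  - by rewrite mulr_ge0// exprn_ge0.
  rewrite integral_indic// setIidl; last first.
    move=> x; rewrite /I /= !in_itv /= => /andP[x1 x2].
    by rewrite (le_trans c0 x1) (lt_le_trans x2 c2).
  apply: (@le_trans _ _ ((k * d ^+ n)%:E * lebesgue_measure I)%E) => //.
  by rewrite E -EFinM lee_fin exprSr mulrA.
apply: ge0_le_integral_nonmeasurable => x /=.
  by move=> _; rewrite lee_fin mulr_ge0 ?indicE// mulr_ge0// exprn_ge0.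
move=> _; rewrite indicE; case: (boolP (x \in I)) => xI; last first.
  by rewrite mulr0; exact: iint_ge0.
rewrite mulr1; apply: (IH _ (fun j => c j.+1)) => //.
  by move=> j jn; exact: hc.
move=> th hth; apply: hf => -[_|j jn] /=; last exact: hth.
by move: xI; rewrite inE /I /= in_itv.
Qed.

Lemma chord2_gt0 (x : R) : 0 < x < 2 * pi -> 0 < chord2 x.
Proof.
move=> /andP[x0 x1].
have -> : chord2 x = 4 * sin (x / 2) ^+ 2.
  rewrite /chord2 {1}(splitr x) cosD -!expr2.
  have := cos2Dsin2 (x / 2); lra.
by rewrite mulr_gt0// exprn_gt0// sin_gt0_pi//; apply/andP; split; lra.
Qed.

(** At the [N] equally spaced points the weight is positive, and by uniform continuity it stays
    above half its value there on a small box. *)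
Lemma mom0_gt0 (N : nat) (theta lam : R) : 0 < lam -> 0 < mom N theta lam 0.
Proof.
move=> lam0.
have [N0|N0] := posnP N.
  subst N; rewrite /mom /iintR /= wabs0E big_ord0; exact: ltr01.
have Nr : 0 < N%:R :> R by rewrite ltr0n.
pose c (j : nat) : R := 2 * pi * j%:R / N%:R.
pose w0 := wabs theta lam 0 (fun j : 'I_N => c j).
have w00 : 0 < w0.
  rewrite /w0 wabs0E; apply: prodr_gt0 => j _; apply: prodr_gt0 => k kj.
  apply: powR_gt0.
  wlog jk : j k kj / (k < j)%N.
    move=> H; have := kj; rewrite -val_eqE neq_ltn => /orP[|kj']; first exact: H.
    by rewrite -chord2N opprB; apply: H => //; rewrite eq_sym.
  apply: chord2_gt0; rewrite /c -mulrBl -mulrBr -natrB 1?ltnW//.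
  rewrite divr_gt0 ?mulr_gt0 ?ltr0n ?subn_gt0//=.
  rewrite ltr_pdivrMr// ltr_pM2l ?mulr_gt0// ltr_nat.
  by apply: leq_ltn_trans (leq_subr _ _) (ltn_ord j).
have [_ uw] := bucont_wabs0 N theta lam0.
have [d d0 hd] := uw _ (divr_gt0 w00 (ltr0Sn _ 1)).
(* The second bound keeps the box inside the domain of integration: the last point is at
   [2 pi - 2 pi / N]. *)
pose d' := Num.min d (2 * pi / N%:R).
have d'0 : 0 < d' by rewrite lt_min d0 divr_gt0// mulr_gt0.
have [E _] := iint_gsum (@wabs_ge0 R N theta lam 0) uw.
have B := @iint_box N (fun th => (wabs theta lam 0 (fun j : 'I_N => th j))%:E) c d' (w0 / 2)
  (ltW d'0) (ltW (divr_gt0 w00 (ltr0Sn _ 1))).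
have {}B : ((w0 / 2 * d' ^+ N)%:E <= (mom N theta lam 0)%:E)%E.
  rewrite /mom -E; apply: B.
  - by move=> th; rewrite lee_fin wabs_ge0.
  - move=> j jN; split; first by rewrite divr_ge0// mulr_ge0// mulr_ge0// ltW.
    apply: le_trans (_ : c j + 2 * pi / N%:R <= _).
      by rewrite lerD2l ge_min lexx orbT.
    rewrite /c -mulrDl -{2}[2 * pi]mulr1 -mulrDr natr1 ler_pdivrMr//.
    by rewrite ler_pM2l ?mulr_gt0// ler_nat.
  move=> th hth; rewrite lee_fin.
  have close (j : 'I_N) : `|th j - c j| <= d.
    have /andP[h1 h2] := hth j (ltn_ord j).
    rewrite ger0_norm ?subr_ge0// lerBlDl; apply: le_trans (ltW h2) _.
    by rewrite lerD2l ge_min lexx.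
  have := hd (fun j : 'I_N => th j) (fun j : 'I_N => c j) close.
  rewrite -/w0 ler_distl => /andP[h1 _]; apply: le_trans h1.
  by rewrite {2}(splitr w0) addrK.
rewrite lee_fin in B; apply: lt_le_trans B.
by rewrite mulr_gt0 ?divr_gt0// exprn_gt0.
Qed.

End Positivity.

(** * Probability of a digit block *)

Section ProbabilityBounds.
Variables (R : realType) (N : nat) (theta lam : R) (b l : nat) (k : nat -> nat).
Hypotheses (lam0 : 0 < lam) (N0 : (0 < N)%N) (hb : (2 <= b)%N) (hl : (1 <= l)%N)
  (hk1 : (1 <= k 1%N <= b - 1)%N)
  (hk : forall j : nat, (2 <= j <= l)%N -> (k j <= b - 1)%N).
Variables (n : nat) (h : R).
Hypotheses (h0 : 0 < h) (h8 : h <= 1 / 8).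
Local Notation conf := ('I_N -> R).
Local Notation wabs := (@wabs R N theta lam).
Local Notation dabs2 := (@dabs2 R N theta).
Local Notation mom := (@mom R N theta lam).
Local Notation al := (dlow R b k l).
Local Notation al' := (dhigh R b k l).
Local Notation tau := (1 / (n.+1%:R * h ^+ 2) : R).
Local Notation rho := (expR (- (decay_rate lam (pi / ln b%:R) / 2 * ln N%:R)) : R).
Local Notation ev := (fun th : nat -> R => forall j : nat, (1 <= j <= l)%N ->
  bdigit b j (cmod (charpoly N th theta)) = (k j)%:Z).
Let pi0 : 0 < (pi : R) := pi_gt0 R.
Let lnb : 0 < ln b%:R :> R. Proof. by rewrite ln_gt0// ltr1n. Qed.
Let al1 : al <= al' := dlow_le_dhigh R hb hk1 hl hk.
Let al2 : al' <= al + 1.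
Proof. by apply: le_trans (dhigh_le1 R hb hk1 hl hk) _; rewrite lerDr dlow_ge0. Qed.
Let tau0 : 0 <= tau.
Proof. by rewrite divr_ge0// mulr_ge0// sqr_ge0. Qed.

(** Since [|D|^2 <= 4^N], this constant makes [cscale a * |D|^(2 a)] at most 1. For fixed [N] it
    tends to 1 with [a] tending to 0. *)
Definition cscale (a : R) : R := (4 ^+ N) `^ (- a).

Lemma cscale_gt0 a : 0 < cscale a.
Proof. by rewrite powR_gt0// exprn_gt0. Qed.

Lemma cscale_le1 a : 0 <= a -> cscale a <= 1.
Proof.
move=> a0; rewrite /cscale powRN invf_le1 ?powR_gt0 ?exprn_gt0//.
rewrite -[leLHS](powRr0 (4 ^+ N)); apply: ler_powR => //.
by rewrite exprn_ege1// ler1n.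
Qed.

Lemma cscale_dabs2 a th : 0 <= a -> cscale a * dabs2 th `^ a <= 1.
Proof.
move=> a0; rewrite /cscale powRN mulrC ler_pdivrMr ?powR_gt0 ?exprn_gt0// mul1r.
by apply: ge0_ler_powR; rewrite ?nnegrE ?dabs2_ge0 ?dabs2_le// exprn_ge0.
Qed.

Lemma ev_phase (th : nat -> R) : ev th <-> 0 < dabs2 (fun j => th j) /\
  exists m : int, al <= phase b (dabs2 (fun j => th j)) - m%:~R < al'.
Proof.
have DP := digitsP hb hk1 hl hk (cmod (charpoly N th theta)).
rewrite cmod_charpoly sqrtr_gt0 in DP.
have H (x : R) : 0 < x -> ln (Num.sqrt x) / ln b%:R = phase b x.
  move=> x0.
  have L : ln x = ln (Num.sqrt x) * 2.
    have s0 : 0 < Num.sqrt x by rewrite sqrtr_gt0.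
    by have := lnXn 2 s0; rewrite sqr_sqrtr ?ltW// => ->; rewrite mulr_natr.
  by rewrite /phase L mulfK.
split.
  move=> E; have /DP[x0 [m hm]] : forall j : nat, (1 <= j <= l)%N ->
      bdigit b j (Num.sqrt (dabs2 (fun i => th i))) = (k j)%:Z.
    by move=> j /E; rewrite cmod_charpoly.
  by split=> //; exists m; rewrite -H.
move=> [x0 [m hm]] j jl; rewrite cmod_charpoly; apply: DP.2 => //.
by split=> //; exists m; rewrite H.
Qed.

Lemma fejer_bounded (p q x : R) :
  `|fejer_prim n (x - p) - fejer_prim n (x - q)| <= `|q - p| + \sum_(m < n) 2.
Proof.
rewrite fejer_diff_expand; apply: le_trans (ler_normD _ _) _; rewrite lerD2l.
apply: le_trans (ler_norm_sum _ _ _) _; apply: ler_sum => m _.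
rewrite normrM -[leRHS]mul1r; apply: ler_pM => //; first exact: fejer_coef_norm.
apply: le_trans (ler_normB _ _) _.
have s1 (y : R) : `|sin y| <= 1 by rewrite ler_norml sin_geN1 sin_le1.
have := s1 (2 * pi * m.+1%:R * (x - p)); have := s1 (2 * pi * m.+1%:R * (x - q)); lra.
Qed.

Lemma continuous_fejer_phase (p x : R) : 0 < x ->
  {for x, continuous (fun x => fejer_prim n (phase b x - p))}.
Proof.
move=> x0.
have dG (z : R) := is_derive_fejer_prim n z.
apply: (@continuous_comp _ _ _ (fun x => phase b x - p) (fejer_prim n)); last first.
  by apply/differentiable_continuous/derivable1_diffP; apply: ex_derive.
apply: continuousB; last exact: cst_continuous.
apply: continuousM; last exact: cst_continuous.
apply: continuousM; last exact: cst_continuous.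
exact: continuous_ln.
Qed.

(** The phase has no limit at [x = 0], so the majorant is multiplied by [|x|^a], which restores
    continuity. The second term repairs the loss: on the event the majorant is at least 1, hence at
    least [cscale a], and the total is at least 1. *)
Definition upper_fun (a x : R) : R :=
  `|x| `^ a * upper_fejer n al al' h (phase b `|x|) + (1 - cscale a * `|x| `^ a).

Definition lower_fun (a x : R) : R :=
  cscale a * (`|x| `^ a * Num.max 0 (lower_fejer n al al' h (phase b `|x|))).

Lemma upper_fejerE x : upper_fejer n al al' h x =
  fejer_prim n (x - (al - h)) - fejer_prim n (x - (al' + h)) + tau.
Proof.
rewrite /upper_fejer; have -> : x - (al - h) = x - al + h by ring.
by have -> : x - (al' + h) = x - al' - h by ring.
Qed.

Lemma lower_fejerE x : lower_fejer n al al' h x =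
  fejer_prim n (x - (al + h)) - fejer_prim n (x - (al' - h)) - tau.
Proof.
rewrite /lower_fejer; have -> : x - (al + h) = x - al - h by ring.
by have -> : x - (al' - h) = x - al' + h by ring.
Qed.

Lemma continuous_upper_fun a : 0 < a -> continuous (upper_fun a).
Proof.
move=> a0 x; rewrite /upper_fun; apply: cvgD.
  apply: (@continuous_powR_mul R a (fun x => upper_fejer n al al' h (phase b x))
    (`|(al' + h) - (al - h)| + \sum_(m < n) 2 + `|tau|)) => //.
    move=> y; rewrite upper_fejerE; apply: le_trans (ler_normD _ _) _.
    by rewrite lerD2r fejer_bounded.
  move=> y y0; rewrite (_ : (fun x => upper_fejer n al al' h (phase b x)) =
    (fun x => fejer_prim n (phase b x - (al - h)) -
              fejer_prim n (phase b x - (al' + h)) + tau)); last first.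
    by apply/funext => z; rewrite upper_fejerE.
  apply: continuousD; last exact: cst_continuous.
  by apply: continuousB; exact: continuous_fejer_phase.
apply: cvgB; first exact: cvg_cst.
by apply: cvgM; [exact: cvg_cst|exact: continuous_abs_powR].
Qed.

Lemma continuous_lower_fun a : 0 < a -> continuous (lower_fun a).
Proof.
move=> a0 x; rewrite /lower_fun; apply: cvgM; first exact: cvg_cst.
apply: (@continuous_powR_mul R a
  (fun x => Num.max 0 (lower_fejer n al al' h (phase b x)))
  (`|(al' - h) - (al + h)| + \sum_(m < n) 2 + `|tau|)) => //.
  move=> y.
  have H : `|lower_fejer n al al' h (phase b y)| <=
      `|(al' - h) - (al + h)| + \sum_(m < n) 2 + `|tau|.
    rewrite lower_fejerE; apply: le_trans (ler_normB _ _) _.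
    by rewrite lerD2r fejer_bounded.
  apply: le_trans H; case: (leP 0 (lower_fejer n al al' h (phase b y))) => // _.
  by rewrite normr0.
move=> y y0.
apply: (@continuous_max _ _ (fun=> 0)); first exact: cst_continuous.
rewrite (_ : (fun x => lower_fejer n al al' h (phase b x)) =
    (fun x => fejer_prim n (phase b x - (al + h)) -
              fejer_prim n (phase b x - (al' - h)) - tau)); last first.
  by apply/funext => z; rewrite lower_fejerE.
apply: continuousB; last exact: cst_continuous.
by apply: continuousB; exact: continuous_fejer_phase.
Qed.

Lemma upper_fun_ge0 a th : 0 <= a -> 0 <= upper_fun a (dabs2 th).
Proof.
move=> a0; rewrite /upper_fun ger0_norm ?dabs2_ge0//.
by rewrite addr_ge0 ?mulr_ge0 ?powR_ge0 ?upper_fejer_ge0// subr_ge0 cscale_dabs2.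
Qed.

Lemma lower_fun_ge0 a th : 0 <= lower_fun a (dabs2 th).
Proof.
by rewrite /lower_fun !mulr_ge0 ?powR_ge0// ?(ltW (cscale_gt0 _))// le_max lexx.
Qed.

Lemma indic_le_upper a (th : nat -> R) : 0 <= a ->
  \1_ev th * wabs 0 (fun j => th j) <=
  upper_fun a (dabs2 (fun j => th j)) * wabs 0 (fun j => th j).
Proof.
move=> a0; rewrite ler_wpM2r ?wabs_ge0// indicE.
case: (boolP (th \in _)) => [|_]; last exact: upper_fun_ge0.
rewrite inE => /ev_phase[x0 [m hm]]; rewrite /upper_fun gtr0_norm//.
have g1 := upper_fejer_ge1 n h0 h8 hm.
set x := dabs2 _ in x0 *; set g := upper_fejer _ _ _ _ _ in g1 *.
have c1 := cscale_le1 a0.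
have : 0 <= x `^ a * (g - cscale a).
  by rewrite mulr_ge0 ?powR_ge0// subr_ge0 (le_trans c1).
rewrite mulrBr subr_ge0 [_ * cscale a]mulrC => i.
by rewrite addrCA lerDl subr_ge0.
Qed.

Lemma lower_le_indic a (th : nat -> R) : 0 < a ->
  lower_fun a (dabs2 (fun j => th j)) * wabs 0 (fun j => th j) <=
  \1_ev th * wabs 0 (fun j => th j).
Proof.
move=> a0; rewrite ler_wpM2r ?wabs_ge0// indicE.
rewrite /lower_fun ger0_norm ?dabs2_ge0// mulrA.
case: (boolP (th \in _)) => [_|].
  rewrite -[leRHS]mulr1; apply: ler_pM.
  - by rewrite mulr_ge0 ?powR_ge0// ltW ?cscale_gt0.
  - by rewrite le_max lexx.
  - by rewrite cscale_dabs2// ltW.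
  - by rewrite ge_max ler01 lower_fejer_le1.
rewrite notin_setE => nE.
have [x0|xn0] := eqVneq (dabs2 (fun j => th j)) 0.
  by rewrite x0 powR0 ?gt_eqF// mulr0 mul0r.
have x0 : 0 < dabs2 (fun j => th j) by rewrite lt_neqAle eq_sym xn0 dabs2_ge0.
rewrite (_ : Num.max _ _ = 0) ?mulr0//; apply/max_idPl.
apply: lower_fejer_le0 => // m hm; apply: nE; apply/ev_phase; split => //.
by exists m.
Qed.

Lemma upper_mom a : 0 < a -> 2 * a <= 1 ->
  iintR (fun th => upper_fun a (dabs2 th) * wabs 0 th) <=
  (al' - al + 2 * h + tau + n%:R * (2 * rho) - cscale a) * mom a + mom 0.
Proof.
move=> a0 a1; have a0' := ltW a0.
set c := (_ - cscale a).
have cF := @cvg_lsum R N (fun th => upper_fun a (dabs2 th) * wabs 0 th)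
  (fun th => mulr_ge0 (upper_fun_ge0 th a0') (wabs_ge0 _ _ _ _))
  (bucont_weighted N theta lam0 (continuous_upper_fun a0)).
apply/ler_addgt0Pr => e e0.
have cG : c * lsum K (wabs a) + lsum K (wabs 0) + e @[K --> \oo] -->
    c * mom a + mom 0 + e.
  apply: cvgD; last exact: cvg_cst; apply: cvgD; last exact: cvg_mom.
  by apply: cvgM; [exact: cvg_cst|exact: cvg_mom].
apply: (ler_cvg_to cF cG).
have e' : 0 < e / (2 * pi) ^+ N by rewrite divr_gt0// exprn_gt0// mulr_gt0.
have [K0 H] := osc_fejer theta lam0 N0 a0 a1 hb n (al - h) (al' + h) e'.
exists (maxn K0 1) => // K /=; rewrite geq_max => /andP[/H {}H K1].
move: H => /(le_trans (ler_norm _)) /(lsum_gsum_le K1).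
rewrite divfK; last by rewrite gt_eqF// exprn_gt0// mulr_gt0.
set r := n%:R * (2 * rho); rewrite mulrCA -/(lsum K _) -/(lsum K _) => H.
have -> : lsum K (fun th => upper_fun a (dabs2 th) * wabs 0 th) =
   lsum K (fun th => wabs a th * (fejer_prim n (phase b (dabs2 th) - (al - h))
      - fejer_prim n (phase b (dabs2 th) - (al' + h)) - ((al' + h) - (al - h))))
   + ((al' + h) - (al - h) + tau - cscale a) * lsum K (wabs a) + lsum K (wabs 0).
  rewrite -lsumZ -!lsumD; congr lsum; apply/funext => th.
  rewrite /upper_fun upper_fejerE ger0_norm ?dabs2_ge0// (wabsE theta lam th a0').
  ring.
rewrite /c -/r; move: H; move: r (lsum K (wabs a)) (lsum K (wabs 0)) (lsum K _) => r A B C.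
move: tau al al' (cscale a) => T u v w; lra.
Qed.

Lemma lower_mom a : 0 < a -> 2 * a <= 1 ->
  cscale a * ((al' - al - 2 * h - tau - n%:R * (2 * rho)) * mom a) <=
  iintR (fun th => lower_fun a (dabs2 th) * wabs 0 th).
Proof.
move=> a0 a1; have a0' := ltW a0.
set c := (_ - _ * _).
have cF := @cvg_lsum R N (fun th => lower_fun a (dabs2 th) * wabs 0 th)
  (fun th => mulr_ge0 (lower_fun_ge0 a th) (wabs_ge0 _ _ _ _))
  (bucont_weighted N theta lam0 (continuous_lower_fun a0)).
apply/ler_addgt0Pr => e e0.
have cF' : lsum K (fun th => lower_fun a (dabs2 th) * wabs 0 th) + e
    @[K --> \oo] --> iintR (fun th => lower_fun a (dabs2 th) * wabs 0 th) + e.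
  by apply: cvgD cF _; exact: cvg_cst.
have cG : cscale a * (c * lsum K (wabs a)) @[K --> \oo] --> cscale a * (c * mom a).
  apply: cvgM; first exact: cvg_cst.
  by apply: cvgM; [exact: cvg_cst|exact: cvg_mom].
apply: (ler_cvg_to cG cF').
have e' : 0 < e / (2 * pi) ^+ N by rewrite divr_gt0// exprn_gt0// mulr_gt0.
have [K0 H] := osc_fejer theta lam0 N0 a0 a1 hb n (al + h) (al' - h) e'.
exists (maxn K0 1) => // K /=; rewrite geq_max => /andP[/H {}H K1].
move: H; rewrite -normrN => /(le_trans (ler_norm _)) /(lsum_gsum_le K1).
rewrite divfK; last by rewrite gt_eqF// exprn_gt0// mulr_gt0.
set r := n%:R * (2 * rho); rewrite mulrCA mulrN -/(lsum K _) -/(lsum K _) => H.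
apply: le_trans (_ : cscale a * lsum K (fun th => wabs a th *
   lower_fejer n al al' h (phase b (dabs2 th))) + e <= _); last first.
  rewrite lerD2r -lsumZ; apply: ler_lsum => th.
  rewrite /lower_fun ger0_norm ?dabs2_ge0// (wabsE theta lam th a0').
  set g := lower_fejer _ _ _ _ _; set x := dabs2 th `^ a; set w := wabs 0 th.
  have -> : cscale a * (x * w * g) = cscale a * (x * g) * w by ring.
  rewrite ler_wpM2r ?wabs_ge0// ler_pM2l ?cscale_gt0// ler_wpM2l ?powR_ge0//.
  by rewrite le_max lexx orbT.
have -> : lsum K (fun th => wabs a th * lower_fejer n al al' h (phase b (dabs2 th))) =
   lsum K (fun th => wabs a th * (fejer_prim n (phase b (dabs2 th) - (al + h))
      - fejer_prim n (phase b (dabs2 th) - (al' - h)) - ((al' - h) - (al + h))))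
   + ((al' - h) - (al + h) - tau) * lsum K (wabs a).
  rewrite -lsumZ -!lsumD; congr lsum; apply/funext => th.
  by rewrite lower_fejerE; ring.
have c1 := cscale_le1 a0'; have c0 := cscale_gt0 a.
have i : c * lsum K (wabs a) <=
   lsum K (fun th => wabs a th * (fejer_prim n (phase b (dabs2 th) - (al + h))
      - fejer_prim n (phase b (dabs2 th) - (al' - h)) - ((al' - h) - (al + h))))
   + ((al' - h) - (al + h) - tau) * lsum K (wabs a) + e.
  rewrite /c -/r; move: H; move: r (lsum K (wabs a)) (lsum K _) => r A C.
  move: tau al al' => T u v; lra.
apply: le_trans (ler_wpM2l (ltW c0) i) _; rewrite mulrDr lerD2l.
by rewrite ler_piMl// ltW.
Qed.

Lemma mom_upper a : 0 <= a -> cscale a * mom a <= mom 0.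
Proof.
move=> a0.
have cA : cscale a * lsum K (wabs a) @[K --> \oo] --> cscale a * mom a.
  by apply: cvgM; [exact: cvg_cst|exact: cvg_mom].
have c0 : lsum K (wabs 0) @[K --> \oo] --> mom 0 by exact: cvg_mom.
apply: (ler_cvg_to cA c0); apply: nearW => K.
rewrite -lsumZ; apply: ler_lsum => th; rewrite (wabsE theta lam th a0) mulrA.
by rewrite ler_piMl ?wabs_ge0// cscale_dabs2.
Qed.

(** Three losses must fit into [z]: [cscale a] costs [a N ln 4] in the exponent, the factors
    [(1 + 2 a)^N] of [mom_lower] cost [4 a N], and [1 - a] costs [a]. They add up to [a * M], which
    the choice of [a] makes equal to [z / 2]. *)
Lemma mom_close z : 0 < z -> z <= 1 -> exists a : R,
  [/\ 0 < a, 2 * a <= 1, 1 - z <= cscale a & (1 - z) * mom 0 <= cscale a * mom a].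
Proof.
move=> z0 z1.
have l4 : 0 <= ln 4 :> R by rewrite ln_ge0// ler1n.
pose M : R := N%:R * (ln 4 + 4) + 1.
have M1 : 1 <= M by rewrite /M lerDr mulr_ge0// addr_ge0.
pose a := z / (2 * M).
have M0 : 0 < M by lra.
have a0 : 0 < a by rewrite divr_gt0// mulr_gt0.
have aM : a * M = z / 2 by rewrite /a; field; rewrite gt_eqF.
have a1 : 2 * a <= 1 by nra.
have cE : cscale a = expR (- (a * (N%:R * ln 4))).
  rewrite /cscale /powR gt_eqF ?exprn_gt0// lnXn// -mulr_natr mulNr.
  by congr (expR (- _)); ring.
have Mle : a * (N%:R * ln 4) + 4 * a * N%:R + a = a * M by rewrite /M; ring.
have aN0 : 0 <= a * N%:R by rewrite mulr_ge0// ltW.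
have aN4 : 0 <= a * (N%:R * ln 4) by apply: mulr_ge0; [exact: ltW|exact: mulr_ge0].
exists a; split => //.
  by rewrite cE; apply: le_trans (expR_ge1Dx _); lra.
have m0 := mom0_gt0 N theta lam0.
have ml := mom_lower N theta lam0 (ltW a0) (_ : a <= 1).
have {}ml := ml ltac:(lra).
have p1 : (1 + 2 * a) ^+ N * (1 + 2 * a) ^+ N <= expR (4 * a * N%:R).
  rewrite -exprD.
  apply: le_trans (_ : expR (2 * a) ^+ (N + N) <= _).
    by apply: lerXn2r; rewrite ?nnegrE ?expR_ge0 ?expR_ge1Dx//; lra.
  by rewrite -expRM_natl ler_expR natrD; lra.
have ma : 0 <= mom a by apply: iintR_ge0 => th; exact: wabs_ge0.
have i1 : (1 - a) * mom 0 <= expR (4 * a * N%:R) * mom a.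
  by apply: le_trans ml _; rewrite ler_wpM2r.
have i2 : expR (- (4 * a * N%:R)) * ((1 - a) * mom 0) <= mom a.
  apply: le_trans (ler_wpM2l (expR_ge0 _) i1) _.
  by rewrite mulrA -expRD addNr expR0 mul1r.
apply: le_trans (ler_wpM2l (ltW (cscale_gt0 a)) i2).
rewrite cE mulrA -expRD mulrA ler_pM2r//.
have e1 : 1 - (a * (N%:R * ln 4) + 4 * a * N%:R) <=
    expR (- (a * (N%:R * ln 4)) - 4 * a * N%:R).
  by apply: le_trans (expR_ge1Dx _); lra.
have a1' : 0 <= 1 - a by lra.
apply: le_trans (ler_wpM2r a1' e1).
nra.
Qed.

(** The right side does not involve [a]. Both sandwich bounds therefore hold up to factors close to
    1 that are made harmless by letting [z], and [a] with it, tend to 0 at fixed [N]. *)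
Lemma cbe_prob_bound :
  `|cbe_prob N (2 * lam) ev - (al' - al)| <= 2 * h + tau + n%:R * (2 * rho).
Proof.
have m0 := mom0_gt0 N theta lam0.
have [_ uw] := bucont_wabs0 N theta lam0.
have [Ew _] := iint_gsum (@wabs_ge0 R N theta lam 0) uw.
have Ed : iint N (fun th => (cbe_weight N (2 * lam) th)%:E) = (mom 0)%:E.
  by rewrite -Ew; congr iint; apply/funext => th; rewrite (cbe_weightE N theta lam).
set J := iint N (fun th => (\1_ev th * cbe_weight N (2 * lam) th)%:E).
have JE : J = iint N (fun th => (\1_ev th * wabs 0 (fun j => th j))%:E).
  by congr iint; apply/funext => th; rewrite (cbe_weightE N theta lam).
have iint_mono (f g : (nat -> R) -> \bar R) : (forall th, (0 <= f th)%E) ->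
    (forall th, (f th <= g th)%E) -> (iint N f <= iint N g)%E.
  elim: (N) f g => [|m IH] f g f0 fg //=.
  by apply: ge0_le_integral_nonmeasurable => x _; [exact: iint_ge0|exact: IH].
have J0 : (0 <= J)%E.
  by rewrite JE; apply: iint_ge0 => th; rewrite lee_fin mulr_ge0 ?indicE ?wabs_ge0.
have up a : 0 < a -> (J <= (iintR (fun th => upper_fun a (dabs2 th) * wabs 0 th))%:E)%E.
  move=> a0; have [_ uF] := bucont_weighted N theta lam0 (continuous_upper_fun a0).
  have [<- _] := iint_gsum (fun th => mulr_ge0 (upper_fun_ge0 th (ltW a0))
    (wabs_ge0 _ _ _ _)) uF.
  rewrite JE; apply: iint_mono => th; rewrite lee_fin; last exact/indic_le_upper/ltW.
  by rewrite mulr_ge0 ?indicE ?wabs_ge0.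
have lo a : 0 < a -> ((iintR (fun th => lower_fun a (dabs2 th) * wabs 0 th))%:E <= J)%E.
  move=> a0; have [_ uF] := bucont_weighted N theta lam0 (continuous_lower_fun a0).
  have [<- _] := iint_gsum (fun th => mulr_ge0 (lower_fun_ge0 a th)
    (wabs_ge0 _ _ _ _)) uF.
  rewrite JE; apply: iint_mono => th; rewrite lee_fin; last exact/lower_le_indic.
  by rewrite mulr_ge0 ?lower_fun_ge0 ?wabs_ge0.
(* The majorant at exponent 1 shows that [J] is finite, so [fine] in [cbe_prob] loses nothing. *)
have finJ : J = (fine J)%:E.
  rewrite fineK// fin_numE; apply/andP; split.
    by rewrite gt_eqF//; apply: lt_le_trans J0; exact: ltNyr.
  by rewrite lt_eqF//; apply: le_lt_trans (up _ ltr01) _; exact: ltry.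
have P : cbe_prob N (2 * lam) ev = fine J / mom 0 by rewrite /cbe_prob Ed.
set j := fine J in finJ P; rewrite {}P.
have j0 : 0 <= j by rewrite -lee_fin -finJ.
set D := al' - al; have D0 : 0 <= D by rewrite subr_ge0.
set e := 2 * h + tau + n%:R * (2 * rho).
have e0 : 0 <= e.
  apply: addr_ge0; first by apply: addr_ge0 => //; rewrite mulr_ge0// ltW.
  by rewrite mulr_ge0// mulr_ge0// expR_ge0.
rewrite ler_distl; apply/andP; split.
  apply/ler_addgt0Pr => z0 z00.
  pose z := Num.min 1 (z0 / (D + 1)).
  have D1 : 0 < D + 1 by rewrite ltr_wpDl.
  have z1 : 0 < z by rewrite lt_min ltr01 divr_gt0.
  have z2 : z <= 1 by rewrite ge_min lexx.
  have zD : z * (D + 1) <= z0 by rewrite -ler_pdivlMr// ge_min lexx orbT.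
  have [a [a0 a1 c1 cm]] := mom_close z1 z2.
  have := le_trans (lower_mom a0 a1) (_ : _ <= j).
  rewrite -lee_fin -finJ => /(_ (lo _ a0)).
  have -> : al' - al - 2 * h - tau - n%:R * (2 * rho) = D - e.
    by rewrite /e /D; ring.
  rewrite mulrCA => H; rewrite -lerBlDr ler_pdivlMr//.
  have [De|De] := leP 0 (D - e); last first.
    by apply: le_trans j0; rewrite pmulr_lle0//; lra.
  apply: le_trans H; apply: le_trans (_ : (D - e) * ((1 - z) * mom 0) <= _).
    rewrite mulrA ler_pM2r//; nra.
  by rewrite ler_wpM2l.
apply/ler_addgt0Pr => z0 z00.
pose S := D + e; have S0 : 0 <= S by exact: addr_ge0.
(* Bounding [mom a] by [(1 + 2 z) mom 0] costs [2 z S], and bounding [cscale a * mom a] below costs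
   [z]. The cap [1 / 2] ensures [(1 + 2 z) (1 - z) >= 1]. *)
pose z := Num.min (1 / 2) (z0 / (2 * S + 1)).
have S1 : 0 < 2 * S + 1 by rewrite ltr_wpDl// mulr_ge0.
have z1 : 0 < z by rewrite lt_min !divr_gt0.
have z2 : z <= 1 / 2 by rewrite ge_min lexx.
have zS : z * (2 * S + 1) <= z0 by rewrite -ler_pdivlMr// ge_min lexx orbT.
have z3 : z <= 1 by lra.
have [a [a0 a1 c1 cm]] := mom_close z1 z3.
have : j <= S * mom a - cscale a * mom a + mom 0.
  rewrite -lee_fin -finJ; apply: le_trans (up _ a0) _; rewrite lee_fin.
  apply: le_trans (upper_mom a0 a1) _; rewrite le_eqVlt; apply/orP; left; apply/eqP.
  by rewrite /S /e /D; ring.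
move=> H; rewrite ler_pdivrMr//; apply: le_trans H _.
have mu := mom_upper (ltW a0).
have ma : mom a <= (1 + 2 * z) * mom 0.
  have ma0 : 0 <= mom a by apply: iintR_ge0 => th; exact: wabs_ge0.
  have q : (1 - z) * mom a <= mom 0 by apply: le_trans mu; rewrite ler_wpM2r.
  have : (1 + 2 * z) * ((1 - z) * mom a) <= (1 + 2 * z) * mom 0.
    by rewrite ler_pM2l//; lra.
  apply: le_trans; have : 0 <= z * (1 - 2 * z) * mom a.
    by rewrite !mulr_ge0//; lra.
  lra.
have i1 : S * mom a <= S * ((1 + 2 * z) * mom 0) by rewrite ler_wpM2l.
have i2 : z * (2 * S + 1) * mom 0 <= z0 * mom 0 by rewrite ler_pM2r.
rewrite -/S; move: i1 i2 cm; move: (cscale a * mom a) (mom 0) => X Y.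
by lra.
Qed.

End ProbabilityBounds.

(** * Choice of the parameters and the final rate *)

Lemma expR_neg_le_pow (R : realType) (c x : R) (m : nat) : 0 < c -> 0 < x ->
  expR (- (c * x)) <= m.+1`!%:R / c ^+ m.+1 / x ^+ m.+1.
Proof.
move=> c0 x0.
have F0 : 0 < m.+1`!%:R :> R by rewrite ltr0n fact_gt0.
have y0 : 0 < (c * x) ^+ m.+1 by rewrite exprn_gt0// mulr_gt0.
have h : (c * x) ^+ m.+1 / m.+1`!%:R <= expR (c * x).
  by apply: le_trans (expR_ge1Dxn m (ltW (mulr_gt0 c0 x0))); rewrite lerDr.
rewrite expRN; apply: le_trans (_ : ((c * x) ^+ m.+1 / m.+1`!%:R)^-1 <= _).
  by rewrite lef_pV2 ?posrE ?expR_gt0 ?divr_gt0.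
by rewrite invf_div exprMn invfM mulrA.
Qed.

(** With [x = ln N], width [h = x^-2] and order about [x^6], the tail [1 / (n h^2)] is again at most
    [h]. The exponential is bounded by its eighth-order term, [8 = 6 + 2], so that after
    multiplication by [n] it is also of order [h]. The total is a constant times [x^-2], and for
    large [x] a spare factor [x^(1/2)] absorbs that constant over [delta]. *)
Lemma rate_bound (R : realType) (c delta eps x : R) :
  0 < c -> 0 < delta -> 0 < eps -> 3 <= x ->
  ((3 + 2 * (8`!%:R / c ^+ 8)) / delta) ^+ 2 <= x ->
  2 * (x ^+ 2)^-1 + 1 / ((Num.truncn (x ^+ 6)).+1%:R * (x ^+ 2)^-1 ^+ 2) +
    (Num.truncn (x ^+ 6))%:R * (2 * expR (- (c * x))) <=
  delta * x `^ (- (3%:R / 2) + eps).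
Proof.
move=> c0 d0 e0 x3 xC; set n := Num.truncn _; set h := (x ^+ 2)^-1.
have x0 : 0 < x by lra.
have x1 : 1 <= x by lra.
set F := 8`!%:R / c ^+ 8 in xC *.
have F0 : 0 <= F by rewrite divr_ge0// exprn_ge0// ltW.
have x6 : 0 <= x ^+ 6 by rewrite exprn_ge0// ltW.
have h0 : 0 < h by rewrite invr_gt0 exprn_gt0.
have i1 : 1 / (n.+1%:R * h ^+ 2) <= h.
  have n1 : x ^+ 6 <= n.+1%:R by apply/ltW; exact: truncnS_gt.
  rewrite ler_pdivrMr; last by rewrite mulr_gt0// exprn_gt0.
  apply: le_trans (_ : h * (x ^+ 6 * h ^+ 2) <= _); last first.
    by rewrite ler_pM2l// ler_pM2r// exprn_gt0.
  by rewrite le_eqVlt; apply/orP; left; apply/eqP; rewrite /h; field; rewrite gt_eqF.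
have i2 : n%:R * (2 * expR (- (c * x))) <= 2 * F * h.
  have n2 : n%:R <= x ^+ 6 by rewrite truncn_le.
  apply: le_trans (_ : x ^+ 6 * (2 * (F / x ^+ 8)) <= _).
    apply: ler_pM => //.
    by rewrite ler_pM2l//; exact: expR_neg_le_pow.
  by rewrite le_eqVlt; apply/orP; left; apply/eqP; rewrite /h; field; rewrite gt_eqF.
apply: le_trans (_ : (3 + 2 * F) * h <= _).
  apply: le_trans (_ : 2 * h + h + 2 * F * h <= _); first by rewrite !lerD.
  by rewrite le_eqVlt; apply/orP; left; apply/eqP; ring.
set C := 3 + 2 * F in xC *.
have C0 : 0 < C by rewrite /C; lra.
have i3 : C <= delta * x `^ (1 / 2).
  rewrite mulrC -ler_pdivrMr//.
  have Cd : 0 < C / delta by rewrite divr_gt0.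
  have -> : C / delta = ((C / delta) ^+ 2) `^ (1 / 2).
    have E2 : 2%:R * (1 / 2) = 1 :> R by field.
    by rewrite -powR_mulrn ?(ltW Cd)// -powRrM E2 powRr1// ltW.
  apply: ge0_ler_powR => //; rewrite ?nnegrE ?sqr_ge0// ltW//.
have hE : h = x `^ (- 2) by rewrite powRN powR_mulrn ?ltW.
apply: le_trans (_ : delta * x `^ (1 / 2) * h <= _); first by rewrite ler_pM2r.
rewrite hE -mulrA ler_pM2l// -powRD ?(gt_eqF x0) ?implybT//.
by apply: ler_powR => //; lra.
Qed.
Theorem theorem1p1 (R : realType) (beta : R) (b : nat) (theta : R)
  (hbeta : 0 < beta) (hb : (2 <= b)%N)
  (htheta0 : 0 <= theta) (htheta1 : theta < 2 * pi)
  (l : nat) (k : nat -> nat) (hl : (1 <= l)%N)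
  (hk1 : (1 <= k 1%N <= b - 1)%N)
  (hk : forall j : nat, (2 <= j <= l)%N -> (k j <= b - 1)%N)
  (eps : R) (heps : 0 < eps) :
  forall delta : R, 0 < delta -> exists N0 : nat, forall N : nat, (N0 <= N)%N ->
    `| cbe_prob N beta
         (fun th => forall j : nat, (1 <= j <= l)%N ->
            bdigit b j (cmod (charpoly N th theta)) = (k j)%:Z)
       - ln (1 + ((\sum_(1 <= j < l.+1) k j * b ^ (l - j))%N%:R)^-1) / ln b%:R |
    <= delta * (ln N%:R) `^ (- (3%:R / 2) + eps).
Proof.
move=> delta d0.
set lam := beta / 2.
have lam0 : 0 < lam by rewrite divr_gt0.
have bE : beta = 2 * lam by rewrite /lam mulrC divfK.
have lnb : 0 < ln b%:R :> R by rewrite ln_gt0// ltr1n.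
pose c := decay_rate lam (pi / ln b%:R) / 2.
have c0 : 0 < c by rewrite divr_gt0// decay_rate_gt0// divr_gt0// pi_gt0.
pose C := ((3 + 2 * (8`!%:R / c ^+ 8)) / delta) ^+ 2.
(* The bound [ln N >= 3] gives [h <= 1 / 9], within the range [1 / 8] of the Fejer tail; [ln N >= C]
   is what [rate_bound] requires. *)
exists (Num.truncn (expR (Num.max 3 C))).+1 => N hN.
have NE : expR (Num.max 3 C) < N%:R.
  by apply: lt_le_trans (truncnS_gt _) _; rewrite ler_nat.
have N1 : 0 < N%:R :> R by apply: le_lt_trans NE; exact: expR_ge0.
have N0 : (0 < N)%N by rewrite -(ltr0n R).
have xm : Num.max 3 C <= ln N%:R by rewrite -ler_expR lnK ?posrE// ltW.
have x3 : 3 <= ln N%:R :> R by apply: le_trans xm; rewrite le_max lexx.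
have xC : C <= ln N%:R by apply: le_trans xm; rewrite le_max lexx orbT.
set x := ln N%:R in x3 xC *.
have x0 : 0 < x by lra.
have h0 : 0 < (x ^+ 2)^-1 by rewrite invr_gt0 exprn_gt0.
have h8 : (x ^+ 2)^-1 <= 1 / 8.
  by rewrite div1r lef_pV2 ?posrE ?exprn_gt0//; nra.
have H := @cbe_prob_bound R N theta lam b l k lam0 N0 hb hl hk1 hk
  (Num.truncn (x ^+ 6)) (x ^+ 2)^-1 h0 h8.
apply: le_trans (rate_bound c0 d0 heps x3 xC).
by move: H; rewrite dhighB// -bE.
Qed.
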